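(* Let $T>0$, $k=T/N$ with $N\in\mathbb{N}$, $h_x,h_y>0$, and $\widehat h=\min\{h_x,h_y\}$. Assume that $0\le\rho_x,\rho_y<1$, $-1\le\rho_{xy}\le 1$ and $$2\rho_x^2(1+2|\rho_{xy}|)<1,\qquad 2\rho_y^2(1+2|\rho_{xy}|)<1,\qquad 2\rho_x\rho_y(3\rho_{xy}^2+2|\rho_{xy}|+1)<1 .$$ Then there exists $\theta\in(0,1)$, independent of $h_x,h_y$ and $k$, such that, if $$\theta^{T/k}\le 2^{-C_0}\,\widehat h^{\,4+\beta}$$ for some $\beta,C_0>0$ independent of $h_x,h_y$ and $k$, then the error of the implicit Milstein scheme (defined in the context) at time $T$ satisfies, for all $i,j\in\mathbb{Z}$, $$\sqrt{\mathbb{E}\big[|V_{i,j}^N-v(T,ih_x,jh_y)|^2\big]}=O(h_x^2)+O(h_y^2)+O(k).$$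
   Context: **SPDE.** Let $x_0,y_0,\mu_x,\mu_y\in\mathbb{R}$, and let $M^x,M^y$ be standard Brownian motions with $\mathrm{d}\langle M^x,M^y\rangle_t=\rho_{xy}\,\mathrm{d}t$. Consider on $(0,T]\times\mathbb{R}^2$ $$\mathrm{d}v=-\mu_x\tfrac{\partial v}{\partial x}\mathrm{d}t-\mu_y\tfrac{\partial v}{\partial y}\mathrm{d}t+\tfrac12\Big(\tfrac{\partial^2 v}{\partial x^2}+2\sqrt{\rho_x\rho_y}\rho_{xy}\tfrac{\partial^2 v}{\partial x\partial y}+\tfrac{\partial^2 v}{\partial y^2}\Big)\mathrm{d}t-\sqrt{\rho_x}\tfrac{\partial v}{\partial x}\mathrm{d}M^x_t-\sqrt{\rho_y}\tfrac{\partial v}{\partial y}\mathrm{d}M^y_t$$ with Dirac initial data $v(0,x,y)=\delta(x-x_0)\delta(y-y_0)$. Its solution is $$v(t,x,y)=\frac{\exp\Big(-\frac{(x-x_0-\mu_x t-\sqrt{\rho_x}M_t^x)^2}{2(1-\rho_x)t}-\frac{(y-y_0-\mu_y t-\sqrt{\rho_y}M_t^y)^2}{2(1-\rho_y)t}\Big)}{2\pi\sqrt{(1-\rho_x)(1-\rho_y)}\,t}.$$ **Grid.** The grid points are $(ih_x,jh_y)$, $i,j\in\mathbb{Z}$, with $h_x,h_y$ chosen such that $i_0=x_0/h_x$ and $j_0=y_0/h_y$ are integers. $V^n_{i,j}$ approximates $v(nk,ih_x,jh_y)$. Initial value: $V^0_{i,j}=h_x^{-1}h_y^{-1}$ if $(i,j)=(i_0,j_0)$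 and $V^0_{i,j}=0$ otherwise. **Difference operators.** $(D_xV)_{i,j}=V_{i+1,j}-V_{i-1,j}$, $(D_yV)_{i,j}=V_{i,j+1}-V_{i,j-1}$, $(D_{xx}V)_{i,j}=V_{i+1,j}-2V_{i,j}+V_{i-1,j}$, $(D_{yy}V)_{i,j}=V_{i,j+1}-2V_{i,j}+V_{i,j-1}$, $(D_{xy}V)_{i,j}=V_{i+1,j+1}-V_{i-1,j+1}-V_{i+1,j-1}+V_{i-1,j-1}$; $D_x^2=D_xD_x$, $D_y^2=D_yD_y$. **Noise.** $\sqrt{k}Z_{n,x}=M^x_{(n+1)k}-M^x_{nk}$, $\sqrt{k}\widetilde Z_{n,y}=M^y_{(n+1)k}-M^y_{nk}$ (so $Z_{n,x},\widetilde Z_{n,y}$ are standard normal with correlation $\rho_{xy}$, independent over $n$). **Implicit Milstein finite difference scheme.** For $n=0,\dots,N-1$, $$\begin{aligned}&\Big(I+\tfrac{\mu_xk}{2h_x}D_x+\tfrac{\mu_yk}{2h_y}D_y-\tfrac{k}{2h_x^2}D_{xx}-\tfrac{k}{2h_y^2}D_{yy}\Big)V^{n+1}\\&=\Big(I-\tfrac{\sqrt{\rho_xk}Z_{n,x}}{2h_x}D_x-\tfrac{\sqrt{\rho_yk}\widetilde Z_{n,y}}{2h_y}D_y+\tfrac{\rho_xk(Z_{n,x}^2-1)}{8h_x^2}D_x^2+\tfrac{\rho_yk(\widetilde Z_{n,y}^2-1)}{8h_y^2}D_y^2+\tfrac{\sqrt{\rho_x\rho_y}kZ_{n,x}\widetilde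 Z_{n,y}}{4h_xh_y}D_{xy}\Big)V^n,\end{aligned}$$ where $V^{n+1}$ is the solution in $\ell^2(\mathbb{Z}^2)$ (obtained by Fourier transform). **Asymptotic notation.** $O(\cdot)$ is as $h_x,h_y,k\to0$ (subject to the stated relation between $k$ and $\widehat h$), with constants independent of $h_x,h_y,k$ and of $(i,j)$. *)

(* Defs.v *)
From HB Require Import structures.
From mathcomp Require Import all_boot all_order all_algebra.
From mathcomp Require Import all_classical all_reals all_analysis.

Set Implicit Arguments.
Unset Strict Implicit.
Unset Printing Implicit Defensive.

Import Order.TTheory GRing.Theory Num.Theory.
Import numFieldNormedType.Exports.

Local Open Scope classical_set_scope.
Local Open Scope ring_scope.

Section brownian_motion.
Context {d : measure_display} {Omega : measurableType d} {R : realType}.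
Variable P : probability Omega R.
Implicit Types (F : R -> set (set Omega)) (M X : R -> Omega -> R).

(* Processes are indexed by all of R; only times t >= 0 are constrained. *)
Definition filtration F : Prop :=
  (forall t, 0 <= t -> sigma_algebra setT (F t) /\ F t `<=` measurable) /\
  (forall s t, 0 <= s -> s <= t -> F s `<=` F t).

Definition adapted F M : Prop :=
  forall t, 0 <= t -> forall B : set R, measurable B -> F t (M t @^-1` B).

Definition martingale F X : Prop :=
  [/\ adapted F X,
      (forall t, 0 <= t -> P.-integrable setT (EFin \o X t)) &
      (forall s t, 0 <= s -> s <= t -> forall A, F s A ->
         (\int[P]_(w in A) (X t w)%:E = \int[P]_(w in A) (X s w)%:E)%E)].

(* The second parameter of [normal_prob] is the standard deviation. *)
Definition brownian_motion F M : Prop :=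
  [/\ adapted F M,
      {ae P, forall w, M 0 w = 0},
      {ae P, forall w, {within `[0, +oo[, continuous (fun t : R => M t w)}},
      (forall s t, 0 <= s -> s < t -> forall B : set R, measurable B ->
         P ((fun w => M t w - M s w) @^-1` B)
         = normal_prob 0 (Num.sqrt (t - s)) B) &
      (forall s t, 0 <= s -> s < t -> forall A (B : set R), F s A ->
         measurable B ->
         P (A `&` (fun w => M t w - M s w) @^-1` B)
         = (P A * P ((fun w => (M t w - M s w)%R) @^-1` B))%E)].

(* d<M, M'>_t = rho dt.  For continuous square-integrable martingales, the
   bracket <M, M'> is the unique continuous adapted process of finite variation,
   null at 0, such that M M' - <M, M'> is a martingale. *)
Definition bracket_rate F M M' (rho : R) : Prop :=
  martingale F (fun t w => M t w * M' t w - rho * t).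

End brownian_motion.

Section finite_difference_scheme.
Context {R : realType}.

Definition grid := int -> int -> R.

Definition Dx (V : grid) : grid := fun i j => V (i + 1) j - V (i - 1) j.
Definition Dy (V : grid) : grid := fun i j => V i (j + 1) - V i (j - 1).
Definition Dxx (V : grid) : grid :=
  fun i j => V (i + 1) j - 2 * V i j + V (i - 1) j.
Definition Dyy (V : grid) : grid :=
  fun i j => V i (j + 1) - 2 * V i j + V i (j - 1).
Definition Dxy (V : grid) : grid := fun i j =>
  V (i + 1) (j + 1) - V (i - 1) (j + 1) - V (i + 1) (j - 1) + V (i - 1) (j - 1).

Definition ell2 (V : grid) : Prop :=
  summable [set: int * int] (fun p => (`|V p.1 p.2| ^+ 2)%:E).

Variables (mux muy rhox rhoy : R) (hx hy k : R).

Definition implicit_op (V : grid) : grid := fun i j =>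
  V i j + mux * k / (2 * hx) * Dx V i j + muy * k / (2 * hy) * Dy V i j
  - k / (2 * hx ^+ 2) * Dxx V i j - k / (2 * hy ^+ 2) * Dyy V i j.

Definition milstein_op (zx zy : R) (V : grid) : grid := fun i j =>
  V i j
  - Num.sqrt (rhox * k) * zx / (2 * hx) * Dx V i j
  - Num.sqrt (rhoy * k) * zy / (2 * hy) * Dy V i j
  + rhox * k * (zx ^+ 2 - 1) / (8 * hx ^+ 2) * Dx (Dx V) i j
  + rhoy * k * (zy ^+ 2 - 1) / (8 * hy ^+ 2) * Dy (Dy V) i j
  + Num.sqrt (rhox * rhoy) * k * zx * zy / (4 * hx * hy) * Dxy V i j.

Definition dirac_grid (i0 j0 : int) : grid := fun i j =>
  if (i == i0) && (j == j0) then hx^-1 * hy^-1 else 0.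

(* V is the numerical solution driven by the normalised increments zx, zy; the
   ell2 requirement singles out one solution of each implicit step. *)
Definition milstein_scheme (i0 j0 : int) (N : nat) (zx zy : nat -> R)
    (V : nat -> grid) : Prop :=
  V 0%N = dirac_grid i0 j0 /\
  forall n : nat, (n < N)%N ->
    ell2 (V n.+1) /\ implicit_op (V n.+1) = milstein_op (zx n) (zy n) (V n).

End finite_difference_scheme.

Arguments grid : clear implicits.

Definition normalised_increment {Omega : Type} {R : realType} (k : R)
    (M : R -> Omega -> R) (w : Omega) (n : nat) : R :=
  (M (n.+1%:R * k) w - M (n%:R * k) w) / Num.sqrt k.

(* v(t, x, y), given the values mx, my of the driving Brownian motions at t. *)
Definition spde_solution {R : realType} (x0 y0 mux muy rhox rhoy : R)
    (t mx my x y : R) : R :=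
  expR (- ((x - x0 - mux * t - Num.sqrt rhox * mx) ^+ 2
             / (2 * (1 - rhox) * t))
        - (y - y0 - muy * t - Num.sqrt rhoy * my) ^+ 2
             / (2 * (1 - rhoy) * t))
  / (2 * pi * Num.sqrt ((1 - rhox) * (1 - rhoy)) * t).

(* Main.v *)
Require Import Defs.
From HB Require Import structures.
From mathcomp Require Import all_boot all_order all_algebra.
From mathcomp Require Import all_classical all_reals all_analysis.
From mathcomp Require Import measurable_realfun.
From mathcomp Require Import ring lra.

(* The coefficients are constant, so the Fourier transform diagonalises both
   problems.  Each implicit step has a strictly diagonally dominant matrix, hence a
   unique bounded solution, and V^N is the inverse transform, over the box
   |z.1| <= pi / hx, |z.2| <= pi / hy, of a product P_N of random amplification
   factors num / den.  The exact solution is the inverse transform, over the whole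
   plane, of Q_N = exp(- i phase) * exp(- T decay).

   For a fixed frequency z put e_n = E |P_n - Q_n|^2, h^2 = hx^2 + hy^2 and
   r = |z|^2.  The leading part of the local error is odd in the Brownian increments,
   so it has conditional mean zero and
     e_(n+1) <= (alpha + k E0) e_n + C k (k + h^2)^2 (1 + |z|)^16 E |Q_n|^2,
   where alpha = E |num / den|^2 and alpha <= E0 <= 1.  The three conditions on
   rhox, rhoy, rhoxy give alpha <= exp(- c k r) when the stiffness
   k * (symDD hx z.1 + symDD hy z.2) is at most 1, and alpha <= theta^2 < 1 otherwise.
   Hence e_N <= w(z)^2 with w(z) = K (k + h^2) exp(- c r) + 2 theta^N on the box.
   Outside the box, where h^2 r >= 1, the Gaussian |Q_N| is itself below
   K h^2 exp(- c r).  Cauchy-Schwarz with weight w and Tonelli bound the mean-square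
   error by the integral of w, in which theta^N contributes theta^N / (hx hy).

   Nothing is known about the joint law of (Mx, My) beyond the bracket.  The needed
   conditional moments of the increments of a Mx + b My, and the characteristic
   function of those of Mx, are obtained by splitting [s, t] finely: a function g with
   |g (r') - g r| <= K (r' - r)^(3/2) for r <= r' is constant. *)

(** With [U = P - Q] one has [den * U_(n+1) = num * U_n + E * Q_n], where
    [E = num - den * Q_(n+1) / Q_n] depends only on the increments of the current step, and
    [|Q_n| ^ 2] is deterministic. So the product of random factors is never expanded. The obstacle
    is that [E] itself has only size [sqrt k * (k + h^2)]; estimating it in absolute value would
    cost half an order in time. The loss sits in the part [odd], which is isolated in the cross term
    [2 Re (conj (num U_n) E Q_n)] before any absolute value is taken. Bounds at fixed frequency must
    stay integrable over a box that grows as the mesh shrinks. For this reason propagation and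
    source are measured against the same geometric rate [E0 ^ n]: Gaussian decay in [z] survives the
    recursion, and half of it pays for the powers of [|z|]. At stiff frequencies no consistency is
    available, so [P_N] and [Q_N] are bounded separately. The price is [theta ^ N] times the area of
    the box; of the four powers of the mesh size granted by the assumption on [theta], two pay for
    the area and two give the order. *)

Set Implicit Arguments.
Unset Strict Implicit.
Unset Printing Implicit Defensive.
Set SsrOldRewriteGoalsOrder.

Import Order.TTheory GRing.Theory Num.Theory.
Import numFieldNormedType.Exports.

Local Open Scope classical_set_scope.
Local Open Scope ring_scope.

(** * Integrals of real functions *)

Section real_integrals.
Context {d : measure_display} {T : measurableType d} {R : realType}.
Context {mu : {measure set T -> \bar R}}.
Implicit Types (f g : T -> R) (D : set T).

Definition rintegrable (m : {measure set T -> \bar R}) D f : Prop :=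
  m.-integrable D (fun x => (f x)%:E).

Lemma rintegrable_measurable D f : rintegrable mu D f -> measurable_fun D f.
Proof. by move=> /measurable_int/measurable_EFinP. Qed.

Lemma rintegrableD D f g : measurable D -> rintegrable mu D f -> rintegrable mu D g ->
  rintegrable mu D (fun x => f x + g x).
Proof.
move=> mD fi gi; rewrite /rintegrable; under eq_fun do rewrite EFinD.
exact: integrableD.
Qed.

Lemma rintegrableZ D f (c : R) : measurable D -> rintegrable mu D f ->
  rintegrable mu D (fun x => c * f x).
Proof.
move=> mD fi; rewrite /rintegrable; under eq_fun do rewrite EFinM.
exact: integrableZl.
Qed.

Lemma rintegrableB D f g : measurable D -> rintegrable mu D f -> rintegrable mu D g ->
  rintegrable mu D (fun x => f x - g x).
Proof.
move=> mD fi gi; rewrite /rintegrable; under eq_fun do rewrite EFinB.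
exact: integrableB.
Qed.

Lemma rintegrable_le D f g : measurable D -> measurable_fun D f ->
  (forall x, D x -> `|f x| <= g x) -> rintegrable mu D g -> rintegrable mu D f.
Proof.
move=> mD mf fg; apply: le_integrable => //; first exact/measurable_EFinP.
by move=> x Dx; rewrite /= lee_fin (le_trans (fg x Dx))// ler_norm.
Qed.

Lemma rintegrable_norm D f : measurable D -> rintegrable mu D f ->
  rintegrable mu D (fun x => `|f x|).
Proof. by move=> mD fi; apply: integrable_norm. Qed.

Lemma rintegrable_cst D (c : R) : measurable D -> (mu D < +oo)%E ->
  rintegrable mu D (fun=> c).
Proof.
move=> mD muD; apply/integrableP; split; first exact: measurable_cst.
by rewrite /= integral_cst//= lte_mul_pinfty// ?lee_fin.
Qed.

Lemma eq_rintegrable D f g : measurable D -> (forall x, D x -> f x = g x) ->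
  rintegrable mu D f -> rintegrable mu D g.
Proof.
by move=> mD fg; apply: eq_integrable => // x /set_mem Dx; rewrite fg.
Qed.

Lemma rintD D f g : measurable D -> rintegrable mu D f -> rintegrable mu D g ->
  (\int[mu]_(x in D) (f x + g x) = \int[mu]_(x in D) f x + \int[mu]_(x in D) g x)%R.
Proof. by move=> mD fi gi; rewrite RintegralD. Qed.

Lemma rintB D f g : measurable D -> rintegrable mu D f -> rintegrable mu D g ->
  (\int[mu]_(x in D) (f x - g x) = \int[mu]_(x in D) f x - \int[mu]_(x in D) g x)%R.
Proof. by move=> mD fi gi; rewrite RintegralB. Qed.

Lemma rintZ D f (c : R) : measurable D -> rintegrable mu D f ->
  (\int[mu]_(x in D) (c * f x) = c * \int[mu]_(x in D) f x)%R.
Proof. by move=> mD fi; rewrite RintegralZl. Qed.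

Lemma eq_rint D f g : (forall x, D x -> f x = g x) ->
  (\int[mu]_(x in D) f x = \int[mu]_(x in D) g x)%R.
Proof. by move=> fg; apply: eq_Rintegral => x /set_mem Dx; rewrite fg. Qed.

Lemma le_rint D f g : measurable D -> rintegrable mu D f -> rintegrable mu D g ->
  (forall x, D x -> f x <= g x) ->
  (\int[mu]_(x in D) f x <= \int[mu]_(x in D) g x)%R.
Proof. by move=> mD fi gi fg; exact: le_Rintegral. Qed.

Lemma norm_rint_le D f g : measurable D -> rintegrable mu D f -> rintegrable mu D g ->
  (forall x, D x -> `|f x| <= g x) ->
  (`|\int[mu]_(x in D) f x| <= \int[mu]_(x in D) g x)%R.
Proof.
move=> mD fi gi fg; apply: le_trans (le_normr_Rintegral mD fi) _.
by apply: le_Rintegral => //; exact: rintegrable_norm.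
Qed.

Lemma EFin_rint D f : measurable D -> rintegrable mu D f ->
  ((\int[mu]_(x in D) f x)%R)%:E = (\int[mu]_(x in D) (f x)%:E)%E.
Proof. by move=> mD fi; rewrite /Rintegral fineK//; exact: integrable_fin_num. Qed.

Lemma ge0_rintegrable D f (c : R) : measurable D -> measurable_fun D f ->
  (forall x, D x -> 0 <= f x) -> (\int[mu]_(x in D) (f x)%:E <= c%:E)%E ->
  rintegrable mu D f.
Proof.
move=> mD mf f0 fc; apply/integrableP; split; first exact/measurable_EFinP.
rewrite (eq_integral (fun x => (f x)%:E)); first exact: le_lt_trans fc (ltry _).
by move=> x /set_mem Dx; rewrite gee0_abs// lee_fin f0.
Qed.

End real_integrals.

(** * Elementary bounds *)

Section elementary_bounds.
Context {R : realType}.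
Implicit Types x y : R.

(** Mean value theorem. It drives the chain of Taylor bounds below: the derivative of each
    difference is the difference bounded just before it. *)
Lemma le_of_derive_ge0 (f df : R -> R) : f 0 = 0 ->
  (forall x, is_derive x 1 f (df x)) -> (forall x, 0 <= x -> 0 <= df x) ->
  forall x, 0 <= x -> 0 <= f x.
Proof.
move=> f0 fdf df0 x x0.
have fc : {within `[0, x], continuous f}.
  by apply: derivable_within_continuous => z _; exact: ex_derive.
have [c c0x] := MVT_segment x0 (fun z _ => fdf z) fc.
rewrite f0 !subr0 => ->; rewrite mulr_ge0// df0//.
by move: c0x; rewrite in_itv/= => /andP[].
Qed.

Lemma sin_le_id x : 0 <= x -> sin x <= x.
Proof.
move=> x0; rewrite -subr_ge0.
apply: (@le_of_derive_ge0 (fun x => x - sin x) (fun x => 1 - cos x)) x0 => [|z z0].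
- by rewrite sin0 subr0.
- by rewrite subr_ge0 cos_le1.
Qed.

Lemma cos_ge_quad x : 0 <= x -> 1 - x ^+ 2 / 2 <= cos x.
Proof.
move=> x0; rewrite -subr_ge0.
apply: (@le_of_derive_ge0 (fun x => cos x - (1 - x ^+ 2 / 2)) (fun x => x - sin x)) x0 => [|z|z z0].
- by rewrite cos0 expr0n/= mul0r subr0 subrr.
- by apply: is_derive_eq; rewrite /GRing.scale/=; field.
- by rewrite subr_ge0 sin_le_id.
Qed.

Lemma sin_ge_cube x : 0 <= x -> x - x ^+ 3 / 6 <= sin x.
Proof.
move=> x0; rewrite -subr_ge0.
apply: (@le_of_derive_ge0 (fun x => sin x - (x - x ^+ 3 / 6))
  (fun x => cos x - (1 - x ^+ 2 / 2))) x0 => [|z|z z0].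
- by rewrite sin0 expr0n/= mul0r !subr0.
- by apply: is_derive_eq; rewrite /GRing.scale/=; field.
- by rewrite subr_ge0 cos_ge_quad.
Qed.

Lemma cos_le_quart x : 0 <= x -> cos x <= 1 - x ^+ 2 / 2 + x ^+ 4 / 24.
Proof.
move=> x0; rewrite -subr_ge0.
apply: (@le_of_derive_ge0 (fun x => 1 - x ^+ 2 / 2 + x ^+ 4 / 24 - cos x)
  (fun x => sin x - (x - x ^+ 3 / 6))) x0 => [|z|z z0].
- by rewrite cos0 !expr0n/= !mul0r subr0 addr0 subrr.
- by apply: is_derive_eq; rewrite /GRing.scale/=; field.
- by rewrite subr_ge0 sin_ge_cube.
Qed.

Lemma sin_le_quint x : 0 <= x -> sin x <= x - x ^+ 3 / 6 + x ^+ 5 / 120.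
Proof.
move=> x0; rewrite -subr_ge0.
apply: (@le_of_derive_ge0 (fun x => x - x ^+ 3 / 6 + x ^+ 5 / 120 - sin x)
  (fun x => 1 - x ^+ 2 / 2 + x ^+ 4 / 24 - cos x)) x0 => [|z|z z0].
- by rewrite sin0 !expr0n/= !mul0r !subr0 addr0.
- by apply: is_derive_eq; rewrite /GRing.scale/=; field.
- by rewrite subr_ge0 cos_le_quart.
Qed.

Lemma cosB1_bound x : 0 <= 1 - cos x <= x ^+ 2 / 2.
Proof.
rewrite subr_ge0 cos_le1/= lerBlDl -lerBlDr -(cos_norm x) -(real_normK (num_real x)).
exact: cos_ge_quad.
Qed.

Lemma cosB_quart x : 0 <= cos x - (1 - x ^+ 2 / 2) <= x ^+ 4 / 24.
Proof.
have := cosB1_bound x => /andP[_ h].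
have := cos_le_quart (normr_ge0 x).
have e4 : `|x| ^+ 4 = x ^+ 4.
  by rewrite -[4%N]/(2 * 2)%N !exprM real_normK ?num_real.
rewrite cos_norm e4 real_normK ?num_real//; lra.
Qed.

Lemma sinB_cube x : `|sin x - x| <= `|x| ^+ 3 / 6.
Proof.
wlog x0 : x / 0 <= x.
  move=> H; have [/H//|/ltW xN] := leP 0 x.
  by have := H (- x); rewrite sinN -opprD !normrN oppr_ge0; exact.
rewrite (ger0_norm x0) ler_norml.
have := sin_ge_cube x0; have := sin_le_id x0.
have : 0 <= x ^+ 3 by exact: exprn_ge0.
by move=> ? ? ?; apply/andP; split; lra.
Qed.

Lemma sinB_quint x : `|sin x - x + x ^+ 3 / 6| <= `|x| ^+ 5 / 120.
Proof.
wlog x0 : x / 0 <= x.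
  move=> H; have [/H//|/ltW xN] := leP 0 x.
  have := H (- x); rewrite oppr_ge0 => /(_ xN).
  rewrite sinN normrN -(normrN (- _ - _ + _)); congr (`|_| <= _).
  by field.
rewrite (ger0_norm x0) ler_norml.
have := sin_ge_cube x0; have := sin_le_quint x0.
by move=> ? ?; apply/andP; split; lra.
Qed.

Lemma sin_norm_le x : `|sin x| <= `|x|.
Proof.
wlog x0 : x / 0 <= x.
  move=> H; have [/H//|/ltW xN] := leP 0 x.
  by have := H (- x); rewrite sinN !normrN oppr_ge0; exact.
rewrite (ger0_norm x0) ler_norml sin_le_id// andbT.
have [x2|x2] := lerP x 1.
  have := sin_ge_cube x0; have : x ^+ 3 <= x.
    by rewrite exprS ler_piMr// exprn_ile1.
  by lra.
by have := sin_geN1 x; lra.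
Qed.

(* The constant is far from Jordan's [2 / pi], but any positive one will do. *)
Lemma sin_ge_third x : 0 <= x -> x <= 2 -> x / 3 <= sin x.
Proof.
move=> x0 x2; apply: le_trans (sin_ge_cube x0).
have : x ^+ 3 <= 4 * x.
  rewrite exprSr ler_wpM2r//.
  by rewrite (_ : 4 = 2 ^+ 2); [rewrite lerXn2r// nnegrE|ring].
by lra.
Qed.

(** Half-angle formula: [1 - cos x] is twice the square of [sin (|x| / 2)], and
    [|x| / 2 <= pi / 2 < 2] allows [sin_ge_third], giving [2 (|x| / 6)^2]. This bounds the discrete
    Laplacian from below on the frequency box. *)
Lemma versine_ge x : `|x| <= pi -> x ^+ 2 / 18 <= 1 - cos x.
Proof.
move=> xpi.
have -> : 1 - cos x = 2 * sin (`|x| / 2) ^+ 2.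
  rewrite -(cos_norm x) [in LHS](_ : `|x| = (`|x| / 2) *+ 2); last by field.
  rewrite cos_mulr2n cos2sin2; ring.
have h0 : 0 <= `|x| / 2 by rewrite divr_ge0.
have h2 : `|x| / 2 <= 2.
  by have := @pihalf_lt2 R; move: xpi; lra.
have := sin_ge_third h0 h2 => h.
have : (`|x| / 2 / 3) ^+ 2 <= sin (`|x| / 2) ^+ 2.
  by rewrite lerXn2r ?nnegrE// ?(le_trans _ h)// divr_ge0.
rewrite -(real_normK (num_real x)); nra.
Qed.

(** For the upper bound, [exp (- x) (1 + x) <= 1 <= 1 + x^3 = (1 - x + x^2) (1 + x)]. *)
Lemma expRN_bound x : 0 <= x -> 0 <= expR (- x) - (1 - x) <= x ^+ 2.
Proof.
move=> x0; rewrite subr_ge0 expR_ge1Dx/= lerBlDl.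
have e1 : expR (- x) * (1 + x) <= 1.
  rewrite -[leRHS](mulVf (lt0r_neq0 (expR_gt0 x))) -expRN.
  by rewrite ler_wpM2l ?expR_ge0// expR_ge1Dx.
have x1 : 0 < 1 + x by lra.
rewrite -(ler_pM2r x1); apply: le_trans e1 _.
have : 0 <= x ^+ 3 by exact: exprn_ge0.
rewrite (_ : (1 - x + x ^+ 2) * (1 + x) = 1 + x ^+ 3); last by ring.
by lra.
Qed.

Lemma expn_le_expR (n : nat) x : 0 <= x -> x ^+ n <= n`!%:R * expR x.
Proof.
move=> x0; case: n => [|n]; first by rewrite expr0 fact0 mul1r -expR0 ler_expR.
have := expR_ge1Dxn n x0 => h.
rewrite -ler_pdivrMl ?ltr0n ?fact_gt0// mulrC; apply: le_trans h.
by rewrite lerDr.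
Qed.

End elementary_bounds.

(** * Moments of the normal law *)

Section normal_moments.
Context {R : realType}.
Implicit Types (x y : R) (sg : R).

(** A crude remainder suffices: it serves to read the first two moments of the normal law off its
    Laplace transform. *)
Lemma expR_taylor2 y : `|expR y - 1 - y - y ^+ 2 / 2| <= `|y| ^+ 3 * expR `|y|.
Proof.
have [y0|/ltW y0] := leP 0 y.
  rewrite (ger0_norm y0) ler_norml.
  have e1 (z : R) (zp : 0 <= z) : 0 <= z * expR z - (expR z - 1).
    refine (@le_of_derive_ge0 _ (fun x => x * expR x - (expR x - 1)) (fun x => x * expR x) _ _ _ z zp) => [|x|x x0].
    + by rewrite ?oppr0 expR0; field.
    + by apply: is_derive_eq; rewrite /GRing.scale/=; ring.
    + by rewrite mulr_ge0// expR_ge0.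
  have e2 (z : R) (zp : 0 <= z) : 0 <= z ^+ 2 * expR z - (expR z - 1 - z).
    refine (@le_of_derive_ge0 _ (fun x => x ^+ 2 * expR x - (expR x - 1 - x))
      (fun x => x * expR x * 2 + x ^+ 2 * expR x - (expR x - 1)) _ _ _ z zp) => [|x|x x0].
    + by rewrite ?oppr0 expR0; field.
    + by apply: is_derive_eq; rewrite /GRing.scale/=; ring.
    + have := e1 x x0.
      have : 0 <= x * expR x by rewrite mulr_ge0// expR_ge0.
      have : 0 <= x ^+ 2 * expR x by rewrite mulr_ge0 ?exprn_ge0// expR_ge0.
      by lra.
  have e3 (z : R) (zp : 0 <= z) : 0 <= z ^+ 3 * expR z - (expR z - 1 - z - z ^+ 2 / 2).
    refine (@le_of_derive_ge0 _ (fun x => x ^+ 3 * expR x - (expR x - 1 - x - x ^+ 2 / 2))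
      (fun x => x ^+ 2 * expR x * 3 + x ^+ 3 * expR x - (expR x - 1 - x)) _ _ _ z zp) => [|x|x x0].
    + by rewrite ?oppr0 expR0; field.
    + by apply: is_derive_eq; rewrite /GRing.scale/=; field.
    + have := e2 x x0.
      have : 0 <= x ^+ 3 * expR x by rewrite mulr_ge0 ?exprn_ge0// expR_ge0.
      have : 0 <= x ^+ 2 * expR x by rewrite mulr_ge0 ?exprn_ge0// expR_ge0.
      by lra.
  have e4 (z : R) (zp : 0 <= z) : 0 <= expR z - 1 - z - z ^+ 2 / 2.
    refine (@le_of_derive_ge0 _ (fun x => expR x - 1 - x - x ^+ 2 / 2)
      (fun x => expR x - 1 - x) _ _ _ z zp) => [|x|x x0].
    + by rewrite ?oppr0 expR0; field.
    + by apply: is_derive_eq; rewrite /GRing.scale/=; field.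
    + by have := expR_ge1Dx x; lra.
  have := e3 y y0; have := e4 y y0.
  have : 0 <= y ^+ 3 * expR y by rewrite mulr_ge0 ?exprn_ge0// expR_ge0.
  by move=> ? ? ?; apply/andP; split; lra.
have [z zy z0] : exists2 z, y = - z & 0 <= z by exists (- y); [rewrite opprK|rewrite oppr_ge0].
rewrite {}zy normrN (ger0_norm z0) sqrrN ler_norml.
have e1 (x : R) (xp : 0 <= x) : 0 <= 1 - x + x ^+ 2 / 2 - expR (- x).
  refine (@le_of_derive_ge0 _ (fun x => 1 - x + x ^+ 2 / 2 - expR (- x))
      (fun x => expR (- x) - 1 + x) _ _ _ x xp) => [|t|t t0].
  + by rewrite ?oppr0 expR0; field.
  + by apply: is_derive_eq; rewrite /GRing.scale/=; field.
  + by have := expR_ge1Dx (- t); lra.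
(* The derivative is the quantity of [e1] plus [(3 - 1/2) x^2], whence the coefficient [5 / 2]. *)
have e2 (x : R) (xp : 0 <= x) : 0 <= expR (- x) - 1 + x - x ^+ 2 / 2 + x ^+ 3.
  refine (@le_of_derive_ge0 _ (fun x => expR (- x) - 1 + x - x ^+ 2 / 2 + x ^+ 3)
      (fun x => 1 - x + x ^+ 2 / 2 - expR (- x) + (5%:R / 2) * x ^+ 2) _ _ _ x xp) => [|t|t t0].
  + by rewrite ?oppr0 expR0; field.
  + by apply: is_derive_eq; rewrite /GRing.scale/=; field.
  + have := e1 t t0; have := sqr_ge0 t; lra.
have := e1 _ z0; have := e2 _ z0 => h1 h2.
have z3 : 0 <= z ^+ 3 by exact: exprn_ge0.
have : z ^+ 3 <= z ^+ 3 * expR z by rewrite ler_peMr// -expR0 ler_expR.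
by move=> ?; apply/andP; split; lra.
Qed.

Local Notation N sg := (@normal_prob R 0 sg).
Local Notation mu := (@lebesgue_measure R).

(** The change of variables produces an abstract Radon-Nikodym derivative. It equals the normal
    density almost everywhere, because both have the same integral over every measurable set. *)
Lemma ge0_integral_normal sg (f : R -> \bar R) :
  measurable_fun [set: R] f -> (forall x, 0 <= f x)%E ->
  (\int[N sg]_x f x = \int[mu]_x (f x * (normal_pdf 0 sg x)%:E))%E.
Proof.
move=> mf f0.
have dom : N sg `<< mu by exact: normal_prob_dominates.
rewrite -(Radon_Nikodym_SigmaFinite.change_of_variables dom)//.
have mpdf : measurable_fun setT (fun x : R => (normal_pdf 0 sg x)%:E).
  by apply/measurable_EFinP; exact: measurable_normal_pdf.
have iRN := Radon_Nikodym_SigmaFinite.f_integrable dom.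
apply: ae_eq_integral => //.
- by apply: emeasurable_funM => //; exact: measurable_int iRN.
- exact: emeasurable_funM.
- apply: ae_eqe_mul2l; apply: integral_ae_eq => // A _ mA.
  by rewrite -Radon_Nikodym_SigmaFinite.f_integral.
Qed.

(** Completing the square turns [exp (l x)] times the centred density into a constant times the
    density of mean [l * sg ^+ 2]. *)
Lemma normal_mgf sg l : sg != 0 ->
  (\int[N sg]_x (expR (l * x))%:E = (expR (l ^+ 2 * sg ^+ 2 / 2))%:E)%E.
Proof.
move=> sg0.
have mexp : measurable_fun setT (fun x : R => (expR (l * x))%:E).
  by apply/measurable_EFinP; apply: measurableT_comp => //; exact: mulrl_measurable.
rewrite ge0_integral_normal//.
transitivity (\int[mu]_x ((expR (l ^+ 2 * sg ^+ 2 / 2))%:E *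
    (normal_pdf (l * sg ^+ 2) sg x)%:E))%E.
  apply: eq_integral => x _; rewrite -!EFinM !normal_pdfE// /normal_fun; congr EFin.
  rewrite mulrCA [RHS]mulrCA -!expRD; congr (_ * expR _).
  by rewrite -mulr_natr; field; rewrite sg0.
rewrite ge0_integralZl//.
- by rewrite integral_normal_pdf mule1.
- by apply/measurable_EFinP; exact: measurable_normal_pdf.
- by move=> x _; rewrite lee_fin normal_pdf_ge0.
Qed.

Lemma normal_integrable_expR sg l : sg != 0 ->
  (N sg).-integrable setT (fun x => (expR (l * x))%:E).
Proof.
move=> sg0; apply/integrableP; split.
  by apply/measurable_EFinP; apply: measurableT_comp => //; exact: mulrl_measurable.
under eq_integral do rewrite gee0_abs ?lee_fin ?expR_ge0//.
by rewrite normal_mgf// ltry.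
Qed.

Lemma expR_norm_le x : expR `|x| <= expR x + expR (- x).
Proof.
by have [x0|x0] := ger0P x; rewrite ?lerDl ?lerDr expR_ge0.
Qed.

Definition normal_moment_cst (p : nat) : R := (p.*2)`!%:R * (2 * expR (1 / 2)).

(** From [y^(2p) <= (2p)! exp |y|] with [y = x / sg], and [exp |y| <= exp y + exp (- y)], where each
    exponential has mean [exp (1/2)]. The constant is not sharp; what matters is the scaling
    [sg^(2p)]. *)
Lemma normal_even_moment sg (p : nat) : 0 < sg ->
  (\int[N sg]_x (x ^+ p.*2)%:E <= (normal_moment_cst p * sg ^+ p.*2)%:E)%E.
Proof.
move=> sg0; have sgN0 : sg != 0 by rewrite gt_eqF.
pose c := (p.*2)`!%:R * sg ^+ p.*2.
have c0 : 0 <= c by rewrite mulr_ge0// exprn_ge0// ltW.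
have me (l : R) : measurable_fun setT (fun x : R => (expR (l * x))%:E).
  by apply/measurable_EFinP; apply: measurableT_comp => //; exact: mulrl_measurable.
have e0 (l x : R) : (0 <= (expR (l * x))%:E)%E by rewrite lee_fin expR_ge0.
apply: (@le_trans _ _ (\int[N sg]_x
    (c%:E * ((expR (sg^-1 * x))%:E + (expR ((- sg^-1) * x))%:E)))%E).
  apply: ge0_le_integral => //=.
  - by move=> x _; rewrite lee_fin -muln2 mulnC exprM exprn_ge0// sqr_ge0.
  - by apply/measurable_EFinP; exact: exprn_measurable.
  - by apply: measurable_funeM; apply: emeasurable_funD; exact: me.
  - move=> x _; rewrite -EFinD -EFinM lee_fin mulNr.
    have := expn_le_expR p.*2 (normr_ge0 (sg^-1 * x)).
    rewrite -normrX ger0_norm; last by rewrite -muln2 mulnC exprM exprn_ge0// sqr_ge0.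
    rewrite exprMn exprVn ler_pdivrMl ?exprn_gt0// mulrCA mulrA => /le_trans; apply.
    by rewrite /c ler_wpM2l// expR_norm_le.
rewrite ge0_integralZl//; last 2 first.
- by apply: emeasurable_funD; exact: me.
- by move=> x _; exact: adde_ge0.
rewrite (_ : integral _ _ _ = (expR (sg^-1 ^+ 2 * sg ^+ 2 / 2) + expR ((- sg^-1) ^+ 2 * sg ^+ 2 / 2))%:E).
  rewrite -EFinM lee_fin /c /normal_moment_cst.
  rewrite sqrrN -exprMn mulVf// expr1n -mulr2n -mulr_natl le_eqVlt; apply/orP; left.
  by apply/eqP; ring.
rewrite ge0_integralD//; [|exact: me..].
by rewrite EFinD; congr (_ + _)%E; exact: normal_mgf.
Qed.

Lemma integrable_normal_expn sg (p : nat) : 0 < sg ->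
  (N sg).-integrable setT (fun x => (x ^+ p)%:E).
Proof.
move=> sg0.
have sgN0 : sg != 0 by rewrite gt_eqF.
apply: (@le_integrable _ _ _ _ _ measurableT _
  (fun x : measurableTypeR R => (p`!%:R)%:E * ((expR (1 * x))%:E + (expR ((- 1) * x))%:E))%E).
- by apply/measurable_EFinP; exact: exprn_measurable.
- move=> x _; rewrite -EFinD -EFinM !abse_EFin lee_fin normrX mul1r mulN1r.
  rewrite (le_trans (expn_le_expR p (normr_ge0 x)))// normrM normr_nat.
  by rewrite ler_wpM2l// (le_trans (expR_norm_le x))// ler_norm.
- by apply: integrableZl => //; apply: integrableD => //; exact: normal_integrable_expR.
Qed.

(** Mean and variance are Taylor coefficients at [0] of the Laplace transform given by [normal_mgf];
    a quantity bounded by [l * K] for all small [l] vanishes. *)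
Lemma normal_mean_var sg : 0 < sg ->
  (\int[N sg]_x x = 0 /\ \int[N sg]_x (x ^+ 2) = sg ^+ 2)%R.
Proof.
move=> sg0; have sgN0 : sg != 0 by rewrite gt_eqF.
pose m1 := (\int[N sg]_x x)%R; pose m2 := (\int[N sg]_x (x ^+ 2))%R.
(* [|x|^3 exp |x| <= 6 exp (2 |x|) <= 6 (exp (2 x) + exp (- 2 x))], and the last expression has mean
   [12 exp (2 sg^2)]. *)
pose C := 12 * expR (2 * sg ^+ 2).
have i1 : rintegrable (N sg) setT (fun x : R => x).
  by apply: eq_rintegrable (integrable_normal_expn 1 sg0) => //= x _; rewrite expr1.
have i2 : rintegrable (N sg) setT (fun x : R => x ^+ 2) by exact: integrable_normal_expn.
have ie l : rintegrable (N sg) setT (fun x => expR (l * x)) by exact: normal_integrable_expR.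
have i0 : rintegrable (N sg) setT (fun _ : R => 1 : R).
  by apply: eq_rintegrable (integrable_normal_expn 0 sg0) => //= x _; rewrite expr0.
have key l : `|l| <= 1 -> `|expR (l ^+ 2 * sg ^+ 2 / 2) - 1 - l * m1 - l ^+ 2 / 2 * m2| <= `|l| ^+ 3 * C.
  move=> l1.
  have il : rintegrable (N sg) setT (fun x => l * x) by exact: rintegrableZ.
  have il2 : rintegrable (N sg) setT (fun x => l ^+ 2 / 2 * x ^+ 2) by exact: rintegrableZ.
  have ie1 : rintegrable (N sg) setT (fun x => expR (l * x) - 1) by exact: rintegrableB.
  have ie2 : rintegrable (N sg) setT (fun x => expR (l * x) - 1 - l * x) by exact: rintegrableB.
  have iT : rintegrable (N sg) setT (fun x => expR (l * x) - 1 - l * x - l ^+ 2 / 2 * x ^+ 2).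
    exact: rintegrableB.
  have -> : expR (l ^+ 2 * sg ^+ 2 / 2) - 1 - l * m1 - l ^+ 2 / 2 * m2 =
      (\int[N sg]_x (expR (l * x) - 1 - l * x - l ^+ 2 / 2 * x ^+ 2))%R.
    rewrite (rintB measurableT ie2 il2) (rintB measurableT ie1 il) (rintB measurableT (ie l) i0).
    rewrite (rintZ _ measurableT i1) (rintZ _ measurableT i2).
    congr (_ - _ - _ - _).
    - by rewrite /Rintegral normal_mgf.
    - rewrite Rintegral_cst// mul1r -[LHS]/(fine 1); congr fine.
      by apply/esym; exact: integral_normal_pdf.
  have ic : rintegrable (N sg) setT (fun x => expR (2 * x) + expR ((- 2) * x)) by exact: rintegrableD.
  have i6 : rintegrable (N sg) setT (fun x => 6 * (expR (2 * x) + expR ((- 2) * x))).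
    exact: rintegrableZ.
  have iR : rintegrable (N sg) setT (fun x => `|l| ^+ 3 * (6 * (expR (2 * x) + expR ((- 2) * x)))).
    exact: rintegrableZ.
  apply: (@le_trans _ _ (\int[N sg]_x (`|l| ^+ 3 * (6 * (expR (2 * x) + expR ((- 2) * x)))))).
    apply: norm_rint_le => // x _; have := expR_taylor2 (l * x).
    rewrite (_ : (l * x) ^+ 2 / 2 = l ^+ 2 / 2 * x ^+ 2); last by field.
    move=> h; apply: le_trans h _; rewrite normrM exprMn -mulrA ler_wpM2l ?exprn_ge0//.
    have h1 : `|l| * `|x| <= `|x| by rewrite ler_piMl.
    have h2 : expR (`|l| * `|x|) <= expR `|x| by rewrite ler_expR.
    have h3 := expn_le_expR 3 (normr_ge0 x).
    have h4 := expR_norm_le (2 * x).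
    rewrite mulNr; apply: (@le_trans _ _ (6 * expR `|x| * expR `|x|)).
      by apply: ler_pM => //; rewrite ?exprn_ge0 ?expR_ge0//; rewrite (le_trans h3)// ler_wpM2r ?expR_ge0.
    rewrite -mulrA ler_wpM2l// -expRD; apply: le_trans h4.
    by rewrite ler_expR normrM (ger0_norm (_ : 0 <= 2 :> R)) //; lra.
  rewrite (rintZ _ measurableT i6) (rintZ _ measurableT ic) (rintD measurableT (ie 2) (ie (- 2))).
  rewrite /Rintegral !normal_mgf//= /C ler_wpM2l ?exprn_ge0//.
  rewrite sqrrN (_ : 2 ^+ 2 * sg ^+ 2 / 2 = 2 * sg ^+ 2); last by field.
  by lra.
have C0 : 0 <= C by rewrite mulr_ge0// expR_ge0.
have small (a K : R) : 0 <= K -> (forall l, 0 < l -> l <= 1 -> `|a| <= l * K) -> a = 0.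
  move=> K0 H; apply/eqP; rewrite -normr_le0; apply/ler_addgt0Pl => e e0; rewrite addr0.
  pose l := Num.min 1 (e / (K + 1)).
  have K1 : 0 < K + 1 by lra.
  have l0 : 0 < l by rewrite lt_min ltr01/= divr_gt0.
  apply: le_trans (H l l0 _) _; first by rewrite ge_min lexx.
  apply: (@le_trans _ _ (e / (K + 1) * (K + 1))); last by rewrite divfK ?gt_eqF.
  apply: ler_pM => //; [exact: ltW|by rewrite ge_min lexx orbT|lra].
have m10 : m1 = 0.
  apply: (small _ C C0) => l l0 l1.
  (* Subtracting the bounds at [l] and [- l] cancels all even terms and leaves [2 * l * m1]. *)
  have h1 := key l; have h2 := key (- l).
  rewrite normrN (ger0_norm (ltW l0)) in h1 h2.
  have {}h1 := h1 l1; have {}h2 := h2 l1; rewrite sqrrN in h2.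
  have : `|2 * l * m1| <= 2 * (l ^+ 3 * C).
    move: h1 h2; rewrite !ler_norml => /andP[? ?] /andP[? ?]; apply/andP; split; lra.
  rewrite -mulrA normrM (ger0_norm (_ : 0 <= 2 :> R))// ler_pM2l// normrM (ger0_norm (ltW l0)).
  rewrite exprS -mulrA ler_pM2l// => /le_trans; apply.
  by rewrite ler_wpM2r// expr2 ler_piMl// ltW.
split; first exact: m10.
apply/eqP; rewrite -subr_eq0; apply/eqP.
apply: (small _ (2 * (C + sg ^+ 4 * expR (sg ^+ 2)))).
  by rewrite mulr_ge0// addr_ge0// mulr_ge0 ?expR_ge0// exprn_ge0// ltW.
move=> l l0 l1.
have := key l; rewrite (ger0_norm (ltW l0)) => /(_ l1); rewrite m10 mulr0 subr0 -/m2 => h1.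
have l2 : 0 < l ^+ 2 by exact: exprn_gt0.
have s2 : 0 <= sg ^+ 2 by exact: sqr_ge0.
pose z := l ^+ 2 * sg ^+ 2 / 2.
have z0 : 0 <= z by rewrite divr_ge0// mulr_ge0// ltW.
have zs : z <= sg ^+ 2.
  rewrite /z -mulrA mulrC -[leRHS]mulr1; apply: ler_pM => //; [by rewrite divr_ge0|exact: ltW|lra|].
  by rewrite exprn_ile1// ltW.
have hz : 0 <= expR z - 1 - z <= z ^+ 2 * expR z.
  have a := @expR_ge1Dx R z.
  have b : expR z * (1 - z) <= 1.
    rewrite -[leRHS](mulfV (lt0r_neq0 (expR_gt0 z))) -expRN ler_wpM2l ?expR_ge0//.
    by have := @expR_ge1Dx R (- z); lra.
  apply/andP; split; first lra.
  have z3 : 0 <= z ^+ 3 by exact: exprn_ge0.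
  have e1 : 1 <= expR z by lra.
  have z2 : 0 <= z ^+ 2 by exact: sqr_ge0.
  nra.
have zE : z ^+ 2 * expR z <= l ^+ 3 * (sg ^+ 4 * expR (sg ^+ 2)).
  rewrite mulrA; apply: ler_pM; rewrite ?sqr_ge0 ?expR_ge0 ?ler_expR//.
  rewrite /z -mulrA exprMn (_ : (_ / 2) ^+ 2 = sg ^+ 4 / 4); last by field.
  have s4 : 0 <= sg ^+ 4 by rewrite exprn_ge0// ltW.
  rewrite -exprM; apply: ler_pM; [by rewrite exprn_ge0// ltW|by rewrite divr_ge0| |lra].
  by rewrite -[(2 * 2)%N]/4%N (exprS l 3) ler_piMl// exprn_ge0// ltW.
have : l ^+ 2 * `|m2 - sg ^+ 2| <= l ^+ 2 * (l * (2 * (C + sg ^+ 4 * expR (sg ^+ 2)))).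
  rewrite -[X in X * `|_|](gtr0_norm l2) -normrM.
  rewrite (_ : l ^+ 2 * (m2 - sg ^+ 2) = 2 * (l ^+ 2 / 2 * m2 - z)); last by rewrite /z; field.
  move: h1 hz zE; rewrite -/z; set y := l ^+ 2 / 2 * m2.
  rewrite (_ : l ^+ 2 * (l * _) = 2 * (l ^+ 3 * C + l ^+ 3 * (sg ^+ 4 * expR (sg ^+ 2)))); last by ring.
  rewrite normrM (ger0_norm (_ : 0 <= 2 :> R))// ler_pM2l// !ler_norml.
  move=> /andP[? ?] /andP[? ?] ?.
  have : 0 <= l ^+ 3 * (sg ^+ 4 * expR (sg ^+ 2)) by rewrite !mulr_ge0 ?expR_ge0 ?exprn_ge0// ltW.
  by move=> ?; apply/andP; split; lra.
by rewrite ler_pM2l.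
Qed.

End normal_moments.

(** * Random variables with finite moments *)

Section tame_variables.
Context {d : measure_display} {Omega : measurableType d} {R : realType}.
Variable P : probability Omega R.
Implicit Types (G : set (set Omega)) (X Y : Omega -> R).

Definition subsigma G : Prop := sigma_algebra setT G /\ G `<=` measurable.

(** This class is closed under sums, products, [cos] and [sin], so the integrability side conditions
    of all expansions below reduce to its closure lemmas, collected in [tame_tac]. *)
Definition tame G X : Prop :=
  measurable_fun setT (X : g_sigma_algebraType G -> R) /\
  forall p : nat, rintegrable P setT (fun w => `|X w| ^+ p).

Lemma subsigma_measurable : subsigma measurable.
Proof. by split=> //; exact: sigma_algebra_measurable. Qed.

Lemma subsigma_generated G A : subsigma G -> <<s G >> A -> G A.
Proof. by move=> [sG _]; rewrite (sigma_algebra_id sG). Qed.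

Lemma subsigma_measurable_fun G X : subsigma G ->
  measurable_fun setT (X : g_sigma_algebraType G -> R) -> measurable_fun setT X.
Proof.
move=> sG mX _ B mB; apply: sG.2.
by apply: (subsigma_generated sG); exact: mX.
Qed.

Lemma tame_measurable G X : subsigma G -> tame G X -> measurable_fun setT X.
Proof. by move=> sG [/(subsigma_measurable_fun sG)]. Qed.

Lemma tame_mono G G' X : subsigma G -> G `<=` G' -> tame G X -> tame G' X.
Proof.
move=> sG GG' [mX iX]; split=> // _ B mB.
by apply: sub_sigma_algebra; apply: GG'; apply: (subsigma_generated sG); exact: mX.
Qed.

Lemma tame_norm_integrable G X : tame G X -> rintegrable P setT (fun w => `|X w|).
Proof.
by move=> [_ /(_ 1%N)]; apply: eq_rintegrable => // w _; rewrite expr1.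
Qed.

Lemma tame_integrable G X : subsigma G -> tame G X -> rintegrable P setT X.
Proof.
move=> sG tX; apply: (rintegrable_le _ _ _ (tame_norm_integrable tX)) => //.
exact: tame_measurable tX.
Qed.

Lemma le_tame G X Y : subsigma G -> measurable_fun setT (X : g_sigma_algebraType G -> R) ->
  (forall w, `|X w| <= Y w) -> (forall p : nat, rintegrable P setT (fun w => Y w ^+ p)) ->
  tame G X.
Proof.
move=> sG mX XY iY; split=> // p; apply: rintegrable_le (iY p) => //.
- apply: measurable_funX; apply: measurableT_comp => //.
  exact: subsigma_measurable_fun mX.
- move=> w _; rewrite normrX normr_id lerXn2r// ?nnegrE//.
  by rewrite (le_trans _ (XY w)).
Qed.

Lemma tame_cst G (c : R) : tame G (fun=> c).
Proof.
split; first exact: measurable_cst.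
move=> p; apply: rintegrable_cst => //.
by rewrite -ge0_fin_numE ?fin_num_measure.
Qed.

Lemma exprD_le (x y : R) p : 0 <= x -> 0 <= y ->
  (x + y) ^+ p <= 2 ^+ p * (x ^+ p + y ^+ p).
Proof.
move=> x0 y0.
wlog xy : x y x0 y0 / x <= y.
  move=> H; have [/H|/ltW/H] := leP x y; first exact.
  by rewrite addrC [in X in _ -> X](addrC (x ^+ p)); exact.
apply: (@le_trans _ _ ((2 * y) ^+ p)).
  by rewrite lerXn2r ?nnegrE ?addr_ge0// ?mulr_ge0//; lra.
by rewrite exprMn ler_wpM2l ?exprn_ge0// lerDr exprn_ge0.
Qed.

Lemma tameD G X Y : subsigma G -> tame G X -> tame G Y -> tame G (fun w => X w + Y w).
Proof.
move=> sG [mX iX] [mY iY].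
apply: (@le_tame G _ (fun w => `|X w| + `|Y w|)) => //.
- exact: measurable_funD.
- by move=> w; exact: ler_normD.
move=> p; apply: (@rintegrable_le _ _ _ _ _ _ (fun w => 2 ^+ p * (`|X w| ^+ p + `|Y w| ^+ p))) => //.
- by apply: measurable_funX; apply: measurable_funD; apply: measurableT_comp => //;
    exact: (subsigma_measurable_fun sG).
- by move=> w _; rewrite ger0_norm ?exprn_ge0 ?addr_ge0// exprD_le.
- by apply: rintegrableZ => //; apply: rintegrableD.
Qed.

(** Young's inequality trades a product for doubled exponents; this is why [tame] asks for all
    moments at once. *)
Lemma tameM G X Y : subsigma G -> tame G X -> tame G Y -> tame G (fun w => X w * Y w).
Proof.
move=> sG [mX iX] [mY iY]; split; first exact: measurable_funM.
move=> p; apply: (@rintegrable_le _ _ _ _ _ _ (fun w => `|X w| ^+ (p + p) + `|Y w| ^+ (p + p))) => //.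
- apply: measurable_funX; apply: measurableT_comp => //.
  by apply: measurable_funM; exact: (subsigma_measurable_fun sG).
- move=> w _; rewrite normrX normr_id normrM exprMn !exprD.
  set x := `|X w| ^+ p; set y := `|Y w| ^+ p.
  have := sqr_ge0 (x - y); have := sqr_ge0 x; have := sqr_ge0 y; rewrite !expr2.
  by lra.
- exact: rintegrableD.
Qed.

Lemma tameZ G X (c : R) : subsigma G -> tame G X -> tame G (fun w => c * X w).
Proof. by move=> sG tX; apply: tameM => //; exact: tame_cst. Qed.

Lemma tameB G X Y : subsigma G -> tame G X -> tame G Y -> tame G (fun w => X w - Y w).
Proof.
move=> sG tX tY; rewrite (_ : (fun w => _) = (fun w => X w + (-1) * Y w)).
  by apply: tameD => //; exact: tameZ.
by apply/funext => w; rewrite mulN1r.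
Qed.

Lemma tameN G X : subsigma G -> tame G X -> tame G (fun w => - X w).
Proof.
move=> sG tX; rewrite (_ : (fun w => _) = (fun w => (-1) * X w)).
  exact: tameZ.
by apply/funext => w; rewrite mulN1r.
Qed.

Lemma tameX G X p : subsigma G -> tame G X -> tame G (fun w => X w ^+ p).
Proof.
move=> sG tX; elim: p => [|p IH].
  by rewrite (_ : (fun w => _) = cst 1); [exact: tame_cst|apply/funext => w; rewrite expr0].
rewrite (_ : (fun w => _) = (fun w => X w * X w ^+ p)); first exact: tameM.
by apply/funext => w; rewrite exprS.
Qed.

Lemma tame_bounded G X (c : R) : subsigma G ->
  measurable_fun setT (X : g_sigma_algebraType G -> R) ->
  (forall w, `|X w| <= c) -> tame G X.
Proof.
move=> sG mX Xc; apply: (@le_tame G _ (fun=> c)) => // p.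
by apply: rintegrable_cst => //; rewrite -ge0_fin_numE ?fin_num_measure.
Qed.

Lemma tame_norm G X : subsigma G -> tame G X -> tame G (fun w => `|X w|).
Proof.
move=> sG [mX iX]; apply: (@le_tame G _ (fun w => `|X w|)) => //.
  by apply: measurableT_comp.
by move=> w; rewrite normr_id.
Qed.

Lemma tame_cos G X : subsigma G -> tame G X -> tame G (fun w => cos (X w)).
Proof.
move=> sG [mX _]; apply: (@tame_bounded _ _ 1) => // [|w]; last exact: cos_max.
apply: measurableT_comp mX; apply: continuous_measurable_fun.
exact: continuous_cos.
Qed.

Lemma tame_sin G X : subsigma G -> tame G X -> tame G (fun w => sin (X w)).
Proof.
move=> sG [mX _]; apply: (@tame_bounded _ _ 1) => // [|w]; last exact: sin_max.
apply: measurableT_comp mX; apply: continuous_measurable_fun.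
exact: continuous_sin.
Qed.

Lemma tame_indic G A : subsigma G -> G A -> tame G (fun w => (\1_A w : R)).
Proof.
move=> sG GA; apply: (@tame_bounded _ _ 1) => //.
  by apply: (measurable_indic (T := g_sigma_algebraType G)); exact: sub_sigma_algebra.
by move=> w; rewrite indicE; case: (_ \in _); rewrite ?normr0 ?normr1.
Qed.

End tame_variables.

(** * Products with a variable of constant conditional mean *)

Section constant_conditional_mean.
Context {d : measure_display} {Omega : measurableType d} {R : realType}.
Variable P : probability Omega R.
Implicit Types (G : set (set Omega)) (X Y H phi : Omega -> R) (c : R).

(* [cmean G phi c] says that the conditional expectation of [phi] given [G] is
   the constant [c]. *)
Definition cmean G phi c : Prop :=
  tame P measurable phi /\
  forall A, G A -> \int[P]_(w in A) phi w = c * fine (P A).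

Let sM := @subsigma_measurable d Omega.

Lemma rint_indic A : measurable A -> \int[P]_w (\1_A w : R) = fine (P A).
Proof. by move=> mA; rewrite /Rintegral integral_indic// setIT. Qed.

Lemma cmean_indic G A phi c : subsigma G -> cmean G phi c -> G A ->
  \int[P]_w (\1_A w * phi w) = c * \int[P]_w (\1_A w : R).
Proof.
move=> sG [_ /(_ A)] phic GA; rewrite rint_indic; last exact: sG.2.
rewrite -phic// [RHS]Rintegral_mkcond; apply: eq_Rintegral => w _.
by rewrite patchE indicE; case: (_ \in _); rewrite ?mul1r ?mul0r.
Qed.

Lemma cmean_simple G phi c (s : seq R) (B : R -> set Omega) :
  subsigma G -> cmean G phi c -> (forall r, G (B r)) ->
  \int[P]_w ((\sum_(r <- s) r * \1_(B r) w) * phi w) =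
  c * \int[P]_w (\sum_(r <- s) r * \1_(B r) w).
Proof.
move=> sG phic GB; have [tphi _] := phic.
have tI r : tame P measurable (fun w => (\1_(B r) w : R)).
  by apply: (tame_indic _ sM); exact: sG.2.
have tS t : tame P measurable (fun w => \sum_(r <- t) r * \1_(B r) w).
  elim: t => [|r t IH].
    by under eq_fun do rewrite big_nil; exact: tame_cst.
  under eq_fun do rewrite big_cons.
  by apply: tameD => //; exact: tameZ.
elim: s => [|r s IH].
  under eq_Rintegral do rewrite big_nil mul0r.
  by under [X in _ = c * X]eq_Rintegral do rewrite big_nil; rewrite Rintegral_cst// mul0r mulr0.
under eq_Rintegral do rewrite big_cons mulrDl -mulrA.
under [X in _ = c * X]eq_Rintegral do rewrite big_cons.
have i1 : rintegrable P setT (fun w => \1_(B r) w * phi w).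
  exact: (tame_integrable sM (tameM sM (tI r) tphi)).
have i2 : rintegrable P setT (fun w => (\1_(B r) w : R)) by exact: (tame_integrable sM (tI r)).
rewrite rintD//; last 2 first.
- exact: rintegrableZ.
- exact: (tame_integrable sM (tameM sM (tS s) tphi)).
rewrite rintD//; last 2 first.
- exact: rintegrableZ.
- exact: (tame_integrable sM (tS s)).
by rewrite IH !rintZ// (cmean_indic sG phic)//; ring.
Qed.

Import HBNNSimple.

(** Simple functions of [G] are covered by [cmean_simple]. They increase to [H], and dominated
    convergence, with bounds [H] and [|H phi|], passes to the limit on both sides. *)
Lemma ge0_cmean_mul G phi c H : subsigma G -> cmean G phi c -> tame P G H ->
  (forall w, 0 <= H w) -> \int[P]_w (H w * phi w) = c * \int[P]_w H w.
Proof.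
move=> sG phic tH H0; have [tphi _] := phic.
have tH' : tame P measurable H by exact: tame_mono sG sG.2 tH.
have mH : measurable_fun setT (fun w : g_sigma_algebraType G => (H w)%:E).
  by apply/measurable_EFinP; case: tH.
pose g := nnsfun_approx measurableT mH.
have gH w : EFin \o g^~ w @ \oo --> (H w)%:E.
  by apply: cvg_nnsfun_approx => // x _; rewrite lee_fin.
have gle n w : g n w <= H w.
  have nd : nondecreasing_seq (fun m => g m w).
    by move=> a b ab; exact/lefP/nd_nnsfun_approx.
  have /fine_cvgP [_ /= cg] := gH w.
  rewrite -(cvg_lim _ cg)//; apply: nondecreasing_cvgn_le => //.
  by apply/cvg_ex; eexists; exact: cg.
have mg n : measurable_fun setT (g n : Omega -> R).
  apply: (@subsigma_measurable_fun _ _ _ G) => //.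
have gE n w : g n w = \sum_(r <- finmap.enum_fset (fset_set (range (g n)))) r * \1_(g n @^-1` [set r]) w.
  rewrite [LHS](fimfunE (g n)) fsbig_finite//.
have eqn n : \int[P]_w (g n w * phi w) = c * \int[P]_w g n w.
  under eq_Rintegral do rewrite gE.
  under [X in _ = c * X]eq_Rintegral do rewrite gE.
  apply: (cmean_simple _ sG phic) => r; apply: (subsigma_generated sG).
  rewrite -[X in <<s _ >> X]setTI.
  have mgn : measurable_fun setT (g n : g_sigma_algebraType G -> R) by [].
  by apply: mgn => //; exact: measurable_set1.
have iH := tame_integrable sM tH'.
have iHphi := tame_norm_integrable (tameM sM tH' tphi).
have mphi := tame_measurable sM tphi.
have mH' := tame_measurable sM tH'.
have cv1 : (\int[P]_w (g n w)%:E @[n --> \oo] --> \int[P]_w (H w)%:E)%E.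
  have [] := @dominated_convergence _ _ _ P setT measurableT (fun n w => (g n w)%:E)
    (fun w => (H w)%:E) (fun w => (H w)%:E) => //.
  - by move=> n; exact/measurable_EFinP.
  - exact/measurable_EFinP.
  - by apply: aeW => w _; exact: gH.
  - by apply: aeW => w n _; rewrite /= lee_fin ger0_norm.
have cv2 : (\int[P]_w (g n w * phi w)%:E @[n --> \oo] --> \int[P]_w (H w * phi w)%:E)%E.
  have [] := @dominated_convergence _ _ _ P setT measurableT (fun n w => (g n w * phi w)%:E)
    (fun w => (H w * phi w)%:E) (fun w => (`|H w * phi w|)%:E) => //.
  - by move=> n; apply/measurable_EFinP; exact: measurable_funM.
  - by apply/measurable_EFinP; exact: measurable_funM.
  - apply: aeW => w _; under eq_fun do rewrite EFinM.
    rewrite EFinM; apply: cvgeZr => //; exact: gH.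
  - apply: aeW => w n _; rewrite /= lee_fin !normrM ler_wpM2r//.
    by rewrite ger0_norm// ger0_norm.
have ig n : rintegrable P setT (g n).
  by apply: rintegrable_le iH => // w _; rewrite ger0_norm.
have igphi n : rintegrable P setT (fun w => g n w * phi w).
  apply: rintegrable_le iHphi => //; first exact: measurable_funM.
  by move=> w _; rewrite !normrM ler_wpM2r// ger0_norm// ger0_norm.
have := cvgeZl (isT : c%:E \is a fin_num) cv1 => cv3.
have e3 : (fun n => c%:E * \int[P]_w (g n w)%:E)%E = (fun n => \int[P]_w (g n w * phi w)%:E)%E.
  by apply/funext => n; rewrite -!EFin_rint// -EFinM -eqn.
have iHp : rintegrable P setT (fun w => H w * phi w) by exact: (tame_integrable sM (tameM sM tH' tphi)).
apply: EFin_inj; rewrite EFinM !EFin_rint//.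
by rewrite e3 in cv3; exact: (cvg_unique _ cv2 cv3).
Qed.

(** [|H| + H] and [|H| - H] are nonnegative, and [H] is half their difference. *)
Lemma cmean_mul G phi c H : subsigma G -> cmean G phi c -> tame P G H ->
  \int[P]_w (H w * phi w) = c * \int[P]_w H w.
Proof.
move=> sG phic tH; have [tphi _] := phic.
have tn := tame_norm sG tH.
pose p w := `|H w| + H w; pose q w := `|H w| - H w.
have tp : tame P G p by exact: tameD.
have tq : tame P G q by exact: tameB.
have ep := ge0_cmean_mul sG phic tp; have eq := ge0_cmean_mul sG phic tq.
have {}ep : \int[P]_w (p w * phi w) = c * \int[P]_w p w.
  by apply: ep => w; rewrite /p; have := ler_norm (- H w); rewrite normrN; lra.
have {}eq : \int[P]_w (q w * phi w) = c * \int[P]_w q w.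
  by apply: eq => w; rewrite /q; have := ler_norm (H w); lra.
have int G' X : subsigma G' -> tame P G' X -> rintegrable P setT X by exact: tame_integrable.
have up Y : tame P G Y -> tame P measurable Y by exact: tame_mono sG.2.
have e1 : \int[P]_w H w = 2^-1 * (\int[P]_w p w - \int[P]_w q w).
  rewrite -rintB//; [|exact: int tp|exact: int tq].
  rewrite -rintZ//; last by apply: (int G) => //; exact: tameB.
  by apply: eq_rint => w _; rewrite /p /q; field.
have e2 : \int[P]_w (H w * phi w) = 2^-1 * (\int[P]_w (p w * phi w) - \int[P]_w (q w * phi w)).
  have tpp := tameM sM (up _ tp) tphi; have tqp := tameM sM (up _ tq) tphi.
  rewrite -rintB//; [|exact: int tpp|exact: int tqp].
  rewrite -rintZ//; last by apply: (int _ _ sM); exact: tameB.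
  by apply: eq_rint => w _; rewrite /p /q; field.
by rewrite e2 ep eq e1; ring.
Qed.

End constant_conditional_mean.

(** * Gaussian increments *)

Section tame_expectation.
Context {d : measure_display} {Omega : measurableType d} {R : realType}.
Variable P : probability Omega R.
Implicit Types (X Y : Omega -> R).
Let sM := @subsigma_measurable d Omega.
Local Notation tameT := (tame P measurable).

Lemma tED X Y : tameT X -> tameT Y ->
  \int[P]_w (X w + Y w) = \int[P]_w X w + \int[P]_w Y w.
Proof. by move=> tX tY; rewrite rintD//; exact: (tame_integrable sM). Qed.

Lemma tEB X Y : tameT X -> tameT Y ->
  \int[P]_w (X w - Y w) = \int[P]_w X w - \int[P]_w Y w.
Proof. by move=> tX tY; rewrite rintB//; exact: (tame_integrable sM). Qed.

Lemma tEZ X (c : R) : tameT X -> \int[P]_w (c * X w) = c * \int[P]_w X w.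
Proof. by move=> tX; rewrite rintZ//; exact: (tame_integrable sM). Qed.

Lemma tE_le X Y : tameT X -> tameT Y -> (forall w, X w <= Y w) ->
  \int[P]_w X w <= \int[P]_w Y w.
Proof. by move=> tX tY XY; apply: le_rint => //; exact: (tame_integrable sM). Qed.

Lemma tE_norm_le X Y : tameT X -> tameT Y -> (forall w, `|X w| <= Y w) ->
  `|\int[P]_w X w| <= \int[P]_w Y w.
Proof. by move=> tX tY XY; apply: norm_rint_le => //; exact: (tame_integrable sM). Qed.

Lemma tE_ge0 X : (forall w, 0 <= X w) -> 0 <= \int[P]_w X w.
Proof. by move=> X0; exact: Rintegral_ge0. Qed.

Lemma tE_cst (c : R) : \int[P]_w c = c.
Proof.
rewrite Rintegral_cst// -[RHS]mulr1 -[X in _ = _ * X]/(fine 1).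
by congr (_ * fine _); exact: probability_setT.
Qed.

End tame_expectation.

Ltac tame_tac := match goal with |- tame _ ?G _ =>
  repeat first
  [ assumption | exact: subsigma_measurable
  | apply: tame_cst | apply: tameN | apply: tameB | apply: tameD | apply: tameX
  | apply: tameM | apply: tame_norm | apply: tame_cos | apply: tame_sin ] end.

Section small_increments.
Context {R : realType}.

(** Cut into [n + 1] equal pieces, an interval of length [D] yields a total increment of at most
    [K * D * sqrt (D / (n + 1))], which falls below any positive [e] for large [n]. *)
Lemma increments_o_constant (g : R -> R) (s t K : R) : s <= t ->
  (forall r r', s <= r -> r <= r' -> r' <= t ->
     `|g r' - g r| <= K * ((r' - r) * Num.sqrt (r' - r))) -> g t = g s.
Proof.
move=> st H; apply/eqP; rewrite -subr_eq0; apply: contraT => gn0.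
pose e : R := `|g t - g s|; have e0 : 0 < e by rewrite normr_gt0.
pose D := t - s; have D0 : 0 <= D by rewrite subr_ge0.
have tel (n : nat) : e <= K * D * Num.sqrt (D / n.+1%:R).
  have n0 : 0 < n.+1%:R :> R by [].
  pose dl := D / n.+1%:R.
  have dl0 : 0 <= dl by rewrite divr_ge0.
  have step (i : nat) : (i <= n.+1)%N ->
      `|g (s + i%:R * dl) - g s| <= i%:R * (K * (dl * Num.sqrt dl)).
    elim: i => [_|i IH lei]; first by rewrite !mul0r addr0 subrr normr0.
    apply: le_trans (ler_distD (g (s + i%:R * dl)) _ _) _.
    have -> : i.+1%:R * (K * (dl * Num.sqrt dl)) =
        K * (dl * Num.sqrt dl) + i%:R * (K * (dl * Num.sqrt dl)) by rewrite -natr1; ring.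
    apply: lerD; last exact/IH/ltnW.
    have := H (s + i%:R * dl) (s + i.+1%:R * dl).
    rewrite (_ : s + i.+1%:R * dl - (s + i%:R * dl) = dl); last by rewrite -natr1; ring.
    apply.
    - by rewrite lerDl mulr_ge0.
    - by rewrite lerD2l ler_wpM2r// ler_nat.
    - rewrite -lerBrDl /dl mulrCA ler_piMr// ler_pdivrMr// mul1r ler_nat.
      exact: lei.
  have := step n.+1 (leqnn _); rewrite /dl mulrCA mulfV ?gt_eqF// mulr1.
  rewrite (_ : s + D = t); last by rewrite /D; ring.
  move/le_trans; apply; rewrite le_eqVlt; apply/orP; left; apply/eqP.
  by field; rewrite gt_eqF.
have KD0 : 0 <= K * D.
  have := tel 0%N; have := sqrtr_ge0 (D / 1); set q := Num.sqrt _ => q0 h.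
  by rewrite leNgt; apply/negP => KDn; nra.
have sq (n : nat) : e ^+ 2 * n.+1%:R <= (K * D) ^+ 2 * D.
  have := tel n => h.
  have : e ^+ 2 <= (K * D * Num.sqrt (D / n.+1%:R)) ^+ 2.
    by rewrite lerXn2r ?nnegrE ?(ltW e0)// mulr_ge0 ?sqrtr_ge0.
  by rewrite exprMn sqr_sqrtr ?divr_ge0// mulrA ler_pdivlMr.
have e20 : 0 < e ^+ 2 by rewrite exprn_gt0.
pose n := Num.bound ((K * D) ^+ 2 * D / e ^+ 2).
suff h : (K * D) ^+ 2 * D < e ^+ 2 * n.+1%:R by have := lt_le_trans h (sq n); rewrite ltxx.
rewrite mulrC -ltr_pdivrMl// mulrC; apply: (@lt_trans _ _ n%:R); last by rewrite ltr_nat.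
have h0 : 0 <= (K * D) ^+ 2 * D / e ^+ 2.
  by apply: divr_ge0; [apply: mulr_ge0 => //; exact: sqr_ge0|exact: ltW].
by have h1 := archi_boundP h0; rewrite [ltLHS]mulrC.
Qed.

End small_increments.

(** * Third and fourth moments and characteristic function from two conditional moments *)

Section gaussian_increments.
Context {d : measure_display} {Omega : measurableType d} {R : realType}.
Variable P : probability Omega R.
Let sM := @subsigma_measurable d Omega.
Implicit Types (F : R -> set (set Omega)) (L : R -> Omega -> R) (H : Omega -> R).

(** Exact values are required for the first two conditional moments only; the even moments need just
    the Brownian order of magnitude. This can be verified for [a Mx + b My] without their joint law,
    and the Gaussian identities below follow from it, in the spirit of Levy's characterisation. *)
Definition gaussian_increments F L (v : R) (K : nat -> R) : Prop :=
  [/\ 0 <= v, (forall p, 0 <= K p),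
      (forall t, 0 <= t -> subsigma (F t)) /\ (forall s t, 0 <= s -> s <= t -> F s `<=` F t),
      (forall s t, 0 <= s -> s <= t -> tame P (F t) (fun w => L t w - L s w)) &
      (forall s t, 0 <= s -> s <= t ->
        [/\ cmean P (F s) (fun w => L t w - L s w) 0,
            cmean P (F s) (fun w => (L t w - L s w) ^+ 2) (v * (t - s)) &
            forall p : nat, \int[P]_w ((L t w - L s w) ^+ p.*2) <= K p * (t - s) ^+ p])].

(** Young's inequality with weight [kappa]. For [kappa = 0] an arbitrarily small weight is used
    instead, the second moment of [Z] being then at most zero. *)
Lemma rint_mul_small (Y Z : Omega -> R) (kappa C : R) : tame P measurable Y ->
  tame P measurable Z -> 0 <= kappa -> \int[P]_w (Z w ^+ 2) <= kappa ^+ 2 * C ->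
  `|\int[P]_w (Y w * Z w)| <= kappa * (\int[P]_w (Y w ^+ 2) + C).
Proof.
move=> tY tZ k0 ZC.
have key e : 0 < e -> `|\int[P]_w (Y w * Z w)| <=
    e * \int[P]_w (Y w ^+ 2) + kappa ^+ 2 / e * C.
  move=> e0.
  apply: (@le_trans _ _ (e * \int[P]_w (Y w ^+ 2) + e^-1 * \int[P]_w (Z w ^+ 2))).
    rewrite -!tEZ; [|tame_tac..]; rewrite -tED; [|tame_tac..].
    apply: tE_norm_le; [tame_tac..|move=> w].
    rewrite normrM -(real_normK (num_real (Y w))) -(real_normK (num_real (Z w))).
    set y := `|Y w|; set z := `|Z w|.
    have : 0 <= (e * y - z) ^+ 2 by exact: sqr_ge0.
    have : 0 <= (e * y) ^+ 2 + z ^+ 2 by rewrite addr_ge0 ?sqr_ge0.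
    rewrite (_ : e * y ^+ 2 + e^-1 * z ^+ 2 = ((e * y) ^+ 2 + z ^+ 2) / e); last by field; rewrite gt_eqF.
    by rewrite ler_pdivlMr// => ? ?; nra.
  by rewrite lerD2l mulrC (mulrAC _ _ C) ler_wpM2r// invr_ge0 ltW.
have [k1|k1] := ltP 0 kappa.
  have := key _ k1; rewrite (_ : kappa ^+ 2 / kappa = kappa); first by rewrite mulrDr.
  by field; rewrite gt_eqF.
have {k1}k1 : kappa = 0 by apply/le_anti; rewrite k1 k0.
rewrite k1 mul0r; apply/ler_addgt0Pl => e e0; rewrite addr0.
set y := \int[P]_w (Y w ^+ 2) in key.
have y0 : 0 <= y by apply: tE_ge0 => w; exact: sqr_ge0.
have e1 : 0 < e / (y + 1) by rewrite divr_gt0// ltr_wpDl.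
apply: le_trans (key _ e1) _; rewrite k1 expr0n/= !mul0r addr0.
by rewrite mulrAC ler_pdivrMr ?ltr_wpDl// ler_wpM2l ?(ltW e0)// lerDl.
Qed.

Section moments.
Variables (F : R -> set (set Omega)) (L : R -> Omega -> R) (v : R) (K : nat -> R).
Hypothesis LF : gaussian_increments F L v K.
Variables (s t : R) (s0 : 0 <= s) (st : s <= t).

Let v0 : 0 <= v. Proof. by case: LF. Qed.
Let K0 p : 0 <= K p. Proof. by case: LF. Qed.

Let sF r : s <= r -> subsigma (F r).
Proof. by move=> sr; case: LF => _ _ [+ _] _ _; apply; exact: le_trans sr. Qed.

Let up H r : s <= r -> tame P (F s) H -> tame P (F r) H.
Proof.
by move=> sr; apply: tame_mono; [exact: sF|case: LF => _ _ [_ +] _ _; exact].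
Qed.

Let tT r (X : Omega -> R) : s <= r -> tame P (F r) X -> tame P measurable X.
Proof. by move=> sr; apply: tame_mono; [exact: sF|exact: (sF sr).2]. Qed.

Let X r := fun w => L r w - L s w.
Let tX r : s <= r -> tame P (F r) (X r).
Proof. by move=> sr; case: LF => _ _ _ + _; exact. Qed.

Let Dl r r' := fun w => L r' w - L r w.

Let tD r r' : s <= r -> r <= r' -> tame P measurable (Dl r r').
Proof.
move=> sr rr'; have s0r : 0 <= r by exact: le_trans sr.
by apply: (@tT r'); [exact: le_trans rr'|case: LF => _ _ _ + _; exact].
Qed.

Let Dmean r r' : s <= r -> r <= r' -> [/\ cmean P (F r) (Dl r r') 0,
  cmean P (F r) (fun w => Dl r r' w ^+ 2) (v * (r' - r)) &
  forall p : nat, \int[P]_w (Dl r r' w ^+ p.*2) <= K p * (r' - r) ^+ p].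
Proof. by move=> sr rr'; case: LF => _ _ _ _; apply => //; exact: le_trans sr. Qed.

Let XD r r' w : X r' w = X r w + Dl r r' w.
Proof. by rewrite /X /Dl; ring. Qed.

Let mD1 H r r' : s <= r -> r <= r' -> tame P (F r) H -> \int[P]_w (H w * Dl r r' w) = 0.
Proof.
by move=> sr rr' tH; have [h _ _] := Dmean sr rr'; rewrite (cmean_mul (sF sr) h tH) mul0r.
Qed.

Let mD2 H r r' : s <= r -> r <= r' -> tame P (F r) H ->
  \int[P]_w (H w * Dl r r' w ^+ 2) = v * (r' - r) * \int[P]_w H w.
Proof.
by move=> sr rr' tH; have [_ h _] := Dmean sr rr'; rewrite (cmean_mul (sF sr) h tH).
Qed.

(* Third-order terms are negligible. *)
Let mD3 H r r' : s <= r -> r <= r' -> tame P (F r) H ->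
  `|\int[P]_w (H w * Dl r r' w ^+ 3)| <=
  (r' - r) * Num.sqrt (r' - r) * (\int[P]_w (H w ^+ 2) + K 3).
Proof.
move=> sr rr' tH; have [_ _ h] := Dmean sr rr'.
have tDD := tD sr rr'; have tHT := tT sr tH.
have d0 : 0 <= r' - r by rewrite subr_ge0.
apply: rint_mul_small => //; [tame_tac|by rewrite mulr_ge0// sqrtr_ge0|].
rewrite exprMn sqr_sqrtr// -exprSr mulrC.
by under eq_Rintegral do rewrite -exprM; exact: (h 3).
Qed.

(** The true order is [(r' - r)^2]; it is weakened to the exponent [3/2] of [increments_o_constant]
    by bounding one factor [sqrt (r' - r)] by [sqrt (t - s)]. *)
Let mD4 H r r' : s <= r -> r <= r' -> r' <= t -> tame P (F r) H ->
  `|\int[P]_w (H w * Dl r r' w ^+ 4)| <=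
  (r' - r) * Num.sqrt (r' - r) * (Num.sqrt (t - s) * (\int[P]_w (H w ^+ 2) + K 4)).
Proof.
move=> sr rr' r't tH; have [_ _ h] := Dmean sr rr'.
have tDD := tD sr rr'; have tHT := tT sr tH.
have d0 : 0 <= r' - r by rewrite subr_ge0.
apply: (@le_trans _ _ ((r' - r) ^+ 2 * (\int[P]_w (H w ^+ 2) + K 4))).
  apply: rint_mul_small => //; [tame_tac|exact: sqr_ge0|].
  rewrite -exprM mulrC.
  by under eq_Rintegral do rewrite -exprM; exact: (h 4).
rewrite mulrA; apply: ler_wpM2r.
  by rewrite addr_ge0// tE_ge0// => w; exact: sqr_ge0.
rewrite expr2 -mulrA ler_wpM2l// -[leLHS]sqr_sqrtr// expr2 ler_wpM2l ?sqrtr_ge0//.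
by rewrite ler_wsqrtr// lerB.
Qed.

Lemma increment_mean H : tame P (F s) H -> \int[P]_w (H w * X t w) = 0.
Proof. by move=> tH; exact: mD1. Qed.

Lemma increment_sqr H : tame P (F s) H ->
  \int[P]_w (H w * X t w ^+ 2) = v * (t - s) * \int[P]_w H w.
Proof. by move=> tH; exact: mD2. Qed.

(** In the expansion of [(X r + D)^3] the term linear in [D] has mean zero, and the quadratic one is
    proportional to the mean of [H * X r], also zero. The remaining [D^3] is negligible, so the
    moment does not move from its value [0] at time [s]. *)
Lemma increment_cube H : tame P (F s) H -> \int[P]_w (H w * X t w ^+ 3) = 0.
Proof.
move=> tH; pose g r := \int[P]_w (H w * X r w ^+ 3).
have g0 : g s = 0.
  rewrite /g; under eq_Rintegral do rewrite /X subrr expr0n mulr0.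
  exact: tE_cst.
rewrite -[LHS]/(g t) -g0.
apply: (@increments_o_constant _ g s t (\int[P]_w (H w ^+ 2) + K 3)) => // r r' sr rr' r't.
have tHr := up sr tH; have tXr := tX sr; have tDr := tD sr rr'.
have tHT := tT sr tHr; have tXT := tT sr tXr; have sr' := le_trans sr rr'.
have sFr := sF sr.
have -> : g r' - g r = \int[P]_w (H w * Dl r r' w ^+ 3).
  have -> : g r' = g r + 3 * \int[P]_w ((H w * X r w ^+ 2) * Dl r r' w) +
      3 * \int[P]_w ((H w * X r w) * Dl r r' w ^+ 2) + \int[P]_w (H w * Dl r r' w ^+ 3).
    rewrite /g -!tEZ; [|tame_tac..].
    rewrite -!tED; [|tame_tac..].
    by apply: eq_rint => w _; rewrite (XD r r'); ring.
  rewrite mD1//; last by tame_tac.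
  rewrite mD2//; last by tame_tac.
  rewrite mD1//; ring.
by rewrite mulrC; exact: mD3.
Qed.

(** Ito's formula by hand: the moment has derivative [6 v E[H X^2] = 6 v^2 (r - s) E[H]].
    Subtracting the integral of this leaves a function whose increments are negligible. *)
Lemma increment_quart H : tame P (F s) H ->
  \int[P]_w (H w * X t w ^+ 4) = 3 * (v * (t - s)) ^+ 2 * \int[P]_w H w.
Proof.
move=> tH; pose f r := \int[P]_w (H w * X r w ^+ 4).
pose EH := \int[P]_w H w.
pose g r := f r - 3 * (v * (r - s)) ^+ 2 * EH.
have g0 : g s = 0.
  rewrite /g /f; under eq_Rintegral do rewrite /X subrr expr0n mulr0.
  by rewrite tE_cst; ring.
suff : g t = 0 by rewrite /g /f => /eqP; rewrite subr_eq0 => /eqP.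
rewrite -g0.
(* A bound on the second moment of [H * X r] uniform in [r], since the constant in
   [increments_o_constant] may not depend on [r]. *)
pose HX := \int[P]_w (H w ^+ 4) + K 2 * (t - s) ^+ 2.
pose H2 := \int[P]_w (H w ^+ 2).
apply: (@increments_o_constant _ g s t (4 * (HX + K 3) + Num.sqrt (t - s) * (H2 + K 4)
   + Num.sqrt (t - s) * `|3 * v ^+ 2 * EH|)) => // r r' sr rr' r't.
have tHr := up sr tH; have tXr := tX sr; have tDr := tD sr rr'.
have tHT := tT sr tHr; have tXT := tT sr tXr; have sr' := le_trans sr rr'.
have sFr := sF sr; have d0 : 0 <= r' - r by rewrite subr_ge0.
have fE : f r' = f r + 4 * \int[P]_w ((H w * X r w ^+ 3) * Dl r r' w) +
      6 * \int[P]_w ((H w * X r w ^+ 2) * Dl r r' w ^+ 2) +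
      4 * \int[P]_w ((H w * X r w) * Dl r r' w ^+ 3) + \int[P]_w (H w * Dl r r' w ^+ 4).
  rewrite /f -!tEZ; [|tame_tac..].
  rewrite -!tED; [|tame_tac..].
  by apply: eq_rint => w _; rewrite (XD r r'); ring.
have -> : g r' - g r = 4 * \int[P]_w ((H w * X r w) * Dl r r' w ^+ 3)
    + \int[P]_w (H w * Dl r r' w ^+ 4) - (r' - r) ^+ 2 * (3 * v ^+ 2 * EH).
  rewrite /g fE mD1//; last by tame_tac.
  rewrite mD2//; last by tame_tac.
  by rewrite mD2//; rewrite -/EH; ring.
have tHX : tame P (F r) (fun w => H w * X r w) by tame_tac.
have := mD3 sr rr' tHX; have := mD4 sr rr' r't tHr.
set A3 := \int[P]_w (H w * X r w * Dl r r' w ^+ 3).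
set A4 := \int[P]_w (H w * Dl r r' w ^+ 4).
set q := (r' - r) * Num.sqrt (r' - r).
have q0 : 0 <= q by rewrite mulr_ge0// sqrtr_ge0.
rewrite -/H2 => h4 h3.
have HXle : \int[P]_w ((H w * X r w) ^+ 2) <= HX.
  apply: (@le_trans _ _ (\int[P]_w (H w ^+ 4) + \int[P]_w (X r w ^+ 4))).
    rewrite -tED; [|tame_tac..]; apply: tE_le; [tame_tac..|move=> w].
    rewrite exprMn; have := sqr_ge0 (H w ^+ 2 - X r w ^+ 2).
    have := sqr_ge0 (H w ^+ 2); have := sqr_ge0 (X r w ^+ 2); rewrite -!exprM; nra.
  rewrite lerD2l; have [_ _ /(_ 2%N)] := Dmean (lexx s) sr.
  move/le_trans; apply; rewrite ler_wpM2l//.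
  by rewrite lerXn2r ?nnegrE ?subr_ge0// lerD2r (le_trans rr').
have e2 : (r' - r) ^+ 2 <= q * Num.sqrt (t - s).
  rewrite /q expr2 -mulrA ler_wpM2l// -[leLHS]sqr_sqrtr// expr2 ler_wpM2l ?sqrtr_ge0//.
  by rewrite ler_wsqrtr// lerB.
apply: le_trans (ler_normB _ _) _.
apply: (@le_trans _ _ (4 * `|A3| + `|A4| + (r' - r) ^+ 2 * `|3 * v ^+ 2 * EH|)).
  rewrite normrM (ger0_norm (sqr_ge0 _)) lerD2r.
  by apply: le_trans (ler_normD _ _) _; rewrite normrM (ger0_norm (_ : 0 <= 4 :> R)).
have h5 : (r' - r) ^+ 2 * `|3 * v ^+ 2 * EH| <= q * Num.sqrt (t - s) * `|3 * v ^+ 2 * EH|.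
  by rewrite ler_wpM2r.
have h6 : `|A3| <= q * (HX + K 3) by apply: le_trans h3 _; rewrite ler_wpM2l// lerD2r.
rewrite [leRHS]mulrC; nra.
Qed.

(** By the addition formula the mean [f] of [cos (u X)] satisfies [f r' = f r (1 - ka (r' - r))] up
    to negligible terms, because [sin (u X)] is multiplied by an increment of conditional mean zero.
    The integrating factor [exp (ka (r - s))] makes it constant. *)
Lemma increment_cos (u : R) :
  \int[P]_w cos (u * X t w) = expR (- (u ^+ 2 * v * (t - s) / 2)).
Proof.
pose f r := \int[P]_w cos (u * X r w).
pose ka := u ^+ 2 * v / 2.
have ka0 : 0 <= ka by rewrite divr_ge0// mulr_ge0// sqr_ge0.
pose g r := expR (ka * (r - s)) * f r.
have g1 : g s = 1.
  rewrite /g /f subrr mulr0 expR0 mul1r.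
  under eq_Rintegral do rewrite /X subrr mulr0 cos0.
  exact: tE_cst.
suff gt : g t = 1.
  rewrite -[LHS]/(f t) (_ : - _ = - (ka * (t - s))); last by rewrite /ka; field.
  rewrite expRN; apply: (mulfI (lt0r_neq0 (expR_gt0 (ka * (t - s))))).
  by rewrite -[LHS]/(g t) gt mulfV// gt_eqF// expR_gt0.
rewrite -g1.
have ts0 : 0 <= t - s by rewrite subr_ge0.
pose Q : R := Num.sqrt (t - s).
have Q0 : 0 <= Q := sqrtr_ge0 _.
pose EE := expR (ka * (t - s)).
pose C3 := 1 + K 3.
apply: (@increments_o_constant _ g s t (EE * (ka ^+ 2 * Q * EE)
   + EE * (u ^+ 4 * K 2 * Q / 24 + `|u| ^+ 3 * C3))) => // r r' sr rr' r't.
have tXr := tX sr; have tDr := tD sr rr'.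
have tXT := tT sr tXr; have sr' := le_trans sr rr'.
have sFr := sF sr; have d0 : 0 <= r' - r by rewrite subr_ge0.
have [_ _ mom] := Dmean sr rr'.
set q := (r' - r) * Num.sqrt (r' - r).
have q0 : 0 <= q by rewrite mulr_ge0// sqrtr_ge0.
have e2 : (r' - r) ^+ 2 <= q * Q.
  rewrite /q expr2 -mulrA ler_wpM2l// -[leLHS]sqr_sqrtr// expr2 ler_wpM2l ?sqrtr_ge0//.
  by rewrite ler_wsqrtr// lerB.
pose err1 w := cos (u * X r w) * (cos (u * Dl r r' w) - (1 - (u * Dl r r' w) ^+ 2 / 2)).
pose err2 w := sin (u * X r w) * (sin (u * Dl r r' w) - u * Dl r r' w).
have tuX : tame P (F r) (fun w => u * X r w) by tame_tac.
have tuD : tame P measurable (fun w => u * Dl r r' w) by tame_tac.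
have tuXT : tame P measurable (fun w => u * X r w) by tame_tac.
have te1 : tame P measurable err1 by rewrite /err1; tame_tac.
have te2 : tame P measurable err2 by rewrite /err2; tame_tac.
have fE : f r' = f r * (1 - ka * (r' - r)) + \int[P]_w err1 w - \int[P]_w err2 w.
  have -> : f r' = f r - u ^+ 2 / 2 * \int[P]_w (cos (u * X r w) * Dl r r' w ^+ 2)
      - u * \int[P]_w (sin (u * X r w) * Dl r r' w) + \int[P]_w err1 w - \int[P]_w err2 w.
    rewrite /f -!tEZ; [|tame_tac..].
    rewrite -!tEB; [|tame_tac..].
    rewrite -tED; [|tame_tac..].
    rewrite -tEB; [|tame_tac..].
    by apply: eq_rint => w _; rewrite /err1 /err2 (XD r r') mulrDr cosD; field.
  rewrite mD2//; last by tame_tac.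
  rewrite mD1//; last by tame_tac.
  by rewrite -/(f r) /ka; field.
have b1 : `|\int[P]_w err1 w| <= q * (u ^+ 4 * K 2 * Q / 24).
  apply: (@le_trans _ _ (u ^+ 4 / 24 * \int[P]_w (Dl r r' w ^+ 4))).
    rewrite -tEZ; [|tame_tac]; apply: tE_norm_le; [tame_tac..|move=> w].
    rewrite /err1 normrM; have := cosB_quart (u * Dl r r' w) => /andP[h1 h2].
    rewrite (ger0_norm h1); apply: le_trans (ler_wpM2r h1 (cos_max _)) _.
    by rewrite mul1r (le_trans h2)// exprMn mulrAC.
  apply: (@le_trans _ _ (u ^+ 4 / 24 * (K 2 * (r' - r) ^+ 2))).
    by rewrite ler_wpM2l ?(mom 2)// divr_ge0// -[4%N]/(2 * 2)%N exprM sqr_ge0.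
  rewrite (_ : q * _ = u ^+ 4 / 24 * (K 2 * (q * Q))); last by field.
  rewrite ler_wpM2l ?ler_wpM2l//.
  by rewrite divr_ge0// -[4%N]/(2 * 2)%N exprM sqr_ge0.
have b2 : `|\int[P]_w err2 w| <= q * (`|u| ^+ 3 * C3).
  have tn : tame P measurable (fun w => `|Dl r r' w|) by tame_tac.
  have tz : tame P measurable (fun w => `|Dl r r' w| ^+ 3) by tame_tac.
  apply: (@le_trans _ _ (`|u| ^+ 3 * \int[P]_w (1 * `|Dl r r' w| ^+ 3))).
    rewrite -tEZ; [|tame_tac]; apply: tE_norm_le; [tame_tac..|move=> w].
    rewrite /err2 normrM mul1r; have := sinB_cube (u * Dl r r' w) => h2.
    apply: le_trans (ler_wpM2r (normr_ge0 _) (sin_max _)) _.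
    rewrite mul1r (le_trans h2)// normrM exprMn ler_pdivrMr//.
    by rewrite ler_peMr ?mulr_ge0 ?exprn_ge0//; lra.
  (* The third absolute moment is not among the even moments at hand; it is estimated through the
     sixth. *)
  have := @rint_mul_small (fun=> 1) (fun w => `|Dl r r' w| ^+ 3) q (K 3).
  have -> : \int[P]_w ((1 : R) ^+ 2) = 1 by rewrite expr1n tE_cst.
  rewrite -/C3 => h; rewrite mulrCA ler_wpM2l ?exprn_ge0//.
  apply: le_trans (ler_norm _) _; apply: h => //; first by tame_tac.
  rewrite /q exprMn sqr_sqrtr// -exprSr mulrC.
  under eq_Rintegral do rewrite -exprM -[(3 * 2)%N]/(2 * 3)%N exprM real_normK ?num_real// -exprM.
  exact: (mom 3).
have fr1 : `|f r| <= 1.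
  rewrite -[leRHS](tE_cst P); apply: tE_norm_le; [tame_tac..|move=> w; exact: cos_max].
pose y := ka * (r' - r).
have y0 : 0 <= y by rewrite mulr_ge0.
(* The integrating factor compensates the linear decrease up to second order in the length of the
   time interval. *)
have ey : 0 <= 1 - expR y * (1 - y) <= y ^+ 2 * expR y.
  have a : 0 < expR y := expR_gt0 y.
  have b : expR y * (1 - y) <= 1.
    rewrite -[leRHS](mulfV (lt0r_neq0 a)) -expRN ler_wpM2l ?expR_ge0//.
    by have := @expR_ge1Dx R (- y); lra.
  have e1 := @expR_ge1Dx R y.
  have y3 : 0 <= y ^+ 3 by exact: exprn_ge0.
  apply/andP; split; first lra.
  have : 1 <= (1 - y + y ^+ 2) * expR y.
    apply: (@le_trans _ _ ((1 - y + y ^+ 2) * (1 + y))).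
      by rewrite (_ : _ * _ = 1 + y ^+ 3); [lra|ring].
    by rewrite ler_wpM2l//; nra.
  by lra.
pose E0 := expR (ka * (r - s)).
have gE : g r' - g r = - (E0 * f r * (1 - expR y * (1 - y)))
    + E0 * expR y * (\int[P]_w err1 w - \int[P]_w err2 w).
  rewrite /g fE (_ : ka * (r' - s) = ka * (r - s) + y); last by rewrite /y; ring.
  by rewrite expRD -/E0 /y; ring.
have E00 : 0 <= E0 := expR_ge0 _.
have E0E : E0 <= EE by rewrite ler_expR ler_wpM2l// lerB// (le_trans rr').
have EyE : expR y <= EE by rewrite ler_expR ler_wpM2l// lerB.
have E0y : E0 * expR y <= EE.
  by rewrite -expRD ler_expR /y -mulrDr ler_wpM2l//; lra.
rewrite gE; apply: le_trans (ler_normD _ _) _; rewrite normrN.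
rewrite (_ : _ * q = q * (EE * (ka ^+ 2 * Q * EE)) +
  q * (EE * (u ^+ 4 * K 2 * Q / 24 + `|u| ^+ 3 * C3))); last by rewrite mulrC mulrDr.
apply: lerD.
  rewrite !normrM (ger0_norm E00) (_ : `|1 - _| = 1 - expR y * (1 - y)); last first.
    by rewrite ger0_norm//; case/andP: ey.
  apply: (@le_trans _ _ (EE * 1 * (y ^+ 2 * expR y))).
    by apply: ler_pM; rewrite ?mulr_ge0//; [case/andP: ey|apply: ler_pM|case/andP: ey].
  rewrite mulr1 [leRHS]mulrCA; apply: ler_wpM2l; first exact: expR_ge0.
  rewrite (_ : q * (ka ^+ 2 * Q * EE) = ka ^+ 2 * (q * Q) * EE); last by ring.
  apply: ler_pM => //; [by rewrite mulr_ge0 ?sqr_ge0 ?expR_ge0|].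
  by rewrite /y exprMn ler_wpM2l// sqr_ge0.
rewrite normrM (ger0_norm (mulr_ge0 E00 (expR_ge0 y))) [leRHS]mulrCA.
apply: ler_pM => //; first by rewrite mulr_ge0// expR_ge0.
by apply: le_trans (ler_normB _ _) _; rewrite mulrDr; exact: lerD.
Qed.

End moments.
End gaussian_increments.

(** * Brownian increments *)

Section brownian_increments.
Context {d : measure_display} {Omega : measurableType d} {R : realType}.
Variable P : probability Omega R.
Variable F : R -> set (set Omega).
Hypothesis hF : filtration F.
Implicit Types M : R -> Omega -> R.
Let sM := @subsigma_measurable d Omega.

Let sF t : 0 <= t -> subsigma (F t). Proof. by move=> t0; exact: (hF.1 t t0). Qed.

Let Fmono s t : 0 <= s -> s <= t -> F s `<=` F t. Proof. exact: hF.2. Qed.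

Lemma adapted_measurable M t : adapted F M -> 0 <= t ->
  measurable_fun setT (M t : g_sigma_algebraType (F t) -> R).
Proof.
move=> aM t0 _ B mB; rewrite setTI; apply: sub_sigma_algebra; exact: aM.
Qed.

Lemma adapted_measurable_le M s t : adapted F M -> 0 <= s -> s <= t ->
  measurable_fun setT (M s : g_sigma_algebraType (F t) -> R).
Proof.
move=> aM s0 st _ B mB; rewrite setTI; apply: sub_sigma_algebra.
by apply: (Fmono s0 st); exact: aM.
Qed.

Lemma increment_measurable M s t : adapted F M -> 0 <= s -> s <= t ->
  measurable_fun setT ((fun w => M t w - M s w) : g_sigma_algebraType (F t) -> R).
Proof.
move=> aM s0 st; apply: measurable_funB.
  by apply: adapted_measurable => //; exact: le_trans st.
exact: adapted_measurable_le.
Qed.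

Variable M : R -> Omega -> R.
Hypothesis bM : brownian_motion P F M.
Let aM : adapted F M. Proof. by case: bM. Qed.
Let D s t := fun w => M t w - M s w.

Let mD s t : 0 <= s -> s <= t -> measurable_fun setT (D s t).
Proof.
move=> s0 st; apply: (@subsigma_measurable_fun _ _ _ (F t)); last exact: increment_measurable.
by apply: sF; exact: le_trans st.
Qed.

Let Nt s t := @normal_prob R 0 (Num.sqrt (t - s)).

Lemma ge0_integral_brownian_increment s t (f : R -> \bar R) : 0 <= s -> s < t ->
  measurable_fun setT f -> (forall x, 0 <= f x)%E ->
  (\int[P]_w f (D s t w) = \int[Nt s t]_x f x)%E.
Proof.
move=> s0 st mf f0.
have mD' : measurable_fun setT (D s t : Omega -> measurableTypeR R) := mD s0 (ltW st).
rewrite -(@ge0_integral_pushforward _ _ _ (measurableTypeR R) _ _ mD' P setT f)//.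
apply: (@eq_measure_integral _ (measurableTypeR R)) => /= A mA _.
by case: bM => _ _ _ law _; exact: law.
Qed.

Lemma rint_brownian_increment s t (f : R -> R) : 0 <= s -> s < t ->
  measurable_fun setT f -> rintegrable (Nt s t) setT f ->
  rintegrable P setT (fun w => f (D s t w)) ->
  \int[P]_w f (D s t w) = \int[Nt s t]_x f x.
Proof.
move=> s0 st mf if1 if2; rewrite /Rintegral; congr fine.
have mD' : measurable_fun setT (D s t : Omega -> measurableTypeR R) := mD s0 (ltW st).
rewrite -[LHS](@integral_pushforward _ _ _ (measurableTypeR R) _ _ mD' P setT (EFin \o f))//.
- apply: (@eq_measure_integral _ (measurableTypeR R)) => /= A mA _.
  by case: bM => _ _ _ law _; exact: law.
- exact/measurable_EFinP.
Qed.

Lemma brownian_even_moment s t (p : nat) : 0 <= s -> s <= t ->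
  (\int[P]_w (D s t w ^+ p.*2)%:E <= (normal_moment_cst p * (t - s) ^+ p)%:E)%E.
Proof.
move=> s0; rewrite le_eqVlt => /predU1P[->|st].
  rewrite /D; under eq_integral do rewrite subrr.
  have PT : (P : {measure set Omega -> \bar R}) setT = 1%E by exact: probability_setT.
  rewrite integral_cst// PT mule1 subrr.
  (* For [p = 0] both powers of zero are [1], and the claim becomes [1 <= 2 exp (1/2)]. *)
  case: p => [|p]; last by rewrite doubleS expr0n/= lee_fin expr0n/= mulr0.
  rewrite /normal_moment_cst -[0.*2]/0%N fact0 !expr0 mul1r mulr1 lee_fin.
  rewrite !mul1r; have := @expR_ge1Dx R 2^-1; set e := expR _ => he.
  by have : 0 <= 2^-1 :> R; [rewrite invr_ge0|move=> ?; lra].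
have st0 : 0 < t - s by rewrite subr_gt0.
rewrite (@ge0_integral_brownian_increment s t (fun x => (x ^+ p.*2)%:E))//.
- have := @normal_even_moment R (Num.sqrt (t - s)) p; rewrite sqrtr_gt0 => /(_ st0).
  by rewrite -[X in (_ <= (_ * X)%:E)%E -> _]mul1r -muln2 mulnC exprM sqr_sqrtr ?(ltW st0)// mul1r.
- by apply/measurable_EFinP; exact: exprn_measurable.
- by move=> x; rewrite lee_fin -muln2 mulnC exprM exprn_ge0// sqr_ge0.
Qed.

Lemma tame_brownian_increment s t : 0 <= s -> s <= t -> tame P (F t) (D s t).
Proof.
move=> s0 st; split; first exact: increment_measurable.
have even p : rintegrable P setT (fun w => D s t w ^+ p.*2).
  apply: ge0_rintegrable (brownian_even_moment p s0 st) => //.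
    by apply: measurable_funX; exact: mD.
  by move=> w _; rewrite -muln2 mulnC exprM exprn_ge0// sqr_ge0.
move=> p; apply: (@rintegrable_le _ _ _ _ _ _ (fun w => D s t w ^+ 0.*2 + D s t w ^+ p.*2)) => //.
- by apply: measurable_funX; apply: measurableT_comp => //; exact: mD.
- move=> w _; rewrite normrX normr_id.
  have -> : D s t w ^+ p.*2 = (`|D s t w| ^+ p) ^+ 2.
    by rewrite -exprM -muln2 [RHS]exprM -!exprM mulnC [LHS]exprM [RHS]exprM real_normK ?num_real.
  rewrite -[0.*2]/0%N expr0; set y := `|D s t w| ^+ p.
  by have := sqr_ge0 (y - 1); have := sqr_ge0 y; nra.
- exact: rintegrableD.
Qed.

Let preD s t : set (set Omega) := preimage_set_system setT (D s t) measurable.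

Let preD_sigma s t : 0 <= s -> s <= t -> subsigma (preD s t).
Proof.
move=> s0 st; split.
  by apply: sigma_algebra_preimage; exact: sigma_algebra_measurable.
by move=> _ [B mB <-]; exact: mD.
Qed.

(* Independence read backwards: given the increment, [1_A] has constant mean. *)
Lemma brownian_cmean s t (f : R -> R) : 0 <= s -> s < t ->
  measurable_fun setT f -> rintegrable (Nt s t) setT f ->
  tame P measurable (fun w => f (D s t w)) ->
  cmean P (F s) (fun w => f (D s t w)) (\int[Nt s t]_x f x).
Proof.
move=> s0 st mf if1 tf; split=> // A FA.
have mA : measurable A by exact: (sF s0).2.
have st' := ltW st.
have cA : cmean P (preD s t) (fun w => \1_A w : R) (fine (P A)).
  split; first exact: tame_indic.
  move=> _ [B mB <-]; rewrite setTI /Rintegral.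
  have mDB : measurable (D s t @^-1` B) by rewrite -[X in measurable X]setTI; exact: mD.
  rewrite integral_indic// -fineM ?fin_num_measure//.
  by case: bM => _ _ _ _ ind; rewrite -ind.
have tfp : tame P (preD s t) (fun w => f (D s t w)).
  split; last by case: tf.
  move=> _ C mC; apply: sub_sigma_algebra; exists (f @^-1` C); last by [].
  by rewrite -[X in measurable X]setTI; exact: mf.
rewrite Rintegral_mkcond.
transitivity (\int[P]_w (f (D s t w) * \1_A w)).
  apply: eq_rint => w _; rewrite patchE indicE.
  by case: (_ \in _); rewrite ?mulr1 ?mulr0.
rewrite (cmean_mul (preD_sigma s0 st') cA tfp) mulrC; congr (_ * _).
by apply: rint_brownian_increment => //; exact: (tame_integrable sM tf).
Qed.

Lemma brownian_gaussian_increments :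
  gaussian_increments P F M 1 (@normal_moment_cst R).
Proof.
split=> //.
- by move=> p; rewrite /normal_moment_cst !mulr_ge0// expR_ge0.
- exact: tame_brownian_increment.
move=> s t s0 st.
have tD : tame P measurable (D s t).
  apply: tame_mono (tame_brownian_increment s0 st); first by apply: sF; exact: le_trans st.
  by have [] := sF (le_trans s0 st).
have mom (p : nat) : \int[P]_w D s t w ^+ p.*2 <= @normal_moment_cst R p * (t - s) ^+ p.
  rewrite -lee_fin EFin_rint//; first exact: brownian_even_moment.
  exact: (tame_integrable sM (tameX _ sM tD)).
(* The law of an increment is prescribed for [s < t] only; at [s = t] the increment vanishes
   identically and every claim is checked directly. *)
move: st; rewrite le_eqVlt => /predU1P[ts|st].
  have D0 : D s t = fun=> 0 by apply/funext => w; rewrite /D -ts subrr.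
  split=> //.
  - split=> // A _; rewrite mul0r; have -> : (fun w => M t w - M s w) = fun=> 0 by [].
    by rewrite /Rintegral integral0.
  - split; first by apply: tameX.
    move=> A _; rewrite mul1r -ts subrr mul0r /Rintegral.
    under eq_integral do rewrite subrr expr0n.
    by rewrite integral0.
have st0 : 0 < t - s by rewrite subr_gt0.
have sg0 : 0 < Num.sqrt (t - s) by rewrite sqrtr_gt0.
have [m1 m2] := normal_mean_var sg0.
split=> //.
- rewrite -m1; apply: (@brownian_cmean s t (fun x => x)) => //.
  by apply: eq_rintegrable (integrable_normal_expn 1 sg0) => // x _; rewrite expr1.
- rewrite mul1r -[X in cmean _ _ _ X](sqr_sqrtr (ltW st0)) -m2.
  apply: (@brownian_cmean s t (fun x => x ^+ 2)) => //.
  + exact: integrable_normal_expn.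
  + exact: tameX.
Qed.

(** [M 0] vanishes only almost everywhere, so the moments are transferred from the increment over
    [[0, s]] by almost-everywhere equality, while measurability comes from adaptedness. *)
Lemma tame_brownian s t : 0 <= s -> s <= t -> tame P (F t) (M s).
Proof.
move=> s0 st; split; first exact: adapted_measurable_le.
have t0 := le_trans s0 st.
have ms u : 0 <= u -> measurable_fun setT (M u).
  by move=> u0; apply: (subsigma_measurable_fun (sF u0)); exact: adapted_measurable.
have [_ i] := tame_brownian_increment (lexx 0) s0.
have [_ M0 _ _ _] := bM.
move=> p; have /integrableP[m1 l1] := i p; apply/integrableP; split.
  by apply/measurable_EFinP; apply: measurable_funX; apply: measurableT_comp => //; exact: ms.
apply: le_lt_trans l1; rewrite le_eqVlt; apply/orP; left; apply/eqP.
apply: ge0_ae_eq_integral => //.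
- by apply: measurableT_comp => //; apply/measurable_EFinP; apply: measurable_funX; apply: measurableT_comp => //; exact: ms.
- exact: measurableT_comp.
- by apply: filterS M0 => w /= M0w _; rewrite /D M0w subr0.
Qed.

End brownian_increments.

(** * Linear combinations of two Brownian motions with a given bracket *)

Section correlated_brownian_motions.
Context {d : measure_display} {Omega : measurableType d} {R : realType}.
Variable P : probability Omega R.
Variable F : R -> set (set Omega).
Hypothesis hF : filtration F.
Variables (Mx My : R -> Omega -> R) (rho : R).
Hypotheses (bX : brownian_motion P F Mx) (bY : brownian_motion P F My).
Hypothesis bXY : bracket_rate P F Mx My rho.
Hypothesis rho1 : -1 <= rho <= 1.
Let sM := @subsigma_measurable d Omega.
Let sF t : 0 <= t -> subsigma (F t). Proof. by move=> t0; exact: (hF.1 t t0). Qed.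

Definition linear_moment_cst (a b : R) (p : nat) : R :=
  2 ^+ p.*2 * (a ^+ p.*2 + b ^+ p.*2) * @normal_moment_cst R p.

(** The product of increments is the increment of [Mx My] minus [Mx s] times the increment of [My]
    minus [My s] times that of [Mx]. The last two have conditional mean zero; the bracket hypothesis
    gives the first. *)
Lemma increments_product_cmean s t : 0 <= s -> s <= t ->
  cmean P (F s) (fun w => (Mx t w - Mx s w) * (My t w - My s w)) (rho * (t - s)).
Proof.
move=> s0 st; have t0 := le_trans s0 st.
have [_ _ _ hX1 hX2] := brownian_gaussian_increments hF bX.
have [_ _ _ hY1 hY2] := brownian_gaussian_increments hF bY.
have tmono r X : 0 <= r -> tame P (F r) X -> tame P measurable X.
  by move=> r0; apply: tame_mono; [exact: sF|exact: (sF r0).2].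
have tDX : tame P measurable (fun w => Mx t w - Mx s w) by exact: (tmono t _ t0 (hX1 _ _ s0 st)).
have tDY : tame P measurable (fun w => My t w - My s w) by exact: (tmono t _ t0 (hY1 _ _ s0 st)).
split; first exact: tameM.
move=> A FA; have mA : measurable A by exact: (sF s0).2.
have tA : tame P (F s) (fun w => \1_A w : R) by apply: tame_indic => //; exact: sF.
have sFs := sF s0.
have tXs := tame_brownian hF bX s0 (lexx s); have tYs := tame_brownian hF bY s0 (lexx s).
have tXt := tmono t _ t0 (tame_brownian hF bX t0 (lexx t)).
have tYt := tmono t _ t0 (tame_brownian hF bY t0 (lexx t)).
have tXs' := tmono s _ s0 tXs; have tYs' := tmono s _ s0 tYs; have tA' := tmono s _ s0 tA.
have [cX _ _] := hX2 _ _ s0 st; have [cY _ _] := hY2 _ _ s0 st.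
have toI (X : Omega -> R) : \int[P]_(w in A) X w = \int[P]_w (\1_A w * X w).
  rewrite Rintegral_mkcond; apply: eq_rint => w _; rewrite patchE indicE.
  by case: (_ \in _); rewrite ?mul1r ?mul0r.
have e1 : \int[P]_w (\1_A w * Mx s w * (My t w - My s w)) = 0.
  by rewrite (cmean_mul sFs cY) ?mul0r//; tame_tac.
have e2 : \int[P]_w (\1_A w * My s w * (Mx t w - Mx s w)) = 0.
  by rewrite (cmean_mul sFs cX) ?mul0r//; tame_tac.
have e3 : \int[P]_w (\1_A w * (Mx t w * My t w - rho * t)) =
          \int[P]_w (\1_A w * (Mx s w * My s w - rho * s)).
  by rewrite -!toI /Rintegral; case: bXY => _ _ /(_ s t s0 st A FA) ->.
rewrite toI.
transitivity (\int[P]_w (\1_A w * (Mx t w * My t w - rho * t))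
  - \int[P]_w (\1_A w * (Mx s w * My s w - rho * s))
  - \int[P]_w (\1_A w * Mx s w * (My t w - My s w))
  - \int[P]_w (\1_A w * My s w * (Mx t w - Mx s w))
  + rho * (t - s) * \int[P]_w (\1_A w)).
  rewrite -tEZ; [|tame_tac..].
  rewrite -!tEB; [|tame_tac..].
  rewrite -tED; [|tame_tac..].
  by apply: eq_rint => w _; ring.
by rewrite e1 e2 e3 (rint_indic P mA); ring.
Qed.

(** The conditional variance comes from expanding the square and [increments_product_cmean]. The
    bound [|rho| <= 1] makes the variance rate nonnegative. *)
Lemma brownian_linear_increments (a b : R) :
  gaussian_increments P F (fun t w => a * Mx t w + b * My t w)
    (a ^+ 2 + b ^+ 2 + 2 * rho * (a * b)) (linear_moment_cst a b).
Proof.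
have [_ K0 sFm hX1 hX2] := brownian_gaussian_increments hF bX.
have [_ _ _ hY1 hY2] := brownian_gaussian_increments hF bY.
have ev (x : R) p : 0 <= x ^+ p.*2 by rewrite -muln2 mulnC exprM exprn_ge0// sqr_ge0.
have E s t w : a * Mx t w + b * My t w - (a * Mx s w + b * My s w) =
  a * (Mx t w - Mx s w) + b * (My t w - My s w) by ring.
split=> //.
- have := sqr_ge0 (a + b); have := sqr_ge0 (a - b); case/andP: rho1 => ? ?; nra.
- move=> p; rewrite /linear_moment_cst.
  by rewrite mulr_ge0// mulr_ge0// ?addr_ge0// exprn_ge0.
- move=> s t s0 st; under eq_fun do rewrite E.
  have sFt := sF (le_trans s0 st).
  have h1 := hX1 _ _ s0 st; have h2 := hY1 _ _ s0 st.
  by tame_tac.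
move=> s t s0 st; have t0 := le_trans s0 st.
have [cX cX2 mX] := hX2 _ _ s0 st; have [cY cY2 mY] := hY2 _ _ s0 st.
have cXY := increments_product_cmean s0 st.
have [tX _] := cX; have [tY _] := cY.
have iA (X : Omega -> R) A : tame P measurable X -> F s A -> rintegrable P A X.
  move=> tX' FA; apply: (@integrableS _ _ _ P setT) => //; first exact: (sF s0).2.
  exact: (tame_integrable sM tX').
split.
- under [X in cmean _ _ X]eq_fun do rewrite E.
  split; first by tame_tac.
  move=> A FA; have mA : measurable A by exact: (sF s0).2.
  have iX := iA _ _ tX FA; have iY := iA _ _ tY FA.
  rewrite rintD//; [|exact: rintegrableZ..].
  by rewrite !rintZ// (cX.2 A FA) (cY.2 A FA); ring.
- under [X in cmean _ _ X]eq_fun do rewrite E.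
  split; first by tame_tac.
  move=> A FA; have mA : measurable A by exact: (sF s0).2.
  have iX := iA _ _ cX2.1 FA; have iY := iA _ _ cY2.1 FA; have iXY := iA _ _ cXY.1 FA.
  transitivity (\int[P]_(w in A) (a ^+ 2 * (Mx t w - Mx s w) ^+ 2 +
     (b ^+ 2 * (My t w - My s w) ^+ 2 + 2 * (a * b) * ((Mx t w - Mx s w) * (My t w - My s w))))).
    by apply: eq_rint => w _; ring.
  rewrite rintD//; [|exact: rintegrableZ|by apply: rintegrableD => //; exact: rintegrableZ].
  rewrite rintD//; [|exact: rintegrableZ..].
  by rewrite !rintZ// (cX2.2 A FA) (cY2.2 A FA) (cXY.2 A FA); ring.
- move=> p; under eq_Rintegral do rewrite E.
  have := mX p; have := mY p.
  set IX := \int[P]_w ((Mx t w - Mx s w) ^+ _); set IY := \int[P]_w ((My t w - My s w) ^+ _).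
  set kk := normal_moment_cst p * _ => hY hX.
  apply: (@le_trans _ _ (2 ^+ p.*2 * (a ^+ p.*2 * IX + b ^+ p.*2 * IY))).
    rewrite /IX /IY -!tEZ; [|tame_tac..]; rewrite -tED; [|tame_tac..]; rewrite -tEZ; [|tame_tac].
    apply: tE_le; [tame_tac..|move=> w].
    set x := Mx t w - Mx s w; set y := My t w - My s w.
    have evn (z : R) : z ^+ p.*2 = `|z| ^+ p.*2 by rewrite -normrX ger0_norm.
    rewrite -!exprMn (evn (a * x + b * y)) (evn (a * x)) (evn (b * y)).
    apply: le_trans (exprD_le _ (normr_ge0 _) (normr_ge0 _)).
    by rewrite lerXn2r ?nnegrE ?addr_ge0// ler_normD.
  rewrite (_ : linear_moment_cst a b p * _ = 2 ^+ p.*2 * (a ^+ p.*2 * kk + b ^+ p.*2 * kk)); last first.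
    by rewrite /linear_moment_cst /kk; ring.
  by rewrite ler_wpM2l ?exprn_ge0//; apply: lerD; rewrite ler_wpM2l.
Qed.

End correlated_brownian_motions.

(** * The local error of one step *)

Lemma normM_le {R : realDomainType} (x y a b : R) : `|x| <= a -> `|y| <= b -> `|x * y| <= a * b.
Proof. by move=> xa yb; rewrite normrM ler_pM. Qed.

Lemma le_of_eq {R : realDomainType} (x y : R) : x = y -> x <= y.
Proof. by move->. Qed.

Lemma normD_le {R : realDomainType} (x y a b : R) : `|x| <= a -> `|y| <= b -> `|x + y| <= a + b.
Proof. by move=> xa yb; rewrite (le_trans (ler_normD _ _))// lerD. Qed.

Lemma normB_le {R : realDomainType} (x y a b : R) : `|x| <= a -> `|y| <= b -> `|x - y| <= a + b.
Proof. by move=> xa yb; rewrite (le_trans (ler_normB _ _))// lerD. Qed.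

Lemma normX_le {R : realDomainType} (x a : R) n : `|x| <= a -> `|x ^+ n| <= a ^+ n.
Proof. by move=> xa; rewrite normrX lerXn2r// nnegrE (le_trans _ xa). Qed.

Section local_error.
Context {R : realType}.
Variables (mux muy rhox rhoy k t h2 : R).
Variables (xi eta a b A B dX dY M Z : R).
Hypotheses (rx : 0 <= rhox <= 1) (ry : 0 <= rhoy <= 1).
Hypotheses (tk : t ^+ 2 = k) (t01 : 0 <= t <= 1) (h20 : 0 <= h2).
Hypotheses (M1 : 1 <= M) (Z1 : 1 <= Z).
Hypotheses (xiM : `|xi| <= M) (etaM : `|eta| <= M) (muM : `|mux| + `|muy| <= M)
  (driftM : `|mux * xi + muy * eta| <= M) (driftM' : `|mux * a + muy * b| <= M).
Hypotheses (axi : `|a| <= `|xi|) (beta : `|b| <= `|eta|).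
Hypotheses (aE : `|a - xi| <= h2 * M ^+ 3) (bE : `|b - eta| <= h2 * M ^+ 3).
Hypotheses (A0 : 0 <= A <= xi ^+ 2) (B0 : 0 <= B <= eta ^+ 2).
Hypotheses (AE : `|A - xi ^+ 2| <= h2 * M ^+ 4) (BE : `|B - eta ^+ 2| <= h2 * M ^+ 4).
Hypotheses (dXZ : `|dX| <= t * Z) (dYZ : `|dY| <= t * Z).

Let s := Num.sqrt rhox * a * dX + Num.sqrt rhoy * b * dY.
Let y := Num.sqrt rhox * xi * dX + Num.sqrt rhoy * eta * dY.
Let q := rhox * a ^+ 2 + rhoy * b ^+ 2.
Let q' := rhox * xi ^+ 2 + rhoy * eta ^+ 2.
(** Complex numbers are split by hand: the factor of one step has numerator [N1 - i s] and
    denominator [D1 + i D2]. Here [a], [b], [A], [B] stand for the discrete symbols at the frequency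
    [(xi, eta)]. *)
Let N1 := 1 - s ^+ 2 / 2 + k / 2 * q.
Let D1 := 1 + k / 2 * (A + B).
Let D2 := k * (mux * a + muy * b).
Let w1 := ((1 - rhox) * xi ^+ 2 + (1 - rhoy) * eta ^+ 2) / 2.
Let w2 := mux * xi + muy * eta.
Let G0 := expR (- (k * w1)).
(** [ka1 + i ka2 = G0 (D1 + i D2) exp (- i k w2)]: the denominator times the deterministic part of
    the exact factor. *)
Let ka1 := G0 * (D1 * cos (k * w2) + D2 * sin (k * w2)).
Let ka2 := G0 * (D2 * cos (k * w2) - D1 * sin (k * w2)).
(** [E1 + i E2 = (N1 - i s) - (ka1 + i ka2) exp (- i y)], that is [num - den * Q_(n+1) / Q_n]. *)
Let E1 := N1 - ka1 * cos y - ka2 * sin y.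
Let E2 := - s - ka2 * cos y + ka1 * sin y.
(** The part of [E2] of order [sqrt k * u]. The cubic term comes from [sin y], and the last one from
    [ka1] being [1 + k / 2 * q'] to leading order. *)
Let odd := y - s - y ^+ 3 / 6 + k / 2 * q' * y.
Let W := M * Z.
Let u := k + h2.

Let t0 : 0 <= t. Proof. by case/andP: t01. Qed.
Let k0 : 0 <= k. Proof. by rewrite -tk sqr_ge0. Qed.
Let kt : k <= t.
Proof. by rewrite -tk expr2 ler_piMl//; case/andP: t01. Qed.
Let k1 : k <= 1. Proof. by apply: le_trans kt _; case/andP: t01. Qed.
Let M0 : 0 <= M. Proof. exact: le_trans M1. Qed.
Let Z0 : 0 <= Z. Proof. exact: le_trans Z1. Qed.
Let MW : M <= W. Proof. by rewrite /W ler_peMr. Qed.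
Let W1 : 1 <= W. Proof. exact: le_trans MW. Qed.
Let W0 : 0 <= W. Proof. exact: le_trans W1. Qed.
Let u0 : 0 <= u. Proof. by rewrite addr_ge0. Qed.
Let ku : k <= u. Proof. by rewrite lerDl. Qed.
Let hu : h2 <= u. Proof. by rewrite lerDr. Qed.

Let WX i j : (i <= j)%N -> W ^+ i <= W ^+ j.
Proof. by move=> ij; rewrite ler_weXn2l. Qed.

Let MX i j : (i <= j)%N -> M ^+ i <= W ^+ j.
Proof.
by move=> ij; apply: le_trans (WX ij); rewrite lerXn2r// nnegrE.
Qed.

(** Higher-order terms of the expansions are all compared with the single monomial [k * u * W ^+ 6],
    so that their numerical constants simply add up. *)
Let absorb (c e : R) (i : nat) : 0 <= c -> 0 <= e -> e <= u -> (i <= 6)%N ->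
  c * e * W ^+ i <= c * u * W ^+ 6.
Proof.
move=> c0 e0 eu i6; apply: ler_pM; rewrite ?mulr_ge0 ?exprn_ge0//.
- exact: ler_wpM2l.
- exact: WX.
Qed.

Let sqx : `|Num.sqrt rhox| <= 1.
Proof. by rewrite ger0_norm ?sqrtr_ge0// -sqrtr1 ler_wsqrtr//; case/andP: rx. Qed.
Let sqy : `|Num.sqrt rhoy| <= 1.
Proof. by rewrite ger0_norm ?sqrtr_ge0// -sqrtr1 ler_wsqrtr//; case/andP: ry. Qed.

Let aM : `|a| <= M. Proof. exact: le_trans xiM. Qed.
Let bM : `|b| <= M. Proof. exact: le_trans etaM. Qed.

Let lin (c d C : R) : `|c| <= C -> `|d| <= C ->
  `|Num.sqrt rhox * c * dX + Num.sqrt rhoy * d * dY| <= 2 * (C * (t * Z)).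
Proof.
move=> cC dC; rewrite (_ : 2 * _ = 1 * C * (t * Z) + 1 * C * (t * Z)); last by ring.
by apply: normD_le; apply: normM_le => //; exact: normM_le.
Qed.

Lemma noise_le : `|s| <= 2 * t * W.
Proof. by rewrite (_ : 2 * t * W = 2 * (M * (t * Z))); [exact: lin|rewrite /W; ring]. Qed.

Let y_le : `|y| <= 2 * t * W.
Proof. by rewrite (_ : 2 * t * W = 2 * (M * (t * Z))); [exact: lin|rewrite /W; ring]. Qed.

Let MZ3 : M ^+ 3 * Z <= W ^+ 3.
Proof.
rewrite /W exprMn ler_wpM2l ?exprn_ge0// exprS ler_peMr//.
by rewrite -(expr1n _ 2) lerXn2r// nnegrE.
Qed.

Let sy_le : `|s - y| <= 2 * t * h2 * W ^+ 3.
Proof.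
rewrite (_ : s - y = Num.sqrt rhox * (a - xi) * dX + Num.sqrt rhoy * (b - eta) * dY); last first.
  by rewrite /s /y; ring.
apply: le_trans (lin aE bE) _.
rewrite (_ : 2 * _ = 2 * t * h2 * (M ^+ 3 * Z)); last by ring.
by rewrite ler_wpM2l// !mulr_ge0.
Qed.

Let qle (c d : R) : `|c| <= M -> `|d| <= M -> 0 <= rhox * c ^+ 2 + rhoy * d ^+ 2 <= 2 * M ^+ 2.
Proof.
move=> /(normX_le 2) + /(normX_le 2); rewrite !(ger0_norm (sqr_ge0 _)) => h1 h2'.
have := sqr_ge0 c; have := sqr_ge0 d; case/andP: rx => ? ?; case/andP: ry => ? ? ? ?.
by apply/andP; split; nra.
Qed.

Lemma num_sub1_le : `|N1 - 1| <= 3 * t * W ^+ 2.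
Proof.
rewrite (_ : N1 - 1 = k / 2 * q - s ^+ 2 / 2); last by rewrite /N1; ring.
have /andP[q0 qM] := qle aM bM.
have hs : s ^+ 2 <= 4 * k * W ^+ 2.
  have := normX_le 2 noise_le; rewrite (ger0_norm (sqr_ge0 _)) => /le_trans; apply.
  by rewrite !exprMn tk; apply: le_of_eq; ring.
have h1 : k * W ^+ 2 <= t * W ^+ 2 by rewrite ler_wpM2r// exprn_ge0.
have h2' : q <= 2 * W ^+ 2 by apply: le_trans qM _; rewrite ler_wpM2l// MX.
have h3 : k * q <= k * (2 * W ^+ 2) by rewrite ler_wpM2l.
have h4 : 0 <= k * q by rewrite mulr_ge0.
have h5 := sqr_ge0 s.
by rewrite ler_norml; apply/andP; split; lra.
Qed.

Let G01 : 0 <= G0 <= 1.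
Proof.
rewrite expR_ge0/= -expR0 ler_expR oppr_le0 mulr_ge0//.
have := sqr_ge0 xi; have := sqr_ge0 eta; case/andP: rx => ? ?; case/andP: ry => ? ? ? ?.
by rewrite /w1; nra.
Qed.

Let w10 : 0 <= w1 <= M ^+ 2.
Proof.
have := normX_le 2 xiM; have := normX_le 2 etaM; rewrite !(ger0_norm (sqr_ge0 _)) => h1 h2'.
have := sqr_ge0 xi; have := sqr_ge0 eta; case/andP: rx => ? ?; case/andP: ry => ? ? ? ?.
by rewrite /w1; apply/andP; split; nra.
Qed.

Let r := xi ^+ 2 + eta ^+ 2.
Let r0 : 0 <= r <= 2 * M ^+ 2.
Proof.
have := normX_le 2 xiM; have := normX_le 2 etaM; rewrite !(ger0_norm (sqr_ge0 _)) => h1 h2'.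
by rewrite /r; have := sqr_ge0 xi; have := sqr_ge0 eta => ? ?; apply/andP; split; lra.
Qed.

Let D1sub : 0 <= D1 - 1 <= k * W ^+ 2.
Proof.
case/andP: A0 => a0 a1; case/andP: B0 => b0 b1; case/andP: r0 => r00 rM.
have h : A + B <= 2 * W ^+ 2.
  apply: (@le_trans _ _ (2 * M ^+ 2)); last by rewrite ler_wpM2l// MX.
  by rewrite /r in rM; lra.
have : k * (A + B) <= k * (2 * W ^+ 2) by rewrite ler_wpM2l.
have : 0 <= k * (A + B) by rewrite mulr_ge0// addr_ge0.
by rewrite /D1 => ? ?; apply/andP; split; lra.
Qed.

Let D1E : `|D1 - (1 + k / 2 * r)| <= k * h2 * W ^+ 4.
Proof.
rewrite (_ : _ - _ = k / 2 * ((A - xi ^+ 2) + (B - eta ^+ 2))); last by rewrite /D1 /r; ring.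
rewrite normrM ger0_norm ?divr_ge0//.
have : `|(A - xi ^+ 2) + (B - eta ^+ 2)| <= h2 * M ^+ 4 + h2 * M ^+ 4 by exact: normD_le.
have m4 : h2 * M ^+ 4 <= h2 * W ^+ 4 by rewrite ler_wpM2l// MX.
set X := `|_| => hX.
have : k * X <= k * (2 * (h2 * W ^+ 4)) by rewrite ler_wpM2l//; lra.
by lra.
Qed.

Let D2_le : `|D2| <= k * W.
Proof.
by rewrite /D2 normrM (ger0_norm k0) ler_wpM2l// (le_trans driftM').
Qed.

Let D2E : `|D2 - k * w2| <= k * h2 * W ^+ 4.
Proof.
rewrite (_ : _ - _ = k * (mux * (a - xi) + muy * (b - eta))); last by rewrite /D2 /w2; ring.
rewrite normrM (ger0_norm k0) -mulrA ler_wpM2l//.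
apply: (@le_trans _ _ (`|mux| * (h2 * M ^+ 3) + `|muy| * (h2 * M ^+ 3))).
  by apply: normD_le; exact: normM_le.
rewrite -mulrDl; apply: (@le_trans _ _ (M * (h2 * M ^+ 3))).
  by rewrite ler_wpM2r// mulr_ge0// exprn_ge0.
by rewrite mulrCA -exprS ler_wpM2l// MX.
Qed.

Let kw2_le : `|k * w2| <= k * W.
Proof. by rewrite normrM (ger0_norm k0) ler_wpM2l// (le_trans driftM). Qed.

Let e1_le : `|G0 - (1 - k * w1)| <= k ^+ 2 * W ^+ 4.
Proof.
case/andP: w10 => w0 wM; have kw0 : 0 <= k * w1 by rewrite mulr_ge0.
have /andP[h1 h2'] := expRN_bound kw0.
rewrite ger0_norm//; apply: le_trans h2' _; rewrite exprMn ler_wpM2l ?sqr_ge0//.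
rewrite -[4%N]/(2 * 2)%N exprM lerXn2r ?nnegrE ?exprn_ge0//.
by apply: le_trans wM _; rewrite MX.
Qed.

Let e2_le : `|cos (k * w2) - 1| <= k ^+ 2 * W ^+ 2.
Proof.
have /andP[h1 h2'] := cosB1_bound (k * w2).
rewrite distrC ger0_norm//; apply: le_trans h2' _.
have := normX_le 2 kw2_le; rewrite (ger0_norm (sqr_ge0 _)) exprMn => h.
by have := sqr_ge0 (k * w2); lra.
Qed.

Let sin_kw2 : `|sin (k * w2)| <= k * W.
Proof. exact: le_trans (sin_norm_le _) kw2_le. Qed.

Let e3_le : `|sin (k * w2) - k * w2| <= k ^+ 2 * W ^+ 3.
Proof.
apply: le_trans (sinB_cube _) _.
have : `|k * w2| ^+ 3 <= (k * W) ^+ 3 by rewrite lerXn2r ?nnegrE ?mulr_ge0.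
rewrite exprMn => h.
have : k ^+ 3 * W ^+ 3 <= k ^+ 2 * W ^+ 3.
  by rewrite ler_wpM2r ?exprn_ge0// exprS ler_piMl// sqr_ge0.
have : 0 <= k ^+ 2 * W ^+ 3 by rewrite mulr_ge0// exprn_ge0.
by have : 0 <= `|k * w2| ^+ 3 by []; lra.
Qed.

Let kk j : (j <= 6)%N -> k ^+ 2 * W ^+ j <= k * u * W ^+ 6.
Proof. by move=> j6; rewrite expr2; exact: absorb. Qed.

Let kh j : (j <= 6)%N -> k * h2 * W ^+ j <= k * u * W ^+ 6.
Proof. by move=> j6; exact: absorb. Qed.

Let T0 : 0 <= k * u * W ^+ 6.
Proof. by rewrite !mulr_ge0// exprn_ge0. Qed.

Let D1_le : `|D1| <= 2 * W ^+ 2.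
Proof.
case/andP: D1sub => h0 h1; rewrite ger0_norm; last by lra.
have : k * W ^+ 2 <= W ^+ 2 by rewrite ler_piMl// exprn_ge0.
by have := WX (isT : (0 <= 2)%N); rewrite expr0; lra.
Qed.

(** Up to order [k * u], [D1] is [1 + k r / 2] and [G0] is [1 - k (r - q') / 2], so their product is
    [1 + k q' / 2]; the rotation by [k * w2] enters at second order only. *)
Let c1_le : `|ka1 - (1 + k / 2 * q')| <= 8 * (k * u * W ^+ 6).
Proof.
pose f1 := D1 * cos (k * w2) + D2 * sin (k * w2) - (1 + k / 2 * r).
have f1_le : `|f1| <= 4 * (k * u * W ^+ 6).
  rewrite (_ : f1 = (D1 - (1 + k / 2 * r)) + D1 * (cos (k * w2) - 1) + D2 * sin (k * w2)); last first.
    by rewrite /f1; ring.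
  rewrite (_ : 4 * _ = k * u * W ^+ 6 + 2 * (k * u * W ^+ 6) + k * u * W ^+ 6); last by ring.
  apply: normD_le; first apply: normD_le.
  - exact: le_trans D1E (kh _).
  - apply: le_trans (normM_le D1_le e2_le) _.
    rewrite [leLHS](_ : _ = 2 * (k ^+ 2 * W ^+ 4)); last by ring.
    by rewrite ler_wpM2l// kk.
  - apply: le_trans (normM_le D2_le sin_kw2) _.
    by rewrite [leLHS](_ : _ = k ^+ 2 * W ^+ 2); [exact: kk|ring].
rewrite (_ : ka1 - _ = G0 * f1 + (G0 - (1 - k * w1)) * (1 + k / 2 * r) - (k * w1) * (k / 2 * r)); last first.
  by rewrite /ka1 /f1 /q' /w1 /r; field.
case/andP: G01 => g0 g1; case/andP: w10 => w0 wM; case/andP: r0 => r00 rM.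
have rW : `|r| <= 2 * W ^+ 2.
  by rewrite ger0_norm//; apply: le_trans rM _; rewrite ler_wpM2l// MX.
have kr : `|k / 2 * r| <= k * W ^+ 2.
  by rewrite normrM (ger0_norm (_ : 0 <= k / 2)) ?divr_ge0//; have := ler_wpM2l k0 rW; lra.
have kr1 : `|1 + k / 2 * r| <= 2 * W ^+ 2.
  apply: le_trans (normD_le (lexx _) kr) _; rewrite normr1.
  have : k * W ^+ 2 <= W ^+ 2 by rewrite ler_piMl// exprn_ge0.
  by have := WX (isT : (0 <= 2)%N); rewrite expr0; lra.
have kw : `|k * w1| <= k * W ^+ 2.
  by rewrite normrM !ger0_norm// ler_wpM2l// (le_trans wM)// MX.
rewrite (_ : 8 * _ = 1 * (4 * (k * u * W ^+ 6)) + 2 * (k * u * W ^+ 6) + 2 * (k * u * W ^+ 6)); last by ring.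
apply: normB_le; first apply: normD_le.
- by apply: normM_le => //; rewrite ger0_norm.
- apply: le_trans (normM_le e1_le kr1) _.
  rewrite [leLHS](_ : _ = 2 * (k ^+ 2 * W ^+ 6)); last by ring.
  by rewrite ler_wpM2l// kk.
- apply: le_trans (normM_le kw kr) _.
  rewrite [leLHS](_ : _ = k ^+ 2 * W ^+ 4); last by ring.
  by have := kk (isT : (4 <= 6)%N); have := T0; lra.
Qed.

(** [D2] and [D1 * sin (k * w2)] both equal [k * w2] to leading order and cancel. *)
Let c2_le : `|ka2| <= 4 * (k * u * W ^+ 6).
Proof.
case/andP: G01 => g0 g1.
rewrite (_ : 4 * _ = 1 * (4 * (k * u * W ^+ 6))); last by ring.
apply: normM_le; first by rewrite ger0_norm.
rewrite (_ : D2 * _ - _ = (D2 - k * w2) + D2 * (cos (k * w2) - 1) - (D1 - 1) * sin (k * w2)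
   - (sin (k * w2) - k * w2)); last by ring.
rewrite (_ : 4 * _ = k * u * W ^+ 6 + k * u * W ^+ 6 + k * u * W ^+ 6 + k * u * W ^+ 6); last by ring.
apply: normB_le; [apply: normB_le; [apply: normD_le|]|].
- exact: le_trans D2E (kh _).
- apply: le_trans (normM_le D2_le e2_le) _.
  apply: le_trans (kk (isT : (3 <= 6)%N)).
  rewrite [leLHS](_ : _ = k * (k ^+ 2 * W ^+ 3)); last by ring.
  by rewrite ler_piMl// mulr_ge0 ?sqr_ge0// exprn_ge0.
- case/andP: D1sub => d0 d1.
  apply: le_trans (normM_le (_ : `|D1 - 1| <= k * W ^+ 2) sin_kw2) _; first by rewrite ger0_norm.
  by rewrite [leLHS](_ : _ = k ^+ 2 * W ^+ 3); [exact: kk|ring].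
- exact: le_trans e3_le (kk _).
Qed.

Let y2_le : y ^+ 2 <= 4 * (k * W ^+ 2).
Proof.
have := normX_le 2 y_le; rewrite (ger0_norm (sqr_ge0 _)) => /le_trans; apply.
by rewrite !exprMn tk; apply: le_of_eq; ring.
Qed.

Let y3_le : `|y| ^+ 3 <= 8 * (t * (k * W ^+ 3)).
Proof.
rewrite -normrX; apply: le_trans (normX_le 3 y_le) _.
by rewrite !exprMn (_ : t ^+ 3 = t * k); [apply: le_of_eq; ring|rewrite -tk; ring].
Qed.

Let q'0 : 0 <= q' <= 2 * W ^+ 2.
Proof.
have /andP[h0 h1] := qle xiM etaM; rewrite /q' h0/=.
by apply: le_trans h1 _; rewrite ler_wpM2l// MX.
Qed.

Let kq' : `|k / 2 * q'| <= k * W ^+ 2.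
Proof.
case/andP: q'0 => h0 h1; rewrite ger0_norm ?mulr_ge0 ?divr_ge0//.
by have := ler_wpM2l k0 h1; lra.
Qed.

Let cos1 : `|cos y| <= 1. Proof. exact: cos_max. Qed.
Let sin1 : `|sin y| <= 1. Proof. exact: sin_max. Qed.

(** [1 - s^2 / 2] is matched with [cos y], and [k q / 2] with the excess of [ka1] over [1]. There
    remain the Taylor remainder of the cosine, the differences of discrete and exact symbols, and
    products of small terms. *)
Lemma error_re_le : `|E1| <= 32 * (k * u * W ^+ 6).
Proof.
rewrite (_ : E1 = (1 - y ^+ 2 / 2 - cos y) - (s - y) * (s + y) / 2 + k / 2 * (q - q')
   + k / 2 * q' * (1 - cos y) - (ka1 - (1 + k / 2 * q')) * cos y - ka2 * sin y); last first.
  by rewrite /E1 /N1; field.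
set T := k * u * W ^+ 6.
rewrite (_ : 32 * T = T + 4 * T + 4 * T + 4 * T + 8 * T * 1 + 4 * T * 1 + 7 * T); last by ring.
apply: ler_wpDr; first by rewrite mulr_ge0.
apply: normB_le; [apply: normB_le; [apply: normD_le; [apply: normD_le; [apply: normB_le|]|]|]|].
- rewrite distrC; have /andP[h0 h1] := cosB_quart y; rewrite ger0_norm//.
  apply: le_trans h1 _; have h2' : y ^+ 4 <= (4 * (k * W ^+ 2)) ^+ 2.
    by rewrite -[4%N]/(2 * 2)%N exprM lerXn2r ?nnegrE ?sqr_ge0// !mulr_ge0// exprn_ge0.
  have := kk (isT : (4 <= 6)%N); rewrite -/T => h3.
  rewrite (_ : (4 * _) ^+ 2 = 16 * (k ^+ 2 * W ^+ 4)) in h2'; last by ring.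
  by have := T0; rewrite -/T => h4; lra.
- rewrite normrM (_ : `|2^-1| = 2^-1); last by rewrite ger0_norm// invr_ge0.
  have h1 : `|s + y| <= 4 * t * W by apply: le_trans (normD_le noise_le y_le) _; apply: le_of_eq; ring.
  have := normM_le sy_le h1; rewrite (_ : _ * _ * W ^+ 3 * _ = 8 * (k * h2 * W ^+ 4)); last by rewrite -tk; ring.
  by have := kh (isT : (4 <= 6)%N); rewrite -/T; lra.
- have h1 (c d x : R) : `|c| <= M -> `|x| <= M -> `|c - x| <= h2 * M ^+ 3 ->
      0 <= d <= 1 -> `|d * (c ^+ 2 - x ^+ 2)| <= 2 * (h2 * W ^+ 4).
    move=> cM xM cx /andP[d0 d1].
    rewrite (_ : 2 * _ = 1 * (2 * (h2 * W ^+ 4))); last by ring.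
    apply: normM_le; first by rewrite ger0_norm.
    rewrite (_ : c ^+ 2 - x ^+ 2 = (c - x) * (c + x)); last by ring.
    apply: le_trans (normM_le cx (normD_le cM xM)) _.
    rewrite [leLHS](_ : _ = 2 * (h2 * M ^+ 4)); last by ring.
    by rewrite ler_wpM2l// ler_wpM2l// MX.
  have h2' : `|q - q'| <= 4 * (h2 * W ^+ 4).
    rewrite (_ : q - q' = rhox * (a ^+ 2 - xi ^+ 2) + rhoy * (b ^+ 2 - eta ^+ 2)); last by rewrite /q /q'; ring.
    rewrite (_ : 4 * _ = 2 * (h2 * W ^+ 4) + 2 * (h2 * W ^+ 4)); last by ring.
    by apply: normD_le; exact: h1.
  rewrite normrM (ger0_norm (_ : 0 <= k / 2)) ?divr_ge0//.
  have := ler_wpM2l k0 h2'; have := kh (isT : (4 <= 6)%N); rewrite -/T.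
  by have := T0; rewrite -/T; lra.
- have h1 : `|1 - cos y| <= 4 * (k * W ^+ 2).
    have /andP[g0 g1] := cosB1_bound y; rewrite ger0_norm//.
    by have := sqr_ge0 y; have := y2_le; lra.
  apply: le_trans (normM_le kq' h1) _.
  rewrite [leLHS](_ : _ = 4 * (k ^+ 2 * W ^+ 4)); last by ring.
  by rewrite ler_wpM2l// kk.
- exact: normM_le.
- exact: normM_le.
Qed.

Lemma error_im_le : `|E2 - odd| <= 32 * (k * u * W ^+ 6).
Proof.
rewrite (_ : E2 - odd = (sin y - y + y ^+ 3 / 6) + k / 2 * q' * (sin y - y)
   + (ka1 - (1 + k / 2 * q')) * sin y - ka2 * cos y); last first.
  by rewrite /E2 /odd; field.
set T := k * u * W ^+ 6.
rewrite (_ : 32 * T = T + 2 * T + 8 * T * 1 + 4 * T * 1 + 17 * T); last by ring.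
apply: ler_wpDr; first by rewrite mulr_ge0.
have k2t : k ^+ 2 * t <= k ^+ 2 by rewrite ler_piMr ?sqr_ge0//; case/andP: t01.
have W5 : 0 <= W ^+ 5 by rewrite exprn_ge0.
apply: normB_le; [apply: normD_le; [apply: normD_le|]|].
- apply: le_trans (sinB_quint y) _.
  have h1 : `|y| ^+ 5 <= 32 * (k ^+ 2 * t * W ^+ 5).
    rewrite -normrX; apply: le_trans (normX_le 5 y_le) _.
    by rewrite !exprMn -tk; apply: le_of_eq; ring.
  have : k ^+ 2 * t * W ^+ 5 <= k ^+ 2 * W ^+ 5 by rewrite ler_wpM2r.
  have := kk (isT : (5 <= 6)%N); rewrite -/T.
  by have := T0; rewrite -/T; lra.
- apply: le_trans (normM_le kq' (sinB_cube y)) _.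
  have h1 : k * W ^+ 2 * `|y| ^+ 3 <= k * W ^+ 2 * (8 * (t * (k * W ^+ 3))).
    by rewrite ler_wpM2l// mulr_ge0// exprn_ge0.
  rewrite (_ : k * W ^+ 2 * (8 * _) = 8 * (k ^+ 2 * t * W ^+ 5)) in h1; last by ring.
  have : k ^+ 2 * t * W ^+ 5 <= k ^+ 2 * W ^+ 5 by rewrite ler_wpM2r.
  have := kk (isT : (5 <= 6)%N); rewrite -/T mulrA.
  by have := T0; rewrite -/T; lra.
- exact: normM_le.
- exact: normM_le.
Qed.

Lemma odd_le : `|odd| <= 6 * (t * u * W ^+ 3).
Proof.
rewrite (_ : odd = - (s - y) - y ^+ 3 / 6 + k / 2 * q' * y); last by rewrite /odd; ring.
have W3 : 0 <= W ^+ 3 by rewrite exprn_ge0.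
have tW : 0 <= t * W ^+ 3 by rewrite mulr_ge0.
have h1 : t * h2 * W ^+ 3 <= t * u * W ^+ 3 by rewrite ler_wpM2r// ler_wpM2l.
have h2' : t * (k * W ^+ 3) <= t * u * W ^+ 3 by rewrite -mulrA ler_wpM2l// ler_wpM2r.
have h3 : 0 <= t * u * W ^+ 3 by rewrite !mulr_ge0.
rewrite (_ : 6 * _ = 2 * (t * u * W ^+ 3) + 2 * (t * u * W ^+ 3) + 2 * (t * u * W ^+ 3)); last by ring.
apply: normD_le; first apply: normB_le.
- by rewrite normrN; have := sy_le; lra.
- rewrite normrM (_ : `|6^-1| = 6^-1); last by rewrite ger0_norm// invr_ge0.
  by rewrite normrX; have := y3_le; lra.
- apply: le_trans (normM_le kq' y_le) _.
  by rewrite [leLHS](_ : _ = 2 * (t * (k * W ^+ 3))); [lra|ring].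
Qed.

Let WX8 i : (i <= 8)%N -> k * u * W ^+ i <= k * u * W ^+ 8.
Proof. by move=> i8; apply: ler_wpM2l; [rewrite mulr_ge0|exact: WX]. Qed.

Let E2_le : `|E2| <= 38 * (t * u * W ^+ 6).
Proof.
rewrite (_ : E2 = odd + (E2 - odd)); last by ring.
have h1 : t * u * W ^+ 3 <= t * u * W ^+ 6 by rewrite ler_wpM2l ?mulr_ge0// WX.
have h2' : k * u * W ^+ 6 <= t * u * W ^+ 6 by rewrite ler_wpM2r ?exprn_ge0// ler_wpM2r.
apply: le_trans (normD_le odd_le error_im_le) _.
by lra.
Qed.

(** [X1 + i X2 = conj (num) (E1 + i E2) - i odd]. With [odd] removed it has order [k * u], against
    [sqrt k * u] for the available bound on [E2]. *)
Let X1 := N1 * E1 - s * E2.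
Let X2 := s * E1 + (E2 - odd) + (N1 - 1) * E2.

Let sq_le (x c : R) : `|x| <= c -> x ^+ 2 <= c ^+ 2.
Proof. by move=> /(normX_le 2); rewrite ger0_norm ?sqr_ge0. Qed.

Let X1_le : `|X1| <= 210 * (k * u * W ^+ 8).
Proof.
rewrite (_ : X1 = E1 + (N1 - 1) * E1 - s * E2); last by rewrite /X1; ring.
set T := k * u * W ^+ 8.
have T0' : 0 <= T by rewrite !mulr_ge0// exprn_ge0.
rewrite (_ : 210 * T = 32 * T + 96 * T + 76 * T + 6 * T); last by ring.
apply: ler_wpDr; first by rewrite mulr_ge0.
apply: normB_le; first apply: normD_le.
- by apply: le_trans error_re_le _; rewrite ler_wpM2l// WX8.
- apply: le_trans (normM_le num_sub1_le error_re_le) _.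
  rewrite [leLHS](_ : _ = 96 * (t * T)); last by rewrite /T; ring.
  by rewrite ler_wpM2l// ler_piMl//; case/andP: t01.
- apply: le_trans (normM_le noise_le E2_le) _.
  rewrite [leLHS](_ : _ = 76 * (k * u * W ^+ 7)); last by rewrite -tk; ring.
  by rewrite ler_wpM2l// WX8.
Qed.

Let X2_le : `|X2| <= 210 * (k * u * W ^+ 8).
Proof.
set T := k * u * W ^+ 8.
have T0' : 0 <= T by rewrite !mulr_ge0// exprn_ge0.
rewrite (_ : 210 * T = 64 * T + 32 * T + 114 * T); last by ring.
apply: normD_le; first apply: normD_le.
- apply: le_trans (normM_le noise_le error_re_le) _.
  rewrite [leLHS](_ : _ = 64 * (t * (k * u * W ^+ 7))); last by ring.
  rewrite ler_wpM2l//; apply: le_trans (WX8 (isT : (7 <= 8)%N)).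
  by rewrite ler_piMl// ?mulr_ge0 ?exprn_ge0//; case/andP: t01.
- by apply: le_trans error_im_le _; rewrite ler_wpM2l// WX8.
- apply: le_trans (normM_le num_sub1_le E2_le) _.
  by apply: le_of_eq; rewrite /T -tk; ring.
Qed.

(** The two equations say [den * V = num * U + E * Q]. In the squared modulus of the right-hand side
    the [odd] part of the cross term is kept exactly, to be averaged later; the rest goes to Young's
    inequality with weight [k * E0]. The constant [420 ^+ 2] covers [2 * 210 ^+ 2 + 2 * 38 ^+ 2]. *)
Lemma step_error_le (E0 de q1 q2 u1 u2 v1 v2 : R) : 0 < k -> 0 < E0 <= 1 ->
  0 < de -> q1 ^+ 2 + q2 ^+ 2 = de ->
  D1 * v1 - D2 * v2 = N1 * u1 + s * u2 + E1 * q1 - E2 * q2 ->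
  D1 * v2 + D2 * v1 = N1 * u2 - s * u1 + E1 * q2 + E2 * q1 ->
  (D1 ^+ 2 + D2 ^+ 2) * (v1 ^+ 2 + v2 ^+ 2) <=
  (N1 ^+ 2 + s ^+ 2 + k * E0) * (u1 ^+ 2 + u2 ^+ 2) - 2 * (odd * (u1 * q2 - u2 * q1))
  + de * (420 ^+ 2 / E0 * (k * u ^+ 2 * W ^+ 16)).
Proof.
move=> kp /andP[E00 E01] de0 deE e1 e2.
rewrite (_ : (D1 ^+ 2 + D2 ^+ 2) * _ = (D1 * v1 - D2 * v2) ^+ 2 + (D1 * v2 + D2 * v1) ^+ 2); last by ring.
rewrite e1 e2.
set z1 := u1 * q1 + u2 * q2; set z2 := u1 * q2 - u2 * q1.
rewrite [leLHS](_ : _ = (N1 ^+ 2 + s ^+ 2) * (u1 ^+ 2 + u2 ^+ 2) - 2 * (odd * z2)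
   + (2 * (X1 * z1) - 2 * (X2 * z2)) + (q1 ^+ 2 + q2 ^+ 2) * (E1 ^+ 2 + E2 ^+ 2)); last first.
  by rewrite /X1 /X2 /z1 /z2; ring.
rewrite deE.
have zE : z1 ^+ 2 + z2 ^+ 2 = de * (u1 ^+ 2 + u2 ^+ 2) by rewrite -deE /z1 /z2; ring.
have tau0 : 0 < k * E0 by rewrite mulr_gt0.
have young x z : 2 * (x * z) <= k * E0 * (z ^+ 2 / de) + de * (x ^+ 2 / (k * E0)).
  rewrite -subr_ge0 (_ : _ - _ = (k * E0 * z - de * x) ^+ 2 / (de * (k * E0))); last first.
    by field; rewrite !gt_eqF.
  by rewrite divr_ge0 ?sqr_ge0// mulr_ge0// ltW.
have y1 := young X1 z1; have y2 := young (- X2) z2; rewrite sqrrN in y2.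
have zz : k * E0 * (z1 ^+ 2 / de) + k * E0 * (z2 ^+ 2 / de) = k * E0 * (u1 ^+ 2 + u2 ^+ 2).
  by rewrite -mulrDr -mulrDl zE; field; rewrite gt_eqF.
set T := k * u ^+ 2 * W ^+ 16.
have T0' : 0 <= T by rewrite !mulr_ge0 ?sqr_ge0// exprn_ge0.
have xx : X1 ^+ 2 / (k * E0) + X2 ^+ 2 / (k * E0) <= 2 * 210 ^+ 2 / E0 * T.
  rewrite -mulrDl ler_pdivrMr//.
  rewrite (_ : _ * T * _ = 2 * (210 * (k * u * W ^+ 8)) ^+ 2); last first.
    by rewrite /T; field; rewrite gt_eqF.
  by have := sq_le X1_le; have := sq_le X2_le; lra.
have EE : E1 ^+ 2 + E2 ^+ 2 <= 2 * 38 ^+ 2 * T.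
  have h1 : `|E1| <= 38 * (t * u * W ^+ 6).
    apply: le_trans error_re_le _.
    have h2' : k * u * W ^+ 6 <= t * u * W ^+ 6 by rewrite ler_wpM2r ?exprn_ge0// ler_wpM2r.
    by have := T0; lra.
  have h3 : (38 * (t * u * W ^+ 6)) ^+ 2 <= 38 ^+ 2 * T.
    rewrite [leLHS](_ : _ = 38 ^+ 2 * (k * u ^+ 2 * W ^+ 12)); last by rewrite -tk; ring.
    by rewrite ler_wpM2l// ler_wpM2l ?mulr_ge0 ?sqr_ge0// WX.
  by have := sq_le h1; have := sq_le E2_le; lra.
have EE' : E1 ^+ 2 + E2 ^+ 2 <= 2 * 38 ^+ 2 / E0 * T.
  apply: le_trans EE _; rewrite ler_wpM2r// ler_pdivlMr//; lra.
have fin : X1 ^+ 2 / (k * E0) + X2 ^+ 2 / (k * E0) + (E1 ^+ 2 + E2 ^+ 2) <= 420 ^+ 2 / E0 * T.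
  apply: le_trans (lerD xx EE') _; rewrite -!mulrDl; apply: ler_wpM2r => //.
  by rewrite ler_wpM2r ?invr_ge0 ?(ltW E00)//; lra.
have := ler_wpM2l (ltW de0) fin.
set A1 := X1 ^+ 2 / _ in y1 *; set A2 := X2 ^+ 2 / _ in y2 *.
set B1 := z1 ^+ 2 / de in y1 zz; set B2 := z2 ^+ 2 / de in y2 zz.
set F := 420 ^+ 2 / E0 * T.
rewrite mulNr mulrN in y2.
lra.
Qed.

End local_error.

(** * Mean-square stability *)

Section symbols.
Context {R : realType}.
Implicit Types (h z : R).

(** [i * symD] is the Fourier symbol of [Dx / (2 h)], and [symDD] that of [- Dxx / h^2]. *)
Definition symD h z : R := sin (h * z) / h.
Definition symDD h z : R := (2 - 2 * cos (h * z)) / h ^+ 2.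

Lemma symD_le h z : 0 < h -> `|symD h z| <= `|z|.
Proof.
move=> h0; rewrite /symD normrM normfV (gtr0_norm h0) ler_pdivrMr//.
by apply: le_trans (sin_norm_le _) _; rewrite normrM (gtr0_norm h0) mulrC.
Qed.

Lemma symD_error h z : 0 < h -> `|symD h z - z| <= h ^+ 2 * `|z| ^+ 3.
Proof.
move=> h0; rewrite (_ : symD h z - z = (sin (h * z) - h * z) / h); last first.
  by rewrite /symD; field; rewrite gt_eqF.
rewrite normrM normfV (gtr0_norm h0) ler_pdivrMr//.
apply: le_trans (sinB_cube _) _; rewrite normrM (gtr0_norm h0) exprMn.
have : 0 <= h ^+ 3 * `|z| ^+ 3 by rewrite mulr_ge0// exprn_ge0// ltW.
by rewrite (_ : h ^+ 2 * _ * h = h ^+ 3 * `|z| ^+ 3); [lra|ring].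
Qed.

Lemma symDD_bound h z : 0 < h -> 0 <= symDD h z <= z ^+ 2.
Proof.
move=> h0; have h2 : 0 < h ^+ 2 by rewrite exprn_gt0.
have /andP[c0 c1] := cosB1_bound (h * z); rewrite exprMn in c1.
apply/andP; split.
  by rewrite divr_ge0 ?(ltW h2)//; lra.
by rewrite ler_pdivrMr// [leRHS]mulrC; lra.
Qed.

Lemma symDD_error h z : 0 < h -> `|symDD h z - z ^+ 2| <= h ^+ 2 * z ^+ 4.
Proof.
move=> h0; have h2 : 0 < h ^+ 2 by rewrite exprn_gt0.
rewrite (_ : _ - _ = - (2 * (cos (h * z) - (1 - (h * z) ^+ 2 / 2)) / h ^+ 2)); last first.
  by rewrite /symDD; field; rewrite gt_eqF.
have /andP[c0 c1] := cosB_quart (h * z).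
rewrite normrN ger0_norm; last by rewrite divr_ge0 ?(ltW h2)// mulr_ge0.
rewrite ler_pdivrMr//; rewrite exprMn in c1.
have z4 : 0 <= h ^+ 4 * z ^+ 4 by rewrite -exprMn -[4%N]/(2 * 2)%N exprM sqr_ge0.
rewrite (_ : h ^+ 2 * _ * _ = h ^+ 4 * z ^+ 4); last by ring.
lra.
Qed.

(** [sin^2 <= 2 - 2 cos] because [(1 - cos)^2 >= 0]. This lets the implicit diffusion dominate the
    centred differences carrying the noise. *)
Lemma symD_sqr_le h z : 0 < h -> symD h z ^+ 2 <= symDD h z.
Proof.
move=> h0; have h2 : 0 < h ^+ 2 by rewrite exprn_gt0.
rewrite /symD /symDD exprMn exprVn ler_wpM2r ?invr_ge0 ?(ltW h2)// sin2cos2.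
by have := sqr_ge0 (1 - cos (h * z)); lra.
Qed.

Lemma symDD_ge h z : 0 < h -> `|z| <= pi / h -> z ^+ 2 / 9 <= symDD h z.
Proof.
move=> h0 zh; have h2 : 0 < h ^+ 2 by rewrite exprn_gt0.
have hz : `|h * z| <= pi by rewrite normrM (gtr0_norm h0) mulrC -ler_pdivlMr.
have := versine_ge hz; rewrite exprMn => v.
by rewrite ler_pdivlMr//; lra.
Qed.

End symbols.

(** * Mean square of the amplification factor under the three conditions *)

Section mean_square_stability.
Context {R : realType}.
Variables (rhox rhoy rhoxy nu : R).
Hypotheses (rx : 0 <= rhox <= nu) (ry : 0 <= rhoy <= nu) (nu1 : nu < 1).
Hypotheses
  (cx : 2 * rhox ^+ 2 * (1 + 2 * `|rhoxy|) <= nu)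
  (cy : 2 * rhoy ^+ 2 * (1 + 2 * `|rhoxy|) <= nu)
  (cxy : 2 * rhox * rhoy * (3 * rhoxy ^+ 2 + 2 * `|rhoxy| + 1) <= nu).

Definition noise_var (a b : R) : R :=
  (Num.sqrt rhox * a) ^+ 2 + (Num.sqrt rhoy * b) ^+ 2
  + 2 * rhoxy * ((Num.sqrt rhox * a) * (Num.sqrt rhoy * b)).

(* The mean square of the numerator [1 - i s - s^2/2 + k q/2] of the symbol when
   [s] is centred Gaussian of variance [k v]. *)
Definition num_mean_sqr (k q v : R) : R :=
  1 + k * q + k ^+ 2 / 4 * (q ^+ 2 - 2 * q * v + 3 * v ^+ 2).

(** With [x = rhox a^2], [y = rhoy b^2] and [v = q + 2 r], the quadratic form is
    [2 q^2 + 8 q r + 12 r^2], where [r^2 = rhoxy^2 x y] and [2 r <= |rhoxy| (x + y)]. In the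
    resulting bound the coefficients of [a^4], [b^4] and [2 a^2 b^2] are exactly the left-hand sides
    of [cx], [cy] and [cxy]. *)
Lemma num_mean_sqr_le (k a b A B : R) : 0 <= k -> a ^+ 2 <= A -> b ^+ 2 <= B ->
  num_mean_sqr k (rhox * a ^+ 2 + rhoy * b ^+ 2) (noise_var a b) <=
  1 + nu * (k * (A + B)) + nu * (k * (A + B)) ^+ 2 / 4.
Proof.
move=> k0 aA bB; case/andP: rx => rx0 rxn; case/andP: ry => ry0 ryn.
set q := rhox * a ^+ 2 + rhoy * b ^+ 2; set v := noise_var a b.
have a2 := sqr_ge0 a; have b2 := sqr_ge0 b.
have A0 : 0 <= A by apply: le_trans aA. 
have B0 : 0 <= B by apply: le_trans bB.
have nu0 : 0 <= nu by apply: le_trans rxn.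
have qle : q <= nu * (A + B).
  by rewrite /q mulrDr; apply: lerD; apply: ler_pM.
pose x := rhox * a ^+ 2; pose y := rhoy * b ^+ 2.
have x0 : 0 <= x by rewrite mulr_ge0.
have y0 : 0 <= y by rewrite mulr_ge0.
pose X := Num.sqrt rhox * a; pose Y := Num.sqrt rhoy * b.
have XE : X ^+ 2 = x by rewrite /X exprMn sqr_sqrtr.
have YE : Y ^+ 2 = y by rewrite /Y exprMn sqr_sqrtr.
pose r := rhoxy * (X * Y).
have vE : v = q + 2 * r by rewrite /v /noise_var -/X -/Y XE YE /q -/x -/y /r; ring.
have r2 : r ^+ 2 = rhoxy ^+ 2 * (x * y) by rewrite /r -XE -YE; ring.
have rle : 2 * r <= `|rhoxy| * (x + y).
  apply: le_trans (ler_norm _) _; rewrite /r mulrCA normrM ler_wpM2l//.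
  rewrite normrM (ger0_norm (_ : 0 <= 2 :> R))// normrM -XE -YE.
  rewrite -(real_normK (num_real X)) -(real_normK (num_real Y)).
  by have := sqr_ge0 (`|X| - `|Y|); lra.
have main : q ^+ 2 - 2 * q * v + 3 * v ^+ 2 <= nu * (A + B) ^+ 2.
  rewrite vE (_ : _ + _ = 2 * q ^+ 2 + 4 * (q * (2 * r)) + 12 * r ^+ 2); last by ring.
  have q0 : 0 <= q by rewrite addr_ge0.
  have h1 : q * (2 * r) <= `|rhoxy| * (x + y) ^+ 2.
    apply: le_trans (ler_wpM2l q0 rle) _.
    by rewrite /q -/x -/y; apply: le_of_eq; ring.
  rewrite r2.
  apply: (@le_trans _ _ ((2 + 4 * `|rhoxy|) * (x ^+ 2 + y ^+ 2)
       + (4 + 8 * `|rhoxy| + 12 * rhoxy ^+ 2) * (x * y))).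
    by move: h1; rewrite -[q]/(x + y); lra.
  have n0 := normr_ge0 rhoxy; have s0 := sqr_ge0 rhoxy.
  have sqAB (c C : R) : 0 <= c -> c <= C -> c ^+ 2 <= C ^+ 2.
    by move=> c0 cC; rewrite lerXn2r// nnegrE// (le_trans c0).
  have e1 : (2 + 4 * `|rhoxy|) * x ^+ 2 <= nu * A ^+ 2.
    rewrite (_ : _ * x ^+ 2 = (2 * rhox ^+ 2 * (1 + 2 * `|rhoxy|)) * (a ^+ 2) ^+ 2); last by rewrite /x; ring.
    by apply: ler_pM; rewrite ?sqr_ge0 ?sqAB// !mulr_ge0 ?sqr_ge0//; lra.
  have e2 : (2 + 4 * `|rhoxy|) * y ^+ 2 <= nu * B ^+ 2.
    rewrite (_ : _ * y ^+ 2 = (2 * rhoy ^+ 2 * (1 + 2 * `|rhoxy|)) * (b ^+ 2) ^+ 2); last by rewrite /y; ring.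
    by apply: ler_pM; rewrite ?sqr_ge0 ?sqAB// !mulr_ge0 ?sqr_ge0//; lra.
  have e3 : (4 + 8 * `|rhoxy| + 12 * rhoxy ^+ 2) * (x * y) <= 2 * nu * (A * B).
    rewrite (_ : _ * (x * y) = 2 * ((2 * rhox * rhoy * (3 * rhoxy ^+ 2 + 2 * `|rhoxy| + 1))
       * (a ^+ 2 * b ^+ 2))); last by rewrite /x /y; ring.
    rewrite -[leRHS]mulrA ler_wpM2l//; apply: ler_pM => //.
    - by rewrite !mulr_ge0//; lra.
    - by rewrite mulr_ge0.
    - exact: ler_pM.
  by lra.
have k2 : 0 <= k ^+ 2 / 4 by rewrite divr_ge0// sqr_ge0.
have := ler_wpM2l k2 main; have := ler_wpM2l k0 qle.
by rewrite /num_mean_sqr => h1 h2; lra.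
Qed.

(** Here [z] is the stiffness [k (A + B)] and the denominator is [(1 + z / 2)^2]. The ratio
    multiplying [1 - nu] in [dampE] is at least [4 z / 9] for [z <= 1], its denominator being at
    most [9/4], and at least its value [5/9] at [z = 1] beyond. *)
Let damp (z : R) := (1 + nu * z + nu * z ^+ 2 / 4) / (1 + z + z ^+ 2 / 4).

Let dampE (z : R) : 0 <= z -> damp z = 1 - (1 - nu) * ((z + z ^+ 2 / 4) / (1 + z + z ^+ 2 / 4)).
Proof.
move=> z0; rewrite /damp; field.
by have := sqr_ge0 z => h; rewrite gt_eqF//; lra.
Qed.

Lemma damp_low (z : R) : 0 <= z <= 1 -> damp z <= expR (- (4 / 9 * (1 - nu) * z)).
Proof.
move=> /andP[z0 z1]; rewrite dampE//.
have z2 : z ^+ 2 <= 1 by rewrite expr_le1.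
have z20 := sqr_ge0 z.
have h : 4 / 9 * z <= (z + z ^+ 2 / 4) / (1 + z + z ^+ 2 / 4).
  rewrite ler_pdivlMr; last by lra.
  have : z * z ^+ 2 <= z * 1 by rewrite ler_wpM2l.
  rewrite mulr1 => z3.
  have : z * (1 + z + z ^+ 2 / 4) <= z * (9 / 4) by rewrite ler_wpM2l//; lra.
  by lra.
have nu0 : 0 <= 1 - nu by rewrite subr_ge0 ltW.
have := ler_wpM2l nu0 h.
by have := @expR_ge1Dx R (- (4 / 9 * (1 - nu) * z)); lra.
Qed.

Lemma damp_high (z : R) : 1 <= z -> damp z <= 1 - 5 / 9 * (1 - nu).
Proof.
move=> z1; rewrite dampE; last by lra.
have z2 : 1 <= z ^+ 2 by rewrite expr_ge1//; lra.
have h : 5 / 9 <= (z + z ^+ 2 / 4) / (1 + z + z ^+ 2 / 4).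
  by rewrite ler_pdivlMr; lra.
have nu0 : 0 <= 1 - nu by rewrite subr_ge0 ltW.
by have := ler_wpM2l nu0 h; lra.
Qed.

(** [D2] only enlarges the denominator, so the bound depends on the stiffness alone. As [damp] tends
    to [nu] for large stiffness, a fixed contraction is all that can be extracted there in
    general. *)
Lemma amplification_le (k a b A B D2 : R) : 0 <= k -> a ^+ 2 <= A -> b ^+ 2 <= B ->
  num_mean_sqr k (rhox * a ^+ 2 + rhoy * b ^+ 2) (noise_var a b)
  / ((1 + k / 2 * (A + B)) ^+ 2 + D2 ^+ 2) <=
  (if k * (A + B) <= 1 then expR (- (4 / 9 * (1 - nu) * (k * (A + B))))
   else 1 - 5 / 9 * (1 - nu)).
Proof.
move=> k0 aA bB; have A0 : 0 <= A by apply: le_trans aA; exact: sqr_ge0.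
have B0 : 0 <= B by apply: le_trans bB; exact: sqr_ge0.
set z := k * (A + B); have z0 : 0 <= z by rewrite mulr_ge0// addr_ge0.
have le_damp : num_mean_sqr k (rhox * a ^+ 2 + rhoy * b ^+ 2) (noise_var a b)
  / ((1 + k / 2 * (A + B)) ^+ 2 + D2 ^+ 2) <= damp z.
  have z2 := sqr_ge0 z; have d2 := sqr_ge0 D2.
  have nu0 : 0 <= nu by case/andP: rx => ? ?; lra.
  have nz : 0 <= nu * z by rewrite mulr_ge0.
  have nz2 : 0 <= nu * z ^+ 2 by rewrite mulr_ge0.
  have e : (1 + k / 2 * (A + B)) ^+ 2 = 1 + z + z ^+ 2 / 4 by rewrite /z; field.
  apply: (@le_trans _ _ ((1 + nu * z + nu * z ^+ 2 / 4) / ((1 + k / 2 * (A + B)) ^+ 2 + D2 ^+ 2))).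
    rewrite ler_wpM2r ?invr_ge0 ?addr_ge0 ?sqr_ge0//; exact: num_mean_sqr_le.
  rewrite /damp e ler_wpM2l//; first by lra.
  by rewrite lef_pV2 ?posrE; lra.
apply: le_trans le_damp _; case: ifPn => [z1|]; first by apply: damp_low; rewrite z0.
by rewrite -ltNge => /ltW; exact: damp_high.
Qed.

End mean_square_stability.

(** * One Fourier mode of the scheme *)

Section amplification_factor.
Context {R : realType}.
Variables (mux muy rhox rhoy hx hy k : R).
Implicit Types (z : R * R) (p : R * R).

Definition den_re z : R := 1 + k / 2 * (symDD hx z.1 + symDD hy z.2).
Definition den_im z : R := k * (mux * symD hx z.1 + muy * symD hy z.2).
Definition den_sq z : R := den_re z ^+ 2 + den_im z ^+ 2.
Definition quad (x y : R) : R := rhox * x ^+ 2 + rhoy * y ^+ 2.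
Definition noise (x y dx dy : R) : R := Num.sqrt rhox * x * dx + Num.sqrt rhoy * y * dy.
Definition noise_num z dx dy := noise (symD hx z.1) (symD hy z.2) dx dy.
Definition num_re z dx dy : R :=
  1 - noise_num z dx dy ^+ 2 / 2 + k / 2 * quad (symD hx z.1) (symD hy z.2).
Definition num_mul_re z dx dy p : R := num_re z dx dy * p.1 + noise_num z dx dy * p.2.
Definition num_mul_im z dx dy p : R := num_re z dx dy * p.2 - noise_num z dx dy * p.1.

(* Complex numbers are pairs (real part, imaginary part); the symbol of one step
   is [(num_re - i noise_num) / (den_re + i den_im)]. *)
Definition amp_step z dx dy p : R * R :=
  ((num_mul_re z dx dy p * den_re z + num_mul_im z dx dy p * den_im z) / den_sq z,
   (num_mul_im z dx dy p * den_re z - num_mul_re z dx dy p * den_im z) / den_sq z).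

Fixpoint amp z (dx dy : nat -> R) (n : nat) : R * R :=
  if n is m.+1 then amp_step z (dx m) (dy m) (amp z dx dy m) else (1, 0).

Definition decay z : R := ((1 - rhox) * z.1 ^+ 2 + (1 - rhoy) * z.2 ^+ 2) / 2.
Definition phase z (t mx my : R) : R :=
  (mux * t + Num.sqrt rhox * mx) * z.1 + (muy * t + Num.sqrt rhoy * my) * z.2.
Definition exact_re z t mx my : R := cos (phase z t mx my) * expR (- (t * decay z)).
Definition exact_im z t mx my : R := - sin (phase z t mx my) * expR (- (t * decay z)).

Hypotheses (hx0 : 0 < hx) (hy0 : 0 < hy) (k0 : 0 <= k).

Lemma den_re_ge1 z : 1 <= den_re z.
Proof.
have /andP[a _] := symDD_bound z.1 hx0; have /andP[b _] := symDD_bound z.2 hy0.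
by rewrite lerDl mulr_ge0 ?divr_ge0// addr_ge0.
Qed.

Lemma den_sq_ge1 z : 1 <= den_sq z.
Proof.
rewrite /den_sq -[leLHS]addr0 lerD ?sqr_ge0// -(expr1n _ 2).
by rewrite lerXn2r ?nnegrE ?den_re_ge1// (le_trans ler01)// den_re_ge1.
Qed.

Lemma den_sq_gt0 z : 0 < den_sq z.
Proof. exact: lt_le_trans ltr01 (den_sq_ge1 z). Qed.

Lemma amp_step_re z dx dy p : den_re z * (amp_step z dx dy p).1 - den_im z * (amp_step z dx dy p).2 =
  num_mul_re z dx dy p.
Proof.
have := den_sq_gt0 z; rewrite /amp_step /= => h.
have hn : den_re z ^+ 2 + den_im z ^+ 2 != 0 by rewrite gt_eqF.
by rewrite /den_sq; field.
Qed.

Lemma amp_step_im z dx dy p : den_re z * (amp_step z dx dy p).2 + den_im z * (amp_step z dx dy p).1 =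
  num_mul_im z dx dy p.
Proof.
have := den_sq_gt0 z; rewrite /amp_step /= => h.
have hn : den_re z ^+ 2 + den_im z ^+ 2 != 0 by rewrite gt_eqF.
by rewrite /den_sq; field.
Qed.

Lemma amp_step_sqr z dx dy p : den_sq z * ((amp_step z dx dy p).1 ^+ 2 + (amp_step z dx dy p).2 ^+ 2) =
  (num_re z dx dy ^+ 2 + noise_num z dx dy ^+ 2) * (p.1 ^+ 2 + p.2 ^+ 2).
Proof.
transitivity (num_mul_re z dx dy p ^+ 2 + num_mul_im z dx dy p ^+ 2).
  by rewrite -amp_step_re -amp_step_im /den_sq; ring.
by rewrite /num_mul_re /num_mul_im; ring.
Qed.

Lemma exact_sqr z t mx my :
  exact_re z t mx my ^+ 2 + exact_im z t mx my ^+ 2 = expR (- (2 * t * decay z)).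
Proof.
rewrite /exact_re /exact_im !exprMn sqrrN -mulrDl cos2Dsin2 mul1r -expRM_natl.
by congr expR; ring.
Qed.

End amplification_factor.

(** * Mean-square error at a single frequency *)

Section fourier_mode.
Context {d : measure_display} {Omega : measurableType d} {R : realType}.
Variable P : probability Omega R.
Variable F : R -> set (set Omega).
Variables (Mx My : R -> Omega -> R) (mux muy rhox rhoy rhoxy : R).
Hypotheses (hF : filtration F) (bX : brownian_motion P F Mx) (bY : brownian_motion P F My).
Hypotheses (bXY : bracket_rate P F Mx My rhoxy) (rho1 : -1 <= rhoxy <= 1).
Hypotheses (rx : 0 <= rhox < 1) (ry : 0 <= rhoy < 1).
Variables (hx hy k : R).
Hypotheses (hx0 : 0 < hx) (hy0 : 0 < hy) (k0 : 0 < k <= 1).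
Variable z : R * R.
Let sM := @subsigma_measurable d Omega.

Let kp : 0 < k. Proof. by case/andP: k0. Qed.
Let tt (n : nat) : R := n%:R * k.
Let tt0 n : 0 <= tt n. Proof. by rewrite mulr_ge0// ltW. Qed.
Let ttS n : tt n <= tt n.+1. Proof. by rewrite ler_wpM2r ?ler_nat// ltW. Qed.
Let ttD n : tt n.+1 - tt n = k. Proof. by rewrite /tt -natr1; ring. Qed.
Let sF n : subsigma (F (tt n)). Proof. exact: (hF.1 _ (tt0 n)). Qed.
Let up n X : tame P (F (tt n)) X -> tame P (F (tt n.+1)) X.
Proof. by apply: tame_mono; [exact: sF|exact: hF.2]. Qed.
Let tT n X : tame P (F (tt n)) X -> tame P measurable X.
Proof. by apply: tame_mono; [exact: sF|exact: (sF n).2]. Qed.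

Definition dB (M : R -> Omega -> R) (n : nat) : Omega -> R :=
  fun w => M (n.+1%:R * k) w - M (n%:R * k) w.

Let dX := dB Mx. Let dY := dB My.

Let tdX n : tame P (F (tt n.+1)) (dX n).
Proof. by have [_ _ _ h _] := brownian_gaussian_increments hF bX; exact: h (tt0 n) (ttS n). Qed.
Let tdY n : tame P (F (tt n.+1)) (dY n).
Proof. by have [_ _ _ h _] := brownian_gaussian_increments hF bY; exact: h (tt0 n) (ttS n). Qed.

Let mom_d M n p : brownian_motion P F M ->
  \int[P]_w (dB M n w ^+ p.*2) <= @normal_moment_cst R p * k ^+ p.
Proof.
move=> bM; have [_ _ _ _ h] := brownian_gaussian_increments hF bM.
by have [_ _ /(_ p)] := h _ _ (tt0 n) (ttS n); rewrite ttD.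
Qed.

Let lin a b n w := a * dX n w + b * dY n w.

Let linE a b n w : lin a b n w =
  a * Mx (tt n.+1) w + b * My (tt n.+1) w - (a * Mx (tt n) w + b * My (tt n) w).
Proof. by rewrite /lin /dX /dY /dB /tt; ring. Qed.

Let v a b := a ^+ 2 + b ^+ 2 + 2 * rhoxy * (a * b).

Let lin1 a b n H : tame P (F (tt n)) H -> \int[P]_w (H w * lin a b n w) = 0.
Proof.
move=> tH; have g := brownian_linear_increments hF bX bY bXY rho1 a b.
rewrite -(increment_mean g (tt0 n) (ttS n) tH).
by apply: eq_rint => w _; rewrite linE.
Qed.

Let lin2 a b n H : tame P (F (tt n)) H ->
  \int[P]_w (H w * lin a b n w ^+ 2) = v a b * k * \int[P]_w H w.
Proof.
move=> tH; have g := brownian_linear_increments hF bX bY bXY rho1 a b.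
have := increment_sqr g (tt0 n) (ttS n) tH; rewrite ttD -/(v a b) => <-.
by apply: eq_rint => w _; rewrite linE.
Qed.

Let lin3 a b n H : tame P (F (tt n)) H -> \int[P]_w (H w * lin a b n w ^+ 3) = 0.
Proof.
move=> tH; have g := brownian_linear_increments hF bX bY bXY rho1 a b.
rewrite -(increment_cube g (tt0 n) (ttS n) tH).
by apply: eq_rint => w _; rewrite linE.
Qed.

Let lin4 a b n H : tame P (F (tt n)) H ->
  \int[P]_w (H w * lin a b n w ^+ 4) = 3 * (v a b * k) ^+ 2 * \int[P]_w H w.
Proof.
move=> tH; have g := brownian_linear_increments hF bX bY bXY rho1 a b.
have := increment_quart g (tt0 n) (ttS n) tH; rewrite ttD -/(v a b) => <-.
by apply: eq_rint => w _; rewrite linE.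
Qed.

Let a := symD hx z.1. Let b := symD hy z.2.
Let sx := Num.sqrt rhox. Let sy := Num.sqrt rhoy.
Let s n := lin (sx * a) (sy * b) n.
Let y n := lin (sx * z.1) (sy * z.2) n.
Let q := quad rhox rhoy a b.
Let q' := quad rhox rhoy z.1 z.2.

Definition mode (n : nat) (w : Omega) : R * R :=
  amp mux muy rhox rhoy hx hy k z (fun m => dX m w) (fun m => dY m w) n.
Definition exact_mode_re n w := exact_re mux muy rhox rhoy z (n%:R * k) (Mx (n%:R * k) w) (My (n%:R * k) w).
Definition exact_mode_im n w := exact_im mux muy rhox rhoy z (n%:R * k) (Mx (n%:R * k) w) (My (n%:R * k) w).

Let Q1 := exact_mode_re. Let Q2 := exact_mode_im.
Let N1 n w := 1 - s n w ^+ 2 / 2 + k / 2 * q.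
Let D1 := den_re hx hy k z. Let D2 := den_im mux muy hx hy k z.
Let Dsq := den_sq mux muy hx hy k z.

Let noiseE n w : noise_num rhox rhoy hx hy z (dX n w) (dY n w) = s n w.
Proof. by rewrite /noise_num /noise /s /lin. Qed.

Let num_reE n w : num_re rhox rhoy hx hy k z (dX n w) (dY n w) = N1 n w.
Proof. by rewrite /num_re noiseE. Qed.

Let k0' : 0 <= k. Proof. exact: ltW. Qed.

Let modeS_re n w : D1 * (mode n.+1 w).1 - D2 * (mode n.+1 w).2 =
  N1 n w * (mode n w).1 + s n w * (mode n w).2.
Proof.
rewrite -num_reE -noiseE.
exact: (amp_step_re mux muy rhox rhoy hx0 hy0 k0').
Qed.

Let modeS_im n w : D1 * (mode n.+1 w).2 + D2 * (mode n.+1 w).1 =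
  N1 n w * (mode n w).2 - s n w * (mode n w).1.
Proof.
rewrite -num_reE -noiseE.
exact: (amp_step_im mux muy rhox rhoy hx0 hy0 k0').
Qed.

Lemma tame_mode n : tame P (F (tt n)) (fun w => (mode n w).1) /\
  tame P (F (tt n)) (fun w => (mode n w).2).
Proof.
elim: n => [|n [IH1 IH2]]; first by split; exact: tame_cst.
have u1 := up IH1; have u2 := up IH2; have tx := tdX n; have ty := tdY n.
have sFn := sF n.+1.
split; rewrite /mode /= /amp_step /= /num_mul_re /num_mul_im /num_re /noise_num /noise;
  rewrite -/(mode n _) /=; tame_tac.
Qed.

Let tB M n : brownian_motion P F M -> tame P (F (tt n)) (M (tt n)).
Proof. by move=> bM; exact: (tame_brownian hF bM (tt0 n) (lexx _)). Qed.

Lemma tame_exact_mode n : tame P (F (tt n)) (Q1 n) /\ tame P (F (tt n)) (Q2 n).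
Proof.
have tX := tB n bX; have tY := tB n bY; have sFn := sF n.
by split; rewrite /Q1 /Q2 /exact_mode_re /exact_mode_im /exact_re /exact_im /phase; tame_tac.
Qed.

Let G0 := expR (- (k * decay rhox rhoy z)).
Let w2 := mux * z.1 + muy * z.2.

Let phaseS n w : phase mux muy rhox rhoy z (tt n.+1) (Mx (tt n.+1) w) (My (tt n.+1) w) =
  phase mux muy rhox rhoy z (tt n) (Mx (tt n) w) (My (tt n) w) + (k * w2 + y n w).
Proof. by rewrite /phase /y /lin /dX /dY /dB /w2 /sx /sy /tt -natr1; ring. Qed.

Let expS n : expR (- (tt n.+1 * decay rhox rhoy z)) = expR (- (tt n * decay rhox rhoy z)) * G0.
Proof. by rewrite /G0 -expRD /tt -natr1; congr expR; ring. Qed.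

Let QS_re n w : Q1 n.+1 w = G0 * (cos (k * w2 + y n w) * Q1 n w + sin (k * w2 + y n w) * Q2 n w).
Proof.
rewrite /Q1 /Q2 /exact_mode_re /exact_mode_im /exact_re /exact_im -!/(tt _) phaseS expS cosD.
by ring.
Qed.

Let QS_im n w : Q2 n.+1 w = G0 * (cos (k * w2 + y n w) * Q2 n w - sin (k * w2 + y n w) * Q1 n w).
Proof.
rewrite /Q1 /Q2 /exact_mode_re /exact_mode_im /exact_re /exact_im -!/(tt _) phaseS expS sinD.
by ring.
Qed.

Let dn n := expR (- (2 * tt n * decay rhox rhoy z)).
Let Q_sqr n w : Q1 n w ^+ 2 + Q2 n w ^+ 2 = dn n.
Proof. exact: exact_sqr. Qed.

Let u1 n w := (mode n w).1 - Q1 n w.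
Let u2 n w := (mode n w).2 - Q2 n w.
Let e n := \int[P]_w (u1 n w ^+ 2 + u2 n w ^+ 2).

Let num_mean n H : tame P (F (tt n)) H ->
  \int[P]_w (H w * (N1 n w ^+ 2 + s n w ^+ 2)) =
  num_mean_sqr k q (v (sx * a) (sy * b)) * \int[P]_w H w.
Proof.
move=> tH; have tHT := tT tH; have tX := tT (tdX n); have tY := tT (tdY n).
transitivity ((1 + k / 2 * q) ^+ 2 * \int[P]_w H w
   - k / 2 * q * \int[P]_w (H w * s n w ^+ 2) + 1 / 4 * \int[P]_w (H w * s n w ^+ 4)).
  rewrite -!tEZ; [|rewrite /s /lin; tame_tac..].
  rewrite -tEB; [|rewrite /s /lin; tame_tac..].
  rewrite -tED; [|rewrite /s /lin; tame_tac..].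
  by apply: eq_rint => w _; rewrite /N1; field.
by rewrite lin2// lin4// /num_mean_sqr; field.
Qed.

Let alpha := num_mean_sqr k q (v (sx * a) (sy * b)) / Dsq.
Let Dsq1 : 1 <= Dsq. Proof. exact: den_sq_ge1. Qed.
Let Dsq0 : 0 < Dsq. Proof. exact: lt_le_trans Dsq1. Qed.

(** [mode n] is known at time [n * k], and the squared modulus of the next numerator has constant
    conditional mean, so each step multiplies by exactly [alpha]. *)
Lemma mode_mean_sqr n : \int[P]_w ((mode n w).1 ^+ 2 + (mode n w).2 ^+ 2) = alpha ^+ n.
Proof.
elim: n => [|n IH].
  rewrite expr0 -[RHS](tE_cst P); apply: eq_rint => w _ /=.
  by rewrite expr1n expr0n addr0.
have [t1 t2] := tame_mode n; have [t3 t4] := tame_mode n.+1.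
have t3' := tT t3; have t4' := tT t4; have sFn := sF n.
apply: (mulfI (lt0r_neq0 Dsq0)); rewrite -tEZ; last by tame_tac.
have tH : tame P (F (tt n)) (fun w => (mode n w).1 ^+ 2 + (mode n w).2 ^+ 2) by tame_tac.
rewrite exprS mulrA [Dsq * alpha]mulrC divfK ?gt_eqF// -IH -(num_mean tH).
apply: eq_rint => w _; rewrite -num_reE -noiseE [RHS]mulrC.
exact: (amp_step_sqr mux muy rhox rhoy hx0 hy0 k0').
Qed.

(** One number dominating [1], both frequencies, the drift coefficients and the drift symbol, so
    that the local error is bounded by a power of it. *)
Definition mode_size : R := (1 + `|mux| + `|muy|) * (1 + `|z.1| + `|z.2|).
Let M := mode_size.
Let h2 := hx ^+ 2 + hy ^+ 2.
Let uu := k + h2.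
Let t := Num.sqrt k.
Let t0 : 0 < t. Proof. by rewrite sqrtr_gt0. Qed.
Let tk : t ^+ 2 = k. Proof. by rewrite sqr_sqrtr. Qed.
Let t01 : 0 <= t <= 1.
Proof. by rewrite (ltW t0)/= -sqrtr1 ler_wsqrtr//; case/andP: k0. Qed.

(** Increments in units of [sqrt k]: the moments are then bounded uniformly in [k]. *)
Let Z n w := 1 + (`|dX n w| + `|dY n w|) / t.

Let M1 : 1 <= M.
Proof.
have a1 := normr_ge0 mux; have a2 := normr_ge0 muy; have a3 := normr_ge0 z.1; have a4 := normr_ge0 z.2.
by rewrite -[leLHS]mulr1; apply: ler_pM => //; lra.
Qed.

Let Mz1 : `|z.1| <= M.
Proof.
have a1 := normr_ge0 mux; have a2 := normr_ge0 muy; have a3 := normr_ge0 z.1; have a4 := normr_ge0 z.2.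
by rewrite -[leLHS]mul1r; apply: ler_pM => //; lra.
Qed.

Let Mz2 : `|z.2| <= M.
Proof.
have a1 := normr_ge0 mux; have a2 := normr_ge0 muy; have a3 := normr_ge0 z.1; have a4 := normr_ge0 z.2.
by rewrite -[leLHS]mul1r; apply: ler_pM => //; lra.
Qed.

Let Mmu : `|mux| + `|muy| <= M.
Proof.
have a1 := normr_ge0 mux; have a2 := normr_ge0 muy; have a3 := normr_ge0 z.1; have a4 := normr_ge0 z.2.
by rewrite -[leLHS]mulr1; apply: ler_pM => //; lra.
Qed.

Let Mdrift (x1 x2 : R) : `|x1| <= `|z.1| -> `|x2| <= `|z.2| -> `|mux * x1 + muy * x2| <= M.
Proof.
move=> x1z x2z; apply: le_trans (ler_normD _ _) _; rewrite !normrM.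
have a1 := normr_ge0 mux; have a2 := normr_ge0 muy; have a3 := normr_ge0 z.1; have a4 := normr_ge0 z.2.
have h1 := ler_wpM2l a1 x1z; have h2' := ler_wpM2l a2 x2z.
have m1 := mulr_ge0 a1 a3; have m2 := mulr_ge0 a1 a4; have m3 := mulr_ge0 a2 a3; have m4 := mulr_ge0 a2 a4.
by rewrite /M /mode_size; lra.
Qed.

Let hh2 : hx ^+ 2 <= h2. Proof. by rewrite lerDl sqr_ge0. Qed.
Let hh2' : hy ^+ 2 <= h2. Proof. by rewrite lerDr sqr_ge0. Qed.
Let h20 : 0 <= h2. Proof. by rewrite addr_ge0 ?sqr_ge0. Qed.

Let aE : `|a - z.1| <= h2 * M ^+ 3.
Proof.
apply: le_trans (symD_error z.1 hx0) _; apply: ler_pM => //; first exact: sqr_ge0.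
by rewrite lerXn2r// nnegrE (le_trans ler01).
Qed.
Let bE : `|b - z.2| <= h2 * M ^+ 3.
Proof.
apply: le_trans (symD_error z.2 hy0) _; apply: ler_pM => //; first exact: sqr_ge0.
by rewrite lerXn2r// nnegrE (le_trans ler01).
Qed.

Let pow4 (x : R) : `|x| <= M -> 0 <= x ^+ 4 <= M ^+ 4.
Proof.
move=> xM; have e4 : x ^+ 4 = `|x| ^+ 4.
  by rewrite -[4%N]/(2 * 2)%N !exprM real_normK// num_real.
by rewrite e4 exprn_ge0//= lerXn2r// nnegrE (le_trans ler01).
Qed.

Let AE : `|symDD hx z.1 - z.1 ^+ 2| <= h2 * M ^+ 4.
Proof.
have /andP[p0 p1] := pow4 Mz1.
by apply: le_trans (symDD_error z.1 hx0) _; apply: ler_pM => //; exact: sqr_ge0.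
Qed.
Let BE : `|symDD hy z.2 - z.2 ^+ 2| <= h2 * M ^+ 4.
Proof.
have /andP[p0 p1] := pow4 Mz2.
by apply: le_trans (symDD_error z.2 hy0) _; apply: ler_pM => //; exact: sqr_ge0.
Qed.

Let Z1 n w : 1 <= Z n w.
Proof. by rewrite lerDl divr_ge0 ?addr_ge0// ltW. Qed.

Let dXZ n w : `|dX n w| <= t * Z n w.
Proof.
rewrite mulrDr mulr1 mulrCA mulfV ?gt_eqF// mulr1.
by have := normr_ge0 (dY n w); have := ltW t0; lra.
Qed.
Let dYZ n w : `|dY n w| <= t * Z n w.
Proof.
rewrite mulrDr mulr1 mulrCA mulfV ?gt_eqF// mulr1.
by have := normr_ge0 (dX n w); have := ltW t0; lra.
Qed.

Let rx' : 0 <= rhox <= 1. Proof. by case/andP: rx => -> /ltW ->. Qed.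
Let ry' : 0 <= rhoy <= 1. Proof. by case/andP: ry => -> /ltW ->. Qed.

Let odd n w := y n w - s n w - y n w ^+ 3 / 6 + k / 2 * q' * y n w.
Let z2 n w := u1 n w * Q2 n w - u2 n w * Q1 n w.

Let pointwise E0 n w : 0 < E0 <= 1 ->
  Dsq * (u1 n.+1 w ^+ 2 + u2 n.+1 w ^+ 2) <=
  (N1 n w ^+ 2 + s n w ^+ 2 + k * E0) * (u1 n w ^+ 2 + u2 n w ^+ 2) - 2 * (odd n w * z2 n w)
  + dn n * (420 ^+ 2 / E0 * (k * uu ^+ 2 * (M * Z n w) ^+ 16)).
Proof.
move=> E01.
have dn0 : 0 < dn n := expR_gt0 _.
apply: (step_error_le rx' ry' tk t01 h20 M1 (Z1 n w) Mz1 Mz2 Mmu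
  (Mdrift (lexx _) (lexx _)) (Mdrift (symD_le z.1 hx0) (symD_le z.2 hy0))
  (symD_le z.1 hx0) (symD_le z.2 hy0) aE bE (symDD_bound z.1 hx0) (symDD_bound z.2 hy0)
  AE BE (dXZ n w) (dYZ n w) kp E01 dn0 (Q_sqr n w)).
- rewrite /u1 /u2.
  rewrite (_ : _ * (_ - _) - _ = (D1 * (mode n.+1 w).1 - D2 * (mode n.+1 w).2)
     - (D1 * Q1 n.+1 w - D2 * Q2 n.+1 w)); last by rewrite -/D1 -/D2 /D1 /D2 /den_re /den_im; ring.
  rewrite modeS_re QS_re QS_im (cosD (k * w2) (y n w)) (sinD (k * w2) (y n w)).
  rewrite /N1 /s /y /lin /D1 /D2 /den_re /den_im /G0 /w2 /q /quad /decay -/a -/b -/sx -/sy.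
  by ring.
- rewrite /u1 /u2.
  rewrite (_ : _ * (_ - _) + _ = (D1 * (mode n.+1 w).2 + D2 * (mode n.+1 w).1)
     - (D1 * Q2 n.+1 w + D2 * Q1 n.+1 w)); last by rewrite -/D1 -/D2 /D1 /D2 /den_re /den_im; ring.
  rewrite modeS_im QS_re QS_im (cosD (k * w2) (y n w)) (sinD (k * w2) (y n w)).
  rewrite /N1 /s /y /lin /D1 /D2 /den_re /den_im /G0 /w2 /q /quad /decay -/a -/b -/sx -/sy.
  by ring.
Qed.

(** A bound for the moment of order 16 of [Z]; each factor [2 ^+ 16] is one application of
    [exprD_le]. *)
Definition increment_moment_cst : R := 2 ^+ 16 * (1 + 2 ^+ 16 * (2 * @normal_moment_cst R 8)).
Let CZ := increment_moment_cst.

Let Z_moment n : \int[P]_w (Z n w ^+ 16) <= CZ.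
Proof.
have tx := tT (tdX n); have ty := tT (tdY n).
have t16 : t ^+ 16 = k ^+ 8 by rewrite -[16%N]/(2 * 8)%N exprM tk.
have k8 : 0 < k ^+ 8 by rewrite exprn_gt0.
apply: (@le_trans _ _ (2 ^+ 16 * (1 + 2 ^+ 16 / k ^+ 8 *
    (\int[P]_w (dX n w ^+ 8.*2) + \int[P]_w (dY n w ^+ 8.*2))))).
  apply: (@le_trans _ _ (\int[P]_w (2 ^+ 16 *
      (1 + 2 ^+ 16 / k ^+ 8 * (dX n w ^+ 8.*2 + dY n w ^+ 8.*2))))); last first.
    apply: le_of_eq; rewrite tEZ; [|tame_tac]; congr (_ * _).
    rewrite tED; [|tame_tac..]; rewrite tE_cst; congr (_ + _).
    by rewrite tEZ; [|tame_tac]; rewrite tED; [|tame_tac..].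
  apply: tE_le; [rewrite /Z; tame_tac|tame_tac|move=> w].
  apply: le_trans (exprD_le _ (ler01) (divr_ge0 (addr_ge0 (normr_ge0 _) (normr_ge0 _)) (ltW t0))) _.
  rewrite expr1n ler_wpM2l ?exprn_ge0// lerD2l exprMn exprVn t16 [leRHS]mulrAC ler_pM2r ?invr_gt0//.
  have ev (x : R) : x ^+ 8.*2 = `|x| ^+ 16.
    by rewrite -[8.*2]/(2 * 8)%N -[16%N]/(2 * 8)%N !exprM real_normK// num_real.
  by rewrite (ev (dX n w)) (ev (dY n w)); exact: exprD_le.
rewrite /CZ /increment_moment_cst ler_wpM2l ?exprn_ge0// lerD2l -mulrA ler_wpM2l ?exprn_ge0//.
rewrite ler_pdivrMl//.
have hX := mom_d n 8 bX; have hY := mom_d n 8 bY.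
by apply: le_trans (lerD hX hY) _; apply: le_of_eq; ring.
Qed.

Let t_u n : [/\ tame P (F (tt n)) (u1 n), tame P (F (tt n)) (u2 n) & tame P (F (tt n)) (z2 n)].
Proof.
have [t1 t2] := tame_mode n; have [t3 t4] := tame_exact_mode n; have sFn := sF n.
have tu1 : tame P (F (tt n)) (u1 n) by rewrite /u1; tame_tac.
have tu2 : tame P (F (tt n)) (u2 n) by rewrite /u2; tame_tac.
by split => //; rewrite /z2; tame_tac.
Qed.

(* The leading term [odd] of the local error is odd in the increments, so it does
   not contribute to the mean square: this is what gives order one in time. *)
Let odd_mean n : \int[P]_w (odd n w * z2 n w) = 0.
Proof.
have [t1 t2 t3] := t_u n; have t3' := tT t3; have tx := tT (tdX n); have ty := tT (tdY n).
have -> : \int[P]_w (odd n w * z2 n w) =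
    (1 + k / 2 * q') * \int[P]_w (z2 n w * y n w) - \int[P]_w (z2 n w * s n w)
    - 6^-1 * \int[P]_w (z2 n w * y n w ^+ 3).
  rewrite -!tEZ; [|rewrite /y /lin; tame_tac..].
  rewrite -tEB; [|rewrite /y /s /lin; tame_tac..].
  rewrite -tEB; [|rewrite /y /s /lin; tame_tac..].
  by apply: eq_rint => w _; rewrite /odd; ring.
by rewrite lin1// lin1// lin3//; ring.
Qed.

Let cst0 : 0 <= 420 ^+ 2 :> R. Proof. exact: sqr_ge0. Qed.
Let M16 : 0 <= M ^+ 16. Proof. by rewrite exprn_ge0// (le_trans ler01). Qed.

Let gam E0 := 420 ^+ 2 / E0 * (k * uu ^+ 2 * (M ^+ 16 * CZ)).

Let uu0 : 0 <= uu. Proof. by rewrite addr_ge0. Qed.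

Let e_ge0 n : 0 <= e n.
Proof. by apply: tE_ge0 => w; rewrite addr_ge0 ?sqr_ge0. Qed.

Let CZ0 : 0 <= CZ.
Proof.
have := Z_moment 0; apply: le_trans; apply: tE_ge0 => w.
by rewrite exprn_ge0// (le_trans ler01).
Qed.

(** The integrated form of [pointwise]: the squared numerator is replaced by its constant
    conditional mean, [odd] averages out, and the other terms may be divided by [Dsq >= 1]. *)
Let e_rec E0 n : 0 < E0 <= 1 -> e n.+1 <= (alpha + k * E0) * e n + dn n * gam E0.
Proof.
move=> E01; have [t1 t2 t3] := t_u n; have [t1' t2' _] := t_u n.+1.
have tx := tT (tdX n); have ty := tT (tdY n).
have t1T := tT t1; have t2T := tT t2; have t1T' := tT t1'; have t2T' := tT t2'.
have t3T := tT t3; have sFn := sF n.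
have ts : tame P measurable (s n) by rewrite /s /lin; tame_tac.
have ty' : tame P measurable (y n) by rewrite /y /lin; tame_tac.
have tN : tame P measurable (N1 n) by rewrite /N1; tame_tac.
have todd : tame P measurable (odd n) by rewrite /odd; tame_tac.
have tZ : tame P measurable (Z n) by rewrite /Z; tame_tac.
have E0p : 0 < E0 by case/andP: E01.
pose c := dn n * (420 ^+ 2 / E0 * (k * uu ^+ 2 * M ^+ 16)).
have c0 : 0 <= c.
  apply: mulr_ge0; first exact: expR_ge0.
  apply: mulr_ge0; first exact: divr_ge0 cst0 (ltW E0p).
  apply: mulr_ge0 M16; apply: mulr_ge0; [exact: k0'|exact: sqr_ge0].
have tU : tame P (F (tt n)) (fun w => u1 n w ^+ 2 + u2 n w ^+ 2) by tame_tac.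
have tUT := tT tU.
have step : Dsq * e n.+1 <= num_mean_sqr k q (v (sx * a) (sy * b)) * e n + k * E0 * e n
    - 2 * \int[P]_w (odd n w * z2 n w) + c * \int[P]_w (Z n w ^+ 16).
  rewrite -(num_mean tU) /e -!tEZ; [|tame_tac..].
  rewrite -tED; [|tame_tac..].
  rewrite -tEB; [|tame_tac..].
  rewrite -tED; [|tame_tac..].
  apply: tE_le; [tame_tac..|move=> w].
  apply: le_trans (pointwise n w E01) _; apply: le_of_eq.
  by rewrite /c exprMn; ring.
rewrite odd_mean mulr0 subr0 in step.
have cZ : c * \int[P]_w (Z n w ^+ 16) <= dn n * gam E0.
  apply: le_trans (ler_wpM2l c0 (Z_moment n)) _.
  by apply: le_of_eq; rewrite /c /gam; ring.
have kE : 0 <= k * E0 * e n by rewrite !mulr_ge0// ltW.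
have g0 : 0 <= dn n * gam E0 by apply: le_trans cZ; rewrite mulr_ge0// tE_ge0// => w; rewrite exprn_ge0// (le_trans ler01).
rewrite -(ler_pM2l Dsq0); apply: le_trans step _.
rewrite [leRHS](_ : _ = num_mean_sqr k q (v (sx * a) (sy * b)) * e n + Dsq * (k * E0 * e n) + Dsq * (dn n * gam E0)); last first.
  by rewrite /alpha; field; rewrite gt_eqF.
have := ler_wpM2r kE Dsq1; have := ler_wpM2r g0 Dsq1; rewrite !mul1r.
by lra.
Qed.

Let e0 : e 0 = 0.
Proof.
have [_ X0 _ _ _] := bX; have [_ Y0 _ _ _] := bY.
have [t1 t2 _] := t_u 0; have t1' := tT t1; have t2' := tT t2.
rewrite /e /Rintegral (_ : integral _ _ _ = 0%E)//.
rewrite -(integral0 P setT).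
have tU : tame P measurable (fun w => u1 0 w ^+ 2 + u2 0 w ^+ 2) by tame_tac.
apply: ge0_ae_eq_integral => //.
- by apply/measurable_EFinP; exact: (tame_measurable sM tU).
- by move=> w _; rewrite lee_fin addr_ge0 ?sqr_ge0.
apply: filterS2 X0 Y0 => w Mx0 My0 _.
rewrite /u1 /u2 /Q1 /Q2 /exact_mode_re /exact_mode_im /exact_re /exact_im /phase /= !mul0r Mx0 My0.
by rewrite !mulr0 !addr0 !mul0r addr0 oppr0 expR0 cos0 sin0 mulr1 oppr0 mul0r !subrr expr0n/= addr0.
Qed.

(** [alpha + k E0 <= E0 (1 + k)], and the source at step [n] is at most [E0 ^+ n * gam E0].
    Propagation and source have the same rate; this resonance costs a factor [n], which meets the
    [k] inside [gam E0] and turns into the final time. *)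
Let mode_error_low E0 n : 0 < E0 <= 1 -> 0 <= alpha <= E0 -> expR (- (2 * k * decay rhox rhoy z)) <= E0 ->
  e n <= n%:R * (gam E0 / E0) * (E0 ^+ n * (1 + k) ^+ n).
Proof.
move=> E01 /andP[al0 alE] dE; have /andP[E0p E1] := E01.
have gam0 : 0 <= gam E0.
  by rewrite mulr_ge0 ?(divr_ge0 cst0 (ltW E0p))// mulr_ge0 ?(mulr_ge0 M16 CZ0)// mulr_ge0 ?sqr_ge0.
have dnE m : dn m <= E0 ^+ m.
  rewrite /dn (_ : - _ = m%:R * (- (2 * k * decay rhox rhoy z))); last by rewrite /tt; ring.
  by rewrite expRM_natl lerXn2r// nnegrE ?expR_ge0// ltW.
have k1 : 1 <= 1 + k by rewrite lerDl.
elim: n => [|n IH]; first by rewrite e0 !mul0r.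
apply: le_trans (e_rec n E01) _.
set g := gam E0 / E0 in IH *.
have gE : gam E0 = g * E0 by rewrite /g divfK// gt_eqF.
have g0 : 0 <= g by rewrite divr_ge0// ltW.
have h1 : (alpha + k * E0) * e n <= (E0 * (1 + k)) * (n%:R * g * (E0 ^+ n * (1 + k) ^+ n)).
  apply: ler_pM => //; first by rewrite addr_ge0// mulr_ge0// ltW.
  by rewrite mulrDr mulr1 [E0 * k]mulrC lerD2r.
have h2' : dn n * gam E0 <= g * (E0 ^+ n.+1 * (1 + k) ^+ n.+1).
  apply: (@le_trans _ _ (E0 ^+ n * gam E0)); first by rewrite ler_wpM2r.
  rewrite gE [leLHS](_ : _ = g * (E0 ^+ n.+1 * 1)); last by rewrite exprS; ring.
  by rewrite ler_wpM2l// ler_wpM2l ?exprn_ge0 ?(ltW E0p)// exprn_ege1.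
apply: le_trans (lerD h1 h2') _; apply: le_of_eq.
by rewrite -natr1 !exprS; ring.
Qed.

Variable nu : R.
Hypotheses (rxn : rhox <= nu) (ryn : rhoy <= nu) (nu1 : nu < 1).
Hypotheses
  (cx : 2 * rhox ^+ 2 * (1 + 2 * `|rhoxy|) <= nu)
  (cy : 2 * rhoy ^+ 2 * (1 + 2 * `|rhoxy|) <= nu)
  (cxy : 2 * rhox * rhoy * (3 * rhoxy ^+ 2 + 2 * `|rhoxy| + 1) <= nu).

(* [4 / 81] comes from the rate [4 / 9] of [amplification_le] and the bound
   [r <= 9 * (symDD hx z.1 + symDD hy z.2)] on the box; [5 / 18] is half of the
   [5 / 9] of [amplification_le], which bounds the squared factor. *)
Definition mode_rate : R := 4 / 81 * (1 - nu).
Definition mode_theta : R := 1 - 5 / 18 * (1 - nu).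
(** [exp (18 mode_rate)] pays for two divisions by [E0 >= exp (- 9 mode_rate)], and [T exp T] for
    [N k (1 + k)^N]. The final [2] belongs to the stiff frequencies. *)
Definition mode_cst (T : R) : R :=
  420 ^+ 2 * expR (18 * mode_rate) * increment_moment_cst * (T * expR T) + 2.

Let r := z.1 ^+ 2 + z.2 ^+ 2.

Let r0 : 0 <= r. Proof. by rewrite addr_ge0 ?sqr_ge0. Qed.

Let c1 := mode_rate.
Let c10 : 0 <= c1. Proof. by rewrite mulr_ge0 ?divr_ge0// subr_ge0 ltW. Qed.

Let decay_ge : c1 * r <= 2 * decay rhox rhoy z.
Proof.
rewrite /decay /r /c1 /mode_rate.
have s1 := sqr_ge0 z.1; have s2 := sqr_ge0 z.2.
have g1 : (1 - nu) * z.1 ^+ 2 <= (1 - rhox) * z.1 ^+ 2 by rewrite ler_wpM2r// lerB.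
have g2 : (1 - nu) * z.2 ^+ 2 <= (1 - rhoy) * z.2 ^+ 2 by rewrite ler_wpM2r// lerB.
have n0 : 0 <= 1 - nu by rewrite subr_ge0 ltW.
have m1 := mulr_ge0 n0 s1; have m2 := mulr_ge0 n0 s2.
by lra.
Qed.

Lemma exact_mode_decay n w :
  exact_mode_re n w ^+ 2 + exact_mode_im n w ^+ 2 <= expR (- (c1 * (n%:R * k) * r)).
Proof.
rewrite Q_sqr /dn ler_expR lerN2 [leRHS]mulrAC [leLHS]mulrAC.
exact: (ler_wpM2r (tt0 n) decay_ge).
Qed.

Let alpha_ge0 : 0 <= alpha.
Proof.
have := mode_mean_sqr 1; rewrite expr1 => <-.
by apply: tE_ge0 => w; rewrite addr_ge0 ?sqr_ge0.
Qed.

Let rM : r <= M ^+ 2.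
Proof.
have a1 := normr_ge0 mux; have a2 := normr_ge0 muy; have a3 := normr_ge0 z.1; have a4 := normr_ge0 z.2.
have h : `|z.1| + `|z.2| <= M.
  by rewrite -[leLHS]mul1r; apply: ler_pM => //; lra.
rewrite /r -(real_normK (num_real z.1)) -(real_normK (num_real z.2)).
apply: (@le_trans _ _ ((`|z.1| + `|z.2|) ^+ 2)).
  by have := mulr_ge0 a3 a4; lra.
by rewrite lerXn2r// nnegrE ?addr_ge0// (le_trans ler01).
Qed.

Lemma mode_error (N : nat) : (0 < N)%N -> `|z.1| <= pi / hx -> `|z.2| <= pi / hy ->
  \int[P]_w (((mode N w).1 - exact_mode_re N w) ^+ 2 + ((mode N w).2 - exact_mode_im N w) ^+ 2) <=
  4 * mode_theta ^+ N.*2 + mode_cst (N%:R * k) *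
    ((k + (hx ^+ 2 + hy ^+ 2)) ^+ 2 * mode_size ^+ 16 *
     expR (- (mode_rate * (N%:R * k) * (z.1 ^+ 2 + z.2 ^+ 2)))).
Proof.
move=> N0 z1h z2h; rewrite -/uu -/M -/c1 -/r -[X in X <= _]/(e N).
have nu0 : 0 <= nu by apply: le_trans rxn; case/andP: rx.
have rxn' : 0 <= rhox <= nu by rewrite rxn andbT; case/andP: rx.
have ryn' : 0 <= rhoy <= nu by rewrite ryn andbT; case/andP: ry.
set AB := symDD hx z.1 + symDD hy z.2.
have ABr : r <= 9 * AB.
  by have := symDD_ge hx0 z1h; have := symDD_ge hy0 z2h; rewrite /AB /r; lra.
have ABle : AB <= r.
  by have /andP[_ ?] := symDD_bound z.1 hx0; have /andP[_ ?] := symDD_bound z.2 hy0; rewrite lerD.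
have al := amplification_le rxn' ryn' nu1 cx cy cxy D2 k0' (symD_sqr_le z.1 hx0) (symD_sqr_le z.2 hy0).
rewrite -[X in X <= _]/alpha -/AB in al.
set T := N%:R * k.
have T0 : 0 <= T by rewrite mulr_ge0.
set X := uu ^+ 2 * M ^+ 16 * expR (- (c1 * T * r)).
have M0 : 0 <= M by rewrite (le_trans ler01).
have X0 : 0 <= X by apply: mulr_ge0 (expR_ge0 _); apply: mulr_ge0 (sqr_ge0 _) M16.
have th0 : 0 <= mode_theta.
  by rewrite /mode_theta; lra.
have th2 : 0 <= 4 * mode_theta ^+ N.*2 by rewrite mulr_ge0// exprn_ge0.
have K0 : 0 <= 420 ^+ 2 * expR (18 * c1) * CZ * (T * expR T).
  apply: mulr_ge0; last exact: mulr_ge0 T0 (expR_ge0 _).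
  by apply: mulr_ge0 CZ0; apply: mulr_ge0 cst0 (expR_ge0 _).
rewrite /mode_cst -/c1 -/CZ.
set K := 420 ^+ 2 * expR (18 * c1) * CZ * (T * expR T) in K0 *.
have KX := mulr_ge0 K0 X0.
rewrite [(K + 2) * X]mulrDl.
have [zl|zh] := leP (k * AB) 1.
- rewrite zl in al.
  set E0 := expR (- (c1 * (k * r))).
  have E01 : 0 < E0 <= 1.
    by rewrite expR_gt0/= -expR0 ler_expR oppr_le0 mulr_ge0// mulr_ge0.
  have /andP[E0p _] := E01.
  have alE : 0 <= alpha <= E0.
    rewrite alpha_ge0/=; apply: le_trans al _; rewrite ler_expR lerN2 /c1 /mode_rate.
    have n0 : 0 <= 1 - nu by rewrite subr_ge0 ltW.
    have kABr : k * r <= 9 * (k * AB) by rewrite mulrCA ler_wpM2l.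
    have := ler_wpM2l n0 kABr; lra.
  have dE : expR (- (2 * k * decay rhox rhoy z)) <= E0.
    rewrite ler_expR lerN2 [leLHS]mulrCA [leRHS](_ : _ = k * (2 * decay rhox rhoy z)).
      exact: (ler_wpM2l k0' decay_ge).
    by rewrite [2 * k]mulrC -mulrA.
  have := mode_error_low N E01 alE dE => h; apply: le_trans h _.
  have E0N : E0 ^+ N = expR (- (c1 * T * r)) by rewrite -expRM_natl /T; congr expR; ring.
  have kN : (1 + k) ^+ N <= expR T.
    by rewrite /T expRM_natl lerXn2r ?nnegrE ?addr_ge0 ?expR_ge0// expR_ge1Dx.
  (* On the box [r <= 9 * AB], so stiffness at most [1] gives [k * r <= 9] and keeps [E0] away from
     zero. *)
  have E0i : E0^-1 <= expR (9 * c1).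
    rewrite -expRN opprK ler_expR mulrC ler_wpM2r//.
    apply: (@le_trans _ _ (9 * (k * AB))); first by rewrite mulrCA ler_wpM2l.
    by rewrite -[leRHS]mulr1 ler_wpM2l.
  have E0ii : E0^-1 * E0^-1 <= expR (18 * c1).
    rewrite (_ : 18 * c1 = 9 * c1 + 9 * c1); last by ring.
    by rewrite expRD; apply: ler_pM => //; rewrite invr_ge0 ltW.
  rewrite [leLHS](_ : _ = (420 ^+ 2 * (E0^-1 * E0^-1) * CZ * (T * (1 + k) ^+ N)) * X); last first.
    by rewrite /X -E0N /gam /T; ring.
  apply: (@le_trans _ _ (K * X)); last by lra.
  apply: ler_wpM2r X0 _ _ _; apply: ler_pM.
  - apply: mulr_ge0 CZ0; apply: mulr_ge0 cst0 _.
    by apply: mulr_ge0; rewrite invr_ge0 ltW.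
  - by apply: mulr_ge0 T0 _; rewrite exprn_ge0// addr_ge0.
  - exact: (ler_wpM2r CZ0 (ler_wpM2l cst0 E0ii)).
  - exact: ler_wpM2l.
- rewrite [k * AB <= 1]leNgt zh /= in al.
  have aN : alpha ^+ N <= mode_theta ^+ N.*2.
    rewrite -muln2 mulnC exprM lerXn2r ?nnegrE ?sqr_ge0//.
    apply: le_trans al _; rewrite /mode_theta.
    have : 0 <= (5 / 18 * (1 - nu)) ^+ 2 by exact: sqr_ge0.
    by lra.
  (* At a stiff frequency the factor [(k * r) ^+ 2], at most [uu ^+ 2 * M ^+ 16], may be inserted
     for free: the exact mode itself is already within the squared error allowed. *)
  have kr : 1 <= k * r by apply: le_trans (ltW zh) _; rewrite ler_wpM2l.
  have dnX : dn N <= X.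
    apply: (@le_trans _ _ (1 * expR (- (c1 * T * r)))).
      rewrite mul1r /dn ler_expR lerN2 -/T [leRHS]mulrAC [leLHS]mulrAC.
      exact: (ler_wpM2r T0 decay_ge).
    rewrite ler_wpM2r ?expR_ge0//.
    apply: (@le_trans _ _ ((k * r) ^+ 2)).
      by rewrite -(expr1n _ 2) lerXn2r ?nnegrE// (le_trans ler01).
    rewrite exprMn; apply: ler_pM; [exact: sqr_ge0|exact: sqr_ge0| |].
      by rewrite lerXn2r ?nnegrE// lerDl.
    apply: (@le_trans _ _ ((M ^+ 2) ^+ 2)).
      by rewrite lerXn2r ?nnegrE ?exprn_ge0.
    by rewrite -exprM ler_weXn2l.
  have [t1 t2] := tame_mode N; have [t3 t4] := tame_exact_mode N.
  have t1' := tT t1; have t2' := tT t2; have t3' := tT t3; have t4' := tT t4.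
  have [tu1 tu2 _] := t_u N; have tu1' := tT tu1; have tu2' := tT tu2.
  apply: (@le_trans _ _ (2 * alpha ^+ N + 2 * dn N)).
    apply: (@le_trans _ _ (\int[P]_w (2 * ((mode N w).1 ^+ 2 + (mode N w).2 ^+ 2) + 2 * dn N))); last first.
      by apply: le_of_eq; rewrite tED; [rewrite tEZ; [rewrite tE_cst mode_mean_sqr|tame_tac]|tame_tac..].
    apply: tE_le; [tame_tac..|move=> w].
    rewrite -(Q_sqr N w) /u1 /u2.
    have := sqr_ge0 ((mode N w).1 + Q1 N w); have := sqr_ge0 ((mode N w).2 + Q2 N w); lra.
  have : 0 <= mode_theta ^+ N.*2 by rewrite exprn_ge0.
  by move=> ?; lra.
Qed.

End fourier_mode.

(** * Uniqueness of the implicit step and grid modes *)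

Section schemes_on_the_grid.
Context {R : realType}.
Variables (mux muy rhox rhoy hx hy k : R).
Implicit Types (V W : grid R) (p : R * R).

(** Uniqueness is argued among bounded grids, which contain both the given [ell2] solution and the
    Fourier integral; square summability of the latter need not be established. *)
Lemma ell2_bounded V : ell2 V -> exists B, forall i j, `|V i j| <= B.
Proof.
move=> V2; have := V2; rewrite /ell2 summableE => /fineK S.
pose s := fine (\esum_(p in [set: int * int]) `|(`|V p.1 p.2| ^+ 2)%:E|)%E.
exists (1 + s) => i j.
have h : `|V i j| ^+ 2 <= s.
  rewrite -lee_fin S; apply: esum_ge; exists [set (i, j)].
    by split => //; exact: finite_set1.
  by rewrite fsbig_set1 abse_EFin lee_fin ler_norm.
by have := sqr_ge0 (`|V i j| - 1); have := sqr_ge0 `|V i j|; lra.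
Qed.

Let K := k / hx ^+ 2 + k / hy ^+ 2.

Lemma implicit_opB V W i j :
  implicit_op mux muy hx hy k (fun a b => V a b - W a b) i j =
  implicit_op mux muy hx hy k V i j - implicit_op mux muy hx hy k W i j.
Proof. by rewrite /implicit_op /Dx /Dy /Dxx /Dyy; ring. Qed.

Hypotheses (hx0 : 0 < hx) (hy0 : 0 < hy) (k0 : 0 < k).
Hypotheses (mux1 : `|mux| * hx <= 1) (muy1 : `|muy| * hy <= 1).

(** The condition [|mu| h <= 1] makes both neighbour weights nonnegative, so their absolute values
    sum to [k / h^2] whatever the drift. *)
Let stencil (mu h a b : R) (B : R) : 0 < h -> `|mu| * h <= 1 -> `|a| <= B -> `|b| <= B ->
  `|k / (2 * h ^+ 2) * ((1 - mu * h) * a + (1 + mu * h) * b)| <= k / h ^+ 2 * B.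
Proof.
move=> h0 muh aB bB.
have h2 : 0 < h ^+ 2 by rewrite exprn_gt0.
have c0 : 0 <= k / (2 * h ^+ 2) by rewrite divr_ge0 ?ltW// mulr_gt0.
have : `|mu * h| <= 1 by rewrite normrM (gtr0_norm h0).
rewrite ler_norml => /andP[m1 m2].
rewrite normrM (ger0_norm c0).
rewrite [leRHS](_ : _ = k / (2 * h ^+ 2) * ((1 - mu * h) * B + (1 + mu * h) * B)); last first.
  by field; rewrite gt_eqF.
apply: ler_wpM2l => //; apply: le_trans (ler_normD _ _) _; rewrite !normrM.
rewrite (@ger0_norm _ (1 - mu * h)); last by rewrite subr_ge0.
rewrite (@ger0_norm _ (1 + mu * h)); last by rewrite -lerBlDl sub0r.
by apply: lerD; apply: ler_wpM2l => //; [rewrite subr_ge0|rewrite -lerBlDl sub0r].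
Qed.

(* The matrix of the implicit step is strictly diagonally dominant. *)
Lemma implicit_op_inj V W : (exists B, forall i j, `|V i j| <= B) ->
  (exists B, forall i j, `|W i j| <= B) ->
  implicit_op mux muy hx hy k V = implicit_op mux muy hx hy k W -> V = W.
Proof.
move=> [B1 VB] [B2 WB] VW.
pose U : grid R := fun i j => V i j - W i j.
have K0 : 0 <= K by rewrite addr_ge0// divr_ge0 ?ltW// exprn_gt0.
have UB i j : `|U i j| <= B1 + B2 by apply: le_trans (ler_normB _ _) _; rewrite lerD.
have U0 i j : implicit_op mux muy hx hy k U i j = 0 by rewrite implicit_opB VW subrr.
have step B : (forall i j, `|U i j| <= B) -> forall i j, (1 + K) * `|U i j| <= K * B.
  move=> hB i j.
  have e : (1 + K) * U i j =
      k / (2 * hx ^+ 2) * ((1 - mux * hx) * U (i + 1) j + (1 + mux * hx) * U (i - 1) j) +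
      k / (2 * hy ^+ 2) * ((1 - muy * hy) * U i (j + 1) + (1 + muy * hy) * U i (j - 1)).
    rewrite -[RHS]addr0 -(U0 i j) /implicit_op /Dx /Dy /Dxx /Dyy /K.
    by field; rewrite !gt_eqF.
  have K1 : 0 <= 1 + K by rewrite addr_ge0.
  rewrite -[X in X * `|_|](ger0_norm K1) -normrM e /K [leRHS]mulrDl.
  by apply: le_trans (ler_normD _ _) _; apply: lerD; exact: stencil.
(* On an infinite grid the maximum need not be attained, so the estimate is applied to the supremum:
   [(1 + K) S <= K S] forces [S <= 0]. *)
pose A := [set x | exists i j, x = `|U i j|].
have hA : has_sup A.
  by split; [exists `|U 0 0|, 0, 0|exists (B1 + B2) => _ [i [j ->]]].
have US i j : `|U i j| <= sup A.
  by apply: ub_le_sup; [exact: hA.2|exists i, j].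
have S0 : 0 <= sup A by apply: le_trans (US 0 0).
have : sup A <= K / (1 + K) * sup A.
  apply: ge_sup; first exact: hA.1.
  move=> _ [i [j ->]]; rewrite mulrAC ler_pdivlMr ?ltr_wpDr//.
  by rewrite [leLHS]mulrC; exact: step.
rewrite mulrAC ler_pdivlMr ?ltr_wpDr// mulrDr mulr1 [K * _]mulrC gerDr => S1.
apply/funext => i; apply/funext => j; apply/eqP; rewrite -subr_eq0 -normr_le0.
exact: le_trans (US i j) S1.
Qed.

Section grid_modes.
Variables (i0 j0 : int) (z : R * R).

Definition grid_phase (i j : int) : R :=
  (i - i0)%:~R * hx * z.1 + (j - j0)%:~R * hy * z.2.
(** The real part of [exp (i grid_phase) * p]: difference operators act on it by complex
    multiplication of the pair [p]. *)
Definition grid_mode p : grid R :=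
  fun i j => cos (grid_phase i j) * p.1 - sin (grid_phase i j) * p.2.

Let ux := hx * z.1. Let uy := hy * z.2.

Let phase_x i j : grid_phase (i + 1) j = grid_phase i j + ux.
Proof. by rewrite /grid_phase /ux addrAC rmorphD /=; ring. Qed.
Let phase_xN i j : grid_phase (i - 1) j = grid_phase i j - ux.
Proof. by rewrite /grid_phase /ux addrAC rmorphB /=; ring. Qed.
Let phase_y i j : grid_phase i (j + 1) = grid_phase i j + uy.
Proof. by rewrite /grid_phase /uy addrAC rmorphD /=; ring. Qed.
Let phase_yN i j : grid_phase i (j - 1) = grid_phase i j - uy.
Proof. by rewrite /grid_phase /uy addrAC rmorphB /=; ring. Qed.

Lemma Dx_mode p : Dx (grid_mode p) = grid_mode (- (2 * sin ux * p.2), 2 * sin ux * p.1).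
Proof.
apply/funext => i; apply/funext => j; rewrite /Dx /grid_mode /= !phase_x !phase_xN.
by move: (grid_phase i j) => f; rewrite !cosD !sinD cosN sinN; ring.
Qed.

Lemma Dy_mode p : Dy (grid_mode p) = grid_mode (- (2 * sin uy * p.2), 2 * sin uy * p.1).
Proof.
apply/funext => i; apply/funext => j; rewrite /Dy /grid_mode /= !phase_y !phase_yN.
by move: (grid_phase i j) => f; rewrite !cosD !sinD cosN sinN; ring.
Qed.

Lemma Dxx_mode p : Dxx (grid_mode p) = grid_mode ((2 * cos ux - 2) * p.1, (2 * cos ux - 2) * p.2).
Proof.
apply/funext => i; apply/funext => j; rewrite /Dxx /grid_mode /= !phase_x !phase_xN.
by move: (grid_phase i j) => f; rewrite !cosD !sinD cosN sinN; ring.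
Qed.

Lemma Dyy_mode p : Dyy (grid_mode p) = grid_mode ((2 * cos uy - 2) * p.1, (2 * cos uy - 2) * p.2).
Proof.
apply/funext => i; apply/funext => j; rewrite /Dyy /grid_mode /= !phase_y !phase_yN.
by move: (grid_phase i j) => f; rewrite !cosD !sinD cosN sinN; ring.
Qed.

Lemma Dxy_DxDy V : Dxy V = Dx (Dy V).
Proof. by apply/funext => i; apply/funext => j; rewrite /Dxy /Dx /Dy; ring. Qed.

Lemma implicit_mode p : implicit_op mux muy hx hy k (grid_mode p) =
  grid_mode (den_re hx hy k z * p.1 - den_im mux muy hx hy k z * p.2,
             den_re hx hy k z * p.2 + den_im mux muy hx hy k z * p.1).
Proof.
apply/funext => i; apply/funext => j.
rewrite /implicit_op Dx_mode Dy_mode Dxx_mode Dyy_mode /grid_mode /= /den_re /den_im.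
rewrite /symD /symDD -/ux -/uy.
by field; rewrite !gt_eqF.
Qed.

(** As [Dxy] is [Dx] after [Dy], the three second-order noise terms assemble into minus half the
    square of the noise symbol, while the [- 1] in the Milstein correction supplies
    [k / 2 * quad]. *)
Lemma milstein_mode zx zy p : 0 <= rhox -> 0 <= rhoy ->
  milstein_op rhox rhoy hx hy k zx zy (grid_mode p) =
  grid_mode (num_mul_re rhox rhoy hx hy k z (Num.sqrt k * zx) (Num.sqrt k * zy) p,
             num_mul_im rhox rhoy hx hy k z (Num.sqrt k * zx) (Num.sqrt k * zy) p).
Proof.
move=> rx ry; apply/funext => i; apply/funext => j.
rewrite /milstein_op Dxy_DxDy !(Dx_mode, Dy_mode) /grid_mode /= /num_mul_re /num_mul_im.
rewrite /num_re /noise_num /noise /quad /symD -/ux -/uy !sqrtrM//.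
set c := cos _; set s := sin _.
set sx := Num.sqrt rhox; set sy := Num.sqrt rhoy; set sk := Num.sqrt k.
have sxE : sx ^+ 2 = rhox by exact: sqr_sqrtr.
have syE : sy ^+ 2 = rhoy by exact: sqr_sqrtr.
have skE : sk ^+ 2 = k by apply: sqr_sqrtr; exact: ltW.
have -> : rhox * k * (zx ^+ 2 - 1) = (sx * (sk * zx)) ^+ 2 - rhox * k.
  by rewrite !exprMn sxE skE; ring.
have -> : rhoy * k * (zy ^+ 2 - 1) = (sy * (sk * zy)) ^+ 2 - rhoy * k.
  by rewrite !exprMn syE skE; ring.
have -> : sx * sy * k * zx * zy = (sx * (sk * zx)) * (sy * (sk * zy)).
  by rewrite -[in LHS]skE; ring.
by field; rewrite !gt_eqF.
Qed.

End grid_modes.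
End schemes_on_the_grid.

(** * Fourier integrals *)

Section real_integral_values.
Context {d : measure_display} {T : measurableType d} {R : realType}.
Variable mu : {measure set T -> \bar R}.
Implicit Types (f g : T -> R) (I J c : R).

(** Integrability travels with the value, so linear identities between integrals reduce to pointwise
    ones. *)
Definition has_rint f I : Prop := rintegrable mu setT f /\ \int[mu]_x f x = I.

Lemma has_rintP f : rintegrable mu setT f -> has_rint f (\int[mu]_x f x).
Proof. by []. Qed.

Lemma has_rintD f g I J : has_rint f I -> has_rint g J -> has_rint (fun x => f x + g x) (I + J).
Proof.
by move=> [fi <-] [gi <-]; split; [exact: rintegrableD|rewrite rintD].
Qed.

Lemma has_rintB f g I J : has_rint f I -> has_rint g J -> has_rint (fun x => f x - g x) (I - J).
Proof.
by move=> [fi <-] [gi <-]; split; [exact: rintegrableB|rewrite rintB].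
Qed.

Lemma has_rintZ f I c : has_rint f I -> has_rint (fun x => c * f x) (c * I).
Proof.
by move=> [fi <-]; split; [exact: rintegrableZ|rewrite rintZ].
Qed.

Lemma eq_has_rint f g I J : (forall x, f x = g x) -> I = J -> has_rint f I -> has_rint g J.
Proof. by move=> fg <-; have -> : f = g by apply/funext. Qed.

Lemma has_rint_fun f I J : has_rint f I -> has_rint f J -> I = J.
Proof. by move=> [_ <-] [_ <-]. Qed.

End real_integral_values.

Section product_integrals.
Context {d1 d2 : measure_display} {T1 : measurableType d1} {T2 : measurableType d2} {R : realType}.
Variable m1 : {sigma_finite_measure set T1 -> \bar R}.
Variable m2 : {sigma_finite_measure set T2 -> \bar R}.

Lemma has_rint_prod (f : T1 -> R) (g : T2 -> R) (I J : R) : has_rint m1 f I -> has_rint m2 g J ->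
  has_rint (m1 \x m2)%E (fun z => f z.1 * g z.2) (I * J).
Proof.
move=> [fi If] [gi Jg].
have mf := rintegrable_measurable fi; have mg := rintegrable_measurable gi.
have mfg : measurable_fun setT (fun z : T1 * T2 => f z.1 * g z.2).
  apply: measurable_funM.
    exact: (measurableT_comp mf measurable_fst).
  exact: (measurableT_comp mg measurable_snd).
have mfgE : measurable_fun setT (fun z : T1 * T2 => (f z.1 * g z.2)%:E).
  exact/measurable_EFinP.
have nf := rintegrable_norm measurableT fi; have ng := rintegrable_norm measurableT gi.
have Ifg : (m1 \x m2)%E.-integrable setT (fun z : T1 * T2 => (f z.1 * g z.2)%:E).
  apply/integrable12ltyP => //=.
  under eq_integral => x _.
    under eq_integral => y _ do rewrite normrM EFinM.
    rewrite ge0_integralZl//; last first.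
      exact/measurable_EFinP/(rintegrable_measurable ng).
    rewrite -EFin_rint//; over.
  rewrite ge0_integralZr//; last 2 first.
  - exact/measurable_EFinP/(rintegrable_measurable nf).
  - by rewrite lee_fin; apply: Rintegral_ge0.
  by rewrite -EFin_rint// -EFinM ltry.
split => //.
rewrite /Rintegral -integral12_prod_meas1//= /fubini_F.
under eq_integral => x _.
  under eq_integral => y _ do rewrite /= EFinM.
  rewrite integralZl//= -EFin_rint// Jg.
  over.
rewrite integralZr//= -EFin_rint// If.
by [].
Qed.

End product_integrals.

Section fourier_integrals.
Context {R : realType}.
Local Notation mu := (@lebesgue_measure R).

Lemma continuous_cosM (u : R) : continuous (fun x : R => cos (u * x)).
Proof.
move=> x; apply: (@continuous_comp _ _ _ (fun x => u * x)); last exact: continuous_cos.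
exact: mulrl_continuous.
Qed.

Lemma continuous_sinM (u : R) : continuous (fun x : R => sin (u * x)).
Proof.
move=> x; apply: (@continuous_comp _ _ _ (fun x => u * x)); last exact: continuous_sin.
exact: mulrl_continuous.
Qed.

Lemma has_rint_ge0 (f : R -> R) (I : R) : measurable_fun setT f -> (forall x, 0 <= f x) ->
  (\int[mu]_x (f x)%:E = I%:E)%E -> has_rint mu f I.
Proof.
move=> mf f0 fI; split; last by rewrite /Rintegral fI.
by apply: (@ge0_rintegrable _ _ _ mu setT f I) => //; rewrite fI.
Qed.

Lemma lebesgue_measure_opp (A : set R) : measurable A ->
  lebesgue_measure A = pushforward mu (-%R : R -> measurableTypeR R) A.
Proof.
move=> mA.
have mN : measurable_fun setT (-%R : measurableTypeR R -> measurableTypeR R) by exact: oppr_measurable.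
pose nu := measure_function_pushforward__canonical__measure_function_Measure mu mN.
apply: (@lebesgue_measure_unique R nu) => //= X [[a b] _ <-].
rewrite /pushforward [in RHS]/=.
have -> : -%R @^-1` `]a, b]%classic = `[- b, - a[%classic :> set R.
  apply/seteqP; split => x /=; rewrite !in_itv/=.
    by rewrite lerNl ltrNr => /andP[-> ->].
  by rewrite lerNl ltrNr => /andP[-> ->].
rewrite !lebesgue_measure_itv/= !lte_fin ltrN2.
by case: ifP => // _; rewrite opprK addeC.
Qed.

(** Reflection preserves Lebesgue measure, so the integral equals its own opposite. *)
Lemma has_rint_odd (f : R -> R) : rintegrable mu setT f -> (forall x, f (- x) = - f x) ->
  has_rint mu f 0.
Proof.
move=> fi fodd; split => //.
have mN : measurable_fun setT (-%R : measurableTypeR R -> measurableTypeR R) by exact: oppr_measurable.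
have e : \int[mu]_x f x = \int[mu]_x (-1 * f x).
  rewrite /Rintegral; congr fine.
  transitivity (\int[pushforward mu (-%R : measurableTypeR R -> measurableTypeR R)]_x (f x)%:E)%E.
    by apply: eq_measure_integral => A mA _; exact: lebesgue_measure_opp.
  rewrite integral_pushforward//.
  - by apply: eq_integral => x _ /=; rewrite fodd mulN1r.
  - exact: measurable_int fi.
  - have h : rintegrable mu setT (fun x => f (- x)).
      have -> : (fun x => f (- x)) = (fun x => -1 * f x).
        by apply/funext => x; rewrite fodd mulN1r.
      exact: rintegrableZ.
    exact: h.
have := rintZ (-1) measurableT fi; rewrite -e mulN1r => /eqP.
by rewrite -addr_eq0 -mulr2n mulrn_eq0 => /eqP.
Qed.

Lemma has_rint_FTC (f F : R -> R) (a b : R) : a < b -> continuous f ->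
  (forall x : R, is_derive x 1 F (f x)) ->
  has_rint mu (fun x => \1_(`[a, b]) x * f x) (F b - F a).
Proof.
move=> ab cf dF.
have cF : continuous F.
  by move=> x; apply: differentiable_continuous; apply/derivable1_diffP; exact: ex_derive.
have mf : measurable_fun setT f by exact: continuous_measurable_fun.
have cfw : {within `[a, b], continuous f} by exact: continuous_subspaceT.
have eI : (\int[mu]_(x in `[a, b]) (f x)%:E = (F b)%:E - (F a)%:E)%E.
  apply: continuous_FTC2 => //.
    split.
    - by move=> x _; exact: ex_derive.
    - exact: cvg_at_right_filter (cF a).
    - exact: cvg_at_left_filter (cF b).
  by move=> x _; rewrite derive1E; exact: derive_val.
have E : (fun x => (\1_(`[a, b]) x * f x)%:E) = (fun x => (f x)%:E) \_ `[a, b].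
  apply/funext => x; rewrite patchE indicE; case: ifPn => _; last by rewrite mul0r.
  by rewrite mul1r.
have fi : mu.-integrable `[a, b] (fun x => (f x)%:E).
  by apply: continuous_compact_integrable => //; exact: segment_compact.
have mI : measurable (`[a, b]%classic : set (measurableTypeR R)) by exact: measurable_itv.
split.
  have := (integrable_mkcond (mu := mu) (fun x : measurableTypeR R => (f x)%:E) mI).1 fi.
  by rewrite -E.
by rewrite /Rintegral E -integral_mkcond eI.
Qed.

Lemma has_rint_cos_box (a u : R) : 0 < a -> u != 0 ->
  has_rint mu (fun x => \1_(`[(- a), a]) x * cos (u * x)) (2 * (sin (u * a) / u)).
Proof.
move=> a0 u0; have aa : - a < a by rewrite gtrN.
apply: eq_has_rint (has_rint_FTC (f := fun x => cos (u * x)) (F := fun x => sin (u * x) / u) aa _ _) => //.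
- by rewrite mulrN sinN; ring.
- exact: continuous_cosM.
- by move=> x; apply: is_derive_eq; rewrite /= !scaler0 add0r /GRing.scale/=; field.
Qed.

Lemma has_rint_sin_box (a u : R) : 0 < a ->
  has_rint mu (fun x => \1_(`[(- a), a]) x * sin (u * x)) 0.
Proof.
move=> a0; have aa : - a < a by rewrite gtrN.
have [u0|u0] := eqVneq u 0.
  apply: eq_has_rint (has_rintZ 0 (has_rint_FTC (f := fun x => 1) (F := id) aa _ _)) => //.
  - by move=> x; rewrite u0 !mul0r sin0 mulr0.
  - by rewrite mul0r.
  - by move=> x; exact: cst_continuous.
apply: eq_has_rint (has_rint_FTC (f := fun x => sin (u * x)) (F := fun x => - cos (u * x) / u) aa _ _) => //.
- by rewrite mulrN cosN subrr.
- exact: continuous_sinM.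
- by move=> x; apply: is_derive_eq; rewrite /= !scaler0 add0r /GRing.scale/=; field.
Qed.

Lemma has_rint_box (a : R) : 0 < a -> has_rint mu (fun x => \1_(`[(- a), a]) x : R) (2 * a).
Proof.
move=> a0; have aa : - a < a by rewrite gtrN.
apply: eq_has_rint (has_rint_FTC (f := fun x => 1) (F := id) aa _ _) => //.
- by move=> x; rewrite mulr1.
- by rewrite opprK; ring.
- by move=> x; exact: cst_continuous.
Qed.

End fourier_integrals.

(** * Fourier transform of a Gaussian function *)

Section gaussian_fourier_integrals.
Context {d : measure_display} {Omega : measurableType d} {R : realType}.
Variable P : probability Omega R.
Variables (F : R -> set (set Omega)) (M : R -> Omega -> R).
Hypotheses (hF : filtration F) (bM : brownian_motion P F M).
Local Notation mu := (@lebesgue_measure R).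
Variable c : R.
Hypothesis c0 : 0 < c.

Let sg := Num.sqrt (2 * c)^-1.
Let v0 : 0 < (2 * c)^-1. Proof. by rewrite invr_gt0 mulr_gt0. Qed.
Let sg0 : sg != 0. Proof. by rewrite gt_eqF// sqrtr_gt0. Qed.
Let sg2 : sg ^+ 2 = (2 * c)^-1. Proof. by rewrite sqr_sqrtr// ltW. Qed.

Let pdfE x : normal_pdf 0 sg x = (Num.sqrt (pi / c))^-1 * expR (- (c * x ^+ 2)).
Proof.
rewrite normal_pdfE// /normal_peak /normal_fun sg2 subr0; congr ((Num.sqrt _)^-1 * expR _).
  by rewrite -mulr_natr; field; rewrite gt_eqF.
by rewrite -mulr_natr; field; rewrite gt_eqF.
Qed.

Let pc : 0 < Num.sqrt (pi / c) :> R. Proof. by rewrite sqrtr_gt0 divr_gt0// pi_gt0. Qed.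

Let pdf_rint : has_rint mu (normal_pdf 0 sg) 1.
Proof.
apply: has_rint_ge0; [exact: measurable_normal_pdf|exact: normal_pdf_ge0|exact: integral_normal_pdf].
Qed.

Lemma has_rint_gauss : has_rint mu (fun x => expR (- (c * x ^+ 2))) (Num.sqrt (pi / c)).
Proof.
apply: eq_has_rint (has_rintZ (Num.sqrt (pi / c)) pdf_rint) => [x|]; last by rewrite mulr1.
by rewrite pdfE mulVKf// gt_eqF.
Qed.

(** A probabilistic computation: over [[0, 1 / (2 c)]] the increment of [M] has a density
    proportional to [exp (- c x^2)], and the mean of its cosine is known from [increment_cos]. *)
Lemma has_rint_gauss_cos u : has_rint mu (fun x => expR (- (c * x ^+ 2)) * cos (u * x))
  (Num.sqrt (pi / c) * expR (- (u ^+ 2 / (4 * c)))).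
Proof.
pose D w := M (2 * c)^-1 w - M 0 w.
have g := brownian_gaussian_increments hF bM.
have tD : tame P (F (2 * c)^-1) D by case: g => _ _ _ h _; apply: h => //; exact: ltW.
have [sF Fm] := hF.1 _ (ltW v0).
have tDT : tame P measurable D by apply: tame_mono tD => //.
have ecos := increment_cos g (lexx 0) (ltW v0) u.
(* Adding [1] makes the integrand nonnegative, so the change of law needs no prior integrability;
   the density is subtracted again at the end. *)
pose f x : R := 1 + cos (u * x).
have f0 x : 0 <= f x by rewrite /f; have := @cos_geN1 R (u * x); lra.
have mf : measurable_fun setT f.
  by apply: measurable_funD => //; apply: continuous_measurable_fun; exact: continuous_cosM.
have I1 : has_rint mu (fun x => f x * normal_pdf 0 sg x) (1 + expR (- (u ^+ 2 / (4 * c)))).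
  apply: has_rint_ge0.
  - by apply: measurable_funM => //; exact: measurable_normal_pdf.
  - by move=> x; rewrite mulr_ge0 ?normal_pdf_ge0.
  transitivity (\int[P]_w (f (D w))%:E)%E.
    rewrite (ge0_integral_brownian_increment hF bM (f := fun x => (f x)%:E) (lexx 0) v0).
    - rewrite subr0 ge0_integral_normal.
      + by apply: eq_integral => x _; rewrite EFinM.
      + exact/measurable_EFinP.
      + by move=> x; rewrite lee_fin.
    - exact/measurable_EFinP.
    - by move=> x; rewrite lee_fin.
  rewrite -EFin_rint//; last first.
    apply: (@tame_integrable _ _ _ P measurable); first exact: subsigma_measurable.
    by have sM := @subsigma_measurable d Omega; rewrite /f; tame_tac.
  congr EFin; rewrite /f tED; [|have sM := @subsigma_measurable d Omega; tame_tac..].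
  rewrite tE_cst ecos; congr (_ + expR _).
  by rewrite subr0; field; rewrite gt_eqF.
apply: eq_has_rint (has_rintZ (Num.sqrt (pi / c)) (has_rintB I1 pdf_rint)) => [x|].
  by rewrite pdfE /f; field; rewrite gt_eqF.
by rewrite addrC addKr.
Qed.

Lemma has_rint_gauss_sin u : has_rint mu (fun x => expR (- (c * x ^+ 2)) * sin (u * x)) 0.
Proof.
apply: has_rint_odd.
  apply: (rintegrable_le measurableT _ _ has_rint_gauss.1).
    apply: measurable_funM; first exact: rintegrable_measurable has_rint_gauss.1.
    by apply: continuous_measurable_fun; exact: continuous_sinM.
  move=> x _; rewrite normrM ger0_norm ?expR_ge0// ler_piMr ?expR_ge0//.
  by rewrite ler_norml sin_geN1 sin_le1.
by move=> x; rewrite sqrrN mulrN sinN mulrN.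
Qed.

End gaussian_fourier_integrals.

(** * Fourier representation of the two solutions *)

Section amplification_measurability.
Context {R : realType} {d : measure_display} {T : measurableType d}.
Variables (mux muy rhox rhoy hx hy k : R).
Hypotheses (hx0 : 0 < hx) (hy0 : 0 < hy) (k0 : 0 <= k).
Variables (z : T -> R * R) (dx dy : nat -> T -> R).
Hypotheses (mz1 : measurable_fun setT (fun t => (z t).1)) (mz2 : measurable_fun setT (fun t => (z t).2)).
Hypotheses (mdx : forall n, measurable_fun setT (dx n)) (mdy : forall n, measurable_fun setT (dy n)).

Let msym (h : R) (f : T -> R) : measurable_fun setT f -> measurable_fun setT (fun t => symD h (f t)).
Proof.
move=> mf; apply: measurable_funM => //.
exact: (measurableT_comp (continuous_measurable_fun (@continuous_sinM R h)) mf).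
Qed.

Let msymD (h : R) (f : T -> R) : measurable_fun setT f -> measurable_fun setT (fun t => symDD h (f t)).
Proof.
move=> mf; apply: measurable_funM => //; apply: measurable_funB => //; apply: measurable_funM => //.
exact: (measurableT_comp (continuous_measurable_fun (@continuous_cosM R h)) mf).
Qed.

Let mden_re : measurable_fun setT (fun t => den_re hx hy k (z t)).
Proof.
apply: measurable_funD => //; apply: measurable_funM => //.
by apply: measurable_funD; exact: msymD.
Qed.

Let mden_im : measurable_fun setT (fun t => den_im mux muy hx hy k (z t)).
Proof.
apply: measurable_funM => //.
by apply: measurable_funD; apply: measurable_funM => //; exact: msym.
Qed.

Let mden_sq : measurable_fun setT (fun t => (den_sq mux muy hx hy k (z t))^-1).
Proof.
(* Since [den_sq >= 1], inversion can be replaced by the inverse of [max 1 x], which is continuous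
   everywhere. *)
have -> : (fun t => (den_sq mux muy hx hy k (z t))^-1) =
    (fun x => (Num.max 1 x)^-1) \o (fun t => den_sq mux muy hx hy k (z t)).
  apply/funext => t /=; rewrite max_r//; exact: den_sq_ge1.
apply: measurableT_comp; last first.
  by apply: measurable_funD; exact: measurable_funX.
apply: continuous_measurable_fun => x; apply: (@cvgV _ _ _ _ (fun x => Num.max 1 x)).
  by rewrite gt_eqF// lt_max ltr01.
have c := @continuous_max _ _ (fun _ : R => 1) id x (cvg_cst _) cvg_id; exact: c.
Qed.

Let mnoise n : measurable_fun setT (fun t => noise_num rhox rhoy hx hy (z t) (dx n t) (dy n t)).
Proof.
by apply: measurable_funD; apply: measurable_funM => //; apply: measurable_funM => //; exact: msym.
Qed.

Let mnum n : measurable_fun setT (fun t => num_re rhox rhoy hx hy k (z t) (dx n t) (dy n t)).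
Proof.
apply: measurable_funD.
  apply: measurable_funB => //; apply: measurable_funM => //.
  exact: measurable_funX.
apply: measurable_funM => //.
by apply: measurable_funD; apply: measurable_funM => //; apply: measurable_funX; exact: msym.
Qed.

Lemma measurable_amp n :
  measurable_fun setT (fun t => (amp mux muy rhox rhoy hx hy k (z t) (dx^~ t) (dy^~ t) n).1) /\
  measurable_fun setT (fun t => (amp mux muy rhox rhoy hx hy k (z t) (dx^~ t) (dy^~ t) n).2).
Proof.
elim: n => [|n [IH1 IH2]]; first by split.
split => /=; apply: measurable_funM => //.
- by apply: measurable_funD; apply: measurable_funM => //;
    [apply: measurable_funD|apply: measurable_funB]; exact: measurable_funM.
- by apply: measurable_funB; apply: measurable_funM => //;
    [apply: measurable_funB|apply: measurable_funD]; exact: measurable_funM.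
Qed.

End amplification_measurability.
Section integrals_of_grids.
Context {R : realType} {d : measure_display} {T : measurableType d}.
Variable m : {measure set T -> \bar R}.
Variables (mux muy rhox rhoy hx hy k : R).
Variables (G : T -> grid R) (I : grid R).
Hypothesis GI : forall i j, has_rint m (fun t => G t i j) (I i j).

Ltac has_rint_tac := repeat
  first [exact: GI | apply: has_rintB | apply: has_rintD | apply: has_rintZ].

Lemma has_rint_implicit_op i j :
  has_rint m (fun t => implicit_op mux muy hx hy k (G t) i j) (implicit_op mux muy hx hy k I i j).
Proof. rewrite /implicit_op /Dx /Dy /Dxx /Dyy; has_rint_tac. Qed.

Lemma has_rint_milstein_op zx zy i j :
  has_rint m (fun t => milstein_op rhox rhoy hx hy k zx zy (G t) i j)
    (milstein_op rhox rhoy hx hy k zx zy I i j).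
Proof. rewrite /milstein_op /Dx /Dy /Dxy; has_rint_tac. Qed.

End integrals_of_grids.

Lemma implicit_opZ (R : realType) (mux muy hx hy k c : R) (V : grid R) i j :
  implicit_op mux muy hx hy k (fun a b => c * V a b) i j = c * implicit_op mux muy hx hy k V i j.
Proof. by rewrite /implicit_op /Dx /Dy /Dxx /Dyy; ring. Qed.

Lemma milstein_opZ (R : realType) (rhox rhoy hx hy k zx zy c : R) (V : grid R) i j :
  milstein_op rhox rhoy hx hy k zx zy (fun a b => c * V a b) i j =
  c * milstein_op rhox rhoy hx hy k zx zy V i j.
Proof. by rewrite /milstein_op /Dx /Dy /Dxy; ring. Qed.

Lemma sin_int_pi (R : realType) (n : int) : sin (n%:~R * pi : R) = 0.
Proof.
have nat_pi (p : nat) : sin (p%:R * pi : R) = 0.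
  by elim: p => [|p IH]; rewrite ?mul0r ?sin0// -natr1 mulrDl mul1r sinDpi IH oppr0.
by case: n => p; [exact: nat_pi|rewrite NegzE mulrNz mulNr sinN nat_pi oppr0].
Qed.

(** * The numerical solution as an inverse Fourier transform over the box *)

Section fourier_solution.
Context {R : realType}.
Local Notation mu := (@lebesgue_measure R).
Local Notation mu2 := (mu \x mu)%E.
Variables (mux muy rhox rhoy hx hy k : R) (i0 j0 : int).
Hypotheses (hx0 : 0 < hx) (hy0 : 0 < hy) (k0 : 0 < k) (rx : 0 <= rhox) (ry : 0 <= rhoy).
Variables (dx dy : nat -> R).

Definition box_indic (z : R * R) : R :=
  \1_(`[- (pi / hx), pi / hx]) z.1 * \1_(`[- (pi / hy), pi / hy]) z.2.

Lemma has_rint_box_indic : has_rint mu2 box_indic (2 * (pi / hx) * (2 * (pi / hy))).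
Proof. by apply: has_rint_prod; apply: has_rint_box; rewrite divr_gt0// pi_gt0. Qed.

Lemma box_indic01 z : 0 <= box_indic z <= 1.
Proof.
by rewrite /box_indic !indicE; do 2!case: (_ \in _); rewrite ?(mulr1, mulr0, lexx, ler01).
Qed.

Let A n z := amp mux muy rhox rhoy hx hy k z dx dy n.

(** The bound depends on the mesh and on the increments; it serves only to make the integral over
    the box converge, uniformly in [i] and [j]. *)
Lemma amp_bounded n : exists2 B, 0 <= B & forall z, (A n z).1 ^+ 2 + (A n z).2 ^+ 2 <= B.
Proof.
have symh (h x : R) : 0 < h -> `|symD h x| <= h^-1.
  move=> h0; rewrite /symD normrM (ger0_norm (x := h^-1)) ?invr_ge0 ?(ltW h0)//.
  by rewrite -[leRHS]mul1r ler_wpM2r ?invr_ge0 ?(ltW h0)// ler_norml sin_geN1 sin_le1.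
elim: n => [|n [B B0 AB]]; first by exists 1 => // z; rewrite /= expr1n expr0n addr0.
pose Nz := Num.sqrt rhox * hx^-1 * `|dx n| + Num.sqrt rhoy * hy^-1 * `|dy n|.
pose Nr := 1 + Nz ^+ 2 / 2 + k / 2 * (rhox * hx^-1 ^+ 2 + rhoy * hy^-1 ^+ 2).
exists ((Nr ^+ 2 + Nz ^+ 2) * B) => [|z]; first by rewrite mulr_ge0// addr_ge0 ?sqr_ge0.
have ax := symh hx z.1 hx0; have ay := symh hy z.2 hy0.
have nz : `|noise_num rhox rhoy hx hy z (dx n) (dy n)| <= Nz.
  rewrite /noise_num /noise; move: (symD hx z.1) (symD hy z.2) ax ay => a b ax ay.
  apply: le_trans (ler_normD _ _) _; rewrite !normrM !(ger0_norm (sqrtr_ge0 _)).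
  by apply: lerD; apply: ler_wpM2r => //; apply: ler_wpM2l => //; exact: sqrtr_ge0.
have nz2 : noise_num rhox rhoy hx hy z (dx n) (dy n) ^+ 2 <= Nz ^+ 2.
  by rewrite -real_normK ?num_real// lerXn2r ?nnegrE// (le_trans _ nz).
have ax2 : symD hx z.1 ^+ 2 <= hx^-1 ^+ 2.
  by rewrite -real_normK ?num_real// lerXn2r ?nnegrE// (le_trans _ ax).
have ay2 : symD hy z.2 ^+ 2 <= hy^-1 ^+ 2.
  by rewrite -real_normK ?num_real// lerXn2r ?nnegrE// (le_trans _ ay).
have q0 : 0 <= quad rhox rhoy (symD hx z.1) (symD hy z.2).
  by rewrite /quad addr_ge0// mulr_ge0// sqr_ge0.
have qle : k / 2 * quad rhox rhoy (symD hx z.1) (symD hy z.2) <=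
    k / 2 * (rhox * hx^-1 ^+ 2 + rhoy * hy^-1 ^+ 2).
  by rewrite ler_wpM2l ?divr_ge0 ?(ltW k0)// lerD// ler_wpM2l.
have kq0 : 0 <= k / 2 * quad rhox rhoy (symD hx z.1) (symD hy z.2).
  by rewrite mulr_ge0// divr_ge0// ltW.
have n0 := sqr_ge0 (noise_num rhox rhoy hx hy z (dx n) (dy n)).
have nr : `|num_re rhox rhoy hx hy k z (dx n) (dy n)| <= Nr.
  by rewrite ler_norml /num_re /Nr; apply/andP; split; lra.
have nr2 : num_re rhox rhoy hx hy k z (dx n) (dy n) ^+ 2 <= Nr ^+ 2.
  by rewrite -real_normK ?num_real// lerXn2r ?nnegrE// (le_trans _ nr).
have e := amp_step_sqr mux muy rhox rhoy hx0 hy0 (ltW k0) z (dx n) (dy n) (A n z).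
have p0 : 0 <= (A n.+1 z).1 ^+ 2 + (A n.+1 z).2 ^+ 2 by rewrite addr_ge0 ?sqr_ge0.
apply: le_trans (_ : den_sq mux muy hx hy k z * ((A n.+1 z).1 ^+ 2 + (A n.+1 z).2 ^+ 2) <= _).
  by rewrite ler_peMl// den_sq_ge1// ltW.
rewrite e; apply: ler_pM => //; [by rewrite addr_ge0 ?sqr_ge0|by rewrite addr_ge0 ?sqr_ge0|].
exact: lerD.
Qed.

Definition grid_integrand n (z : R * R) : grid R :=
  fun i j => box_indic z * grid_mode hx hy i0 j0 z (A n z) i j.

Lemma measurable_grid_phase i j : measurable_fun setT
  (fun z : R * R => grid_phase hx hy i0 j0 z i j).
Proof.
by apply: measurable_funD; apply: measurable_funM.
Qed.

Lemma grid_integrand_bounded n :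
  exists B, forall z i j, `|grid_integrand n z i j| <= B * box_indic z.
Proof.
have [B B0 AB] := amp_bounded n; exists (2 + 2 * B) => z i j.
have /andP[b0 _] := box_indic01 z.
rewrite /grid_integrand normrM (ger0_norm b0) mulrC ler_wpM2r//.
have a1 : `|(A n z).1| <= 1 + B.
  have s1 := sqr_ge0 (A n z).1; have s2 := sqr_ge0 (A n z).2.
  have := AB z; have := sqr_ge0 (`|(A n z).1| - 1).
  by have e := real_normK (num_real (A n z).1); rewrite sqrrB expr1n mulr1 e => *; lra.
have a2 : `|(A n z).2| <= 1 + B.
  have s1 := sqr_ge0 (A n z).1; have s2 := sqr_ge0 (A n z).2.
  have := AB z; have := sqr_ge0 (`|(A n z).2| - 1).
  by have e := real_normK (num_real (A n z).2); rewrite sqrrB expr1n mulr1 e => *; lra.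
apply: le_trans (ler_normB _ _) _; rewrite !normrM.
have c1 : `|cos (grid_phase hx hy i0 j0 z i j)| <= 1 by exact: cos_max.
have c2 : `|sin (grid_phase hx hy i0 j0 z i j)| <= 1 by exact: sin_max.
rewrite [leRHS](_ : _ = 1 * (1 + B) + 1 * (1 + B)); last by ring.
by apply: lerD; apply: ler_pM.
Qed.

Lemma grid_integrand_rintegrable n i j : rintegrable mu2 setT (fun z => grid_integrand n z i j).
Proof.
have [B Ble] := grid_integrand_bounded n.
have [ib _] := has_rint_box_indic.
apply: (@rintegrable_le _ (measurableTypeR R * measurableTypeR R)%type R mu2 setT
  (fun z => grid_integrand n z i j) (fun z => B * box_indic z) measurableT) => //.
  2: exact: rintegrableZ.
apply: measurable_funM; first exact: rintegrable_measurable ib.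
have [m1 m2] := @measurable_amp R _ (measurableTypeR R * measurableTypeR R)%type mux muy rhox rhoy hx hy k
  hx0 hy0 (ltW k0) id (fun n _ => dx n) (fun n _ => dy n) measurable_fst measurable_snd
  (fun n => measurable_cst _) (fun n => measurable_cst _) n.
have mc := measurable_grid_phase i j.
apply: measurable_funB; apply: measurable_funM => //.
  exact: (measurableT_comp (continuous_measurable_fun (@continuous_cos R)) mc).
exact: (measurableT_comp (continuous_measurable_fun (@continuous_sin R)) mc).
Qed.

Definition fourier_solution (n : nat) : grid R :=
  fun i j => (4 * pi ^+ 2)^-1 * \int[mu2]_z grid_integrand n z i j.

Let pi2 : 0 < 4 * pi ^+ 2 :> R. Proof. by rewrite mulr_gt0// exprn_gt0// pi_gt0. Qed.

Lemma fourier_solution_bounded n : exists B, forall i j, `|fourier_solution n i j| <= B.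
Proof.
have [B Ble] := grid_integrand_bounded n; have [ib _] := has_rint_box_indic.
exists ((4 * pi ^+ 2)^-1 * \int[mu2]_z (B * box_indic z)) => i j.
rewrite normrM ger0_norm ?invr_ge0 ?(ltW pi2)// ler_wpM2l ?invr_ge0 ?(ltW pi2)//.
apply: norm_rint_le => //; first exact: grid_integrand_rintegrable.
exact: rintegrableZ.
Qed.

(** With half-width [pi / h], the integral of [cos ((n - n0) h x)] is a multiple of the sine of an
    integer multiple of [pi], hence zero unless [n = n0]. The sine products contribute nothing. *)
Lemma fourier_solution0 : fourier_solution 0 = dirac_grid hx hy i0 j0.
Proof.
apply/funext => i; apply/funext => j.
have cosb (h : R) (n n0 : int) : 0 < h ->
    has_rint mu (fun x => \1_(`[- (pi / h), pi / h]) x * cos ((n - n0)%:~R * h * x))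
     (if n == n0 then 2 * (pi / h) else 0).
  move=> h0; have ph : 0 < pi / h by rewrite divr_gt0// pi_gt0.
  case: eqVneq => [->|nn].
    apply: eq_has_rint (has_rint_box ph) => // x.
    by rewrite subrr !mul0r cos0 mulr1.
  have nh : (n - n0)%:~R * h != 0 by rewrite mulf_neq0 ?intr_eq0 ?subr_eq0// gt_eqF.
  apply: eq_has_rint (has_rint_cos_box ph nh) => //.
  by rewrite -mulrA [h * _]mulrC divfK ?gt_eqF// sin_int_pi mul0r mulr0.
have sinb (h : R) (n n0 : int) : 0 < h ->
    has_rint mu (fun x => \1_(`[- (pi / h), pi / h]) x * sin ((n - n0)%:~R * h * x)) 0.
  by move=> h0; apply: has_rint_sin_box; rewrite divr_gt0// pi_gt0.
have H := has_rintB (has_rint_prod (cosb hx i i0 hx0) (cosb hy j j0 hy0))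
  (has_rint_prod (sinb hx i i0 hx0) (sinb hy j j0 hy0)).
rewrite /fourier_solution.
have -> : (fun z => grid_integrand 0 z i j) = (fun z =>
    \1_(`[- (pi / hx), pi / hx]) z.1 * cos ((i - i0)%:~R * hx * z.1) *
    (\1_(`[- (pi / hy), pi / hy]) z.2 * cos ((j - j0)%:~R * hy * z.2)) -
    \1_(`[- (pi / hx), pi / hx]) z.1 * sin ((i - i0)%:~R * hx * z.1) *
    (\1_(`[- (pi / hy), pi / hy]) z.2 * sin ((j - j0)%:~R * hy * z.2))).
  apply/funext => z; rewrite /grid_integrand /grid_mode /grid_phase /box_indic /= cosD.
  by rewrite mulr0 subr0 mulr1; ring.
rewrite H.2 mulr0 subr0 /dirac_grid.
case: eqVneq => _ /=; last by rewrite mul0r mulr0.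
case: eqVneq => _; last by rewrite !mulr0.
have p0 : (pi : R) != 0 by rewrite gt_eqF// pi_gt0.
have hxn : hx != 0 by rewrite gt_eqF.
have hyn : hy != 0 by rewrite gt_eqF.
by move: (pi : R) p0 => q q0; field; rewrite q0 hxn hyn.
Qed.

(** Both operators are finite combinations of shifts and commute with the integral; under it,
    [amp_step] solves the step frequency by frequency. *)
Lemma fourier_solutionS n zx zy : dx n = Num.sqrt k * zx -> dy n = Num.sqrt k * zy ->
  implicit_op mux muy hx hy k (fourier_solution n.+1) =
  milstein_op rhox rhoy hx hy k zx zy (fourier_solution n).
Proof.
move=> ex ey; apply/funext => i; apply/funext => j.
rewrite implicit_opZ milstein_opZ; congr (_ * _).
have hasI m i' j' : has_rint mu2 (fun z => grid_integrand m z i' j')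
    (\int[mu2]_z grid_integrand m z i' j').
  exact: has_rintP (grid_integrand_rintegrable m i' j').
apply: (has_rint_fun (has_rint_implicit_op mux muy hx hy k (hasI n.+1) i j)).
apply: eq_has_rint (has_rint_milstein_op rhox rhoy hx hy k (hasI n) zx zy i j) => // z.
rewrite /grid_integrand implicit_opZ milstein_opZ; congr (_ * _).
rewrite implicit_mode// milstein_mode//.
have e1 := amp_step_re mux muy rhox rhoy hx0 hy0 (ltW k0) z (dx n) (dy n) (A n z).
have e2 := amp_step_im mux muy rhox rhoy hx0 hy0 (ltW k0) z (dx n) (dy n) (A n z).
by rewrite -ex -ey -e1 -e2.
Qed.

Lemma milstein_scheme_fourier (N : nat) (zx zy : nat -> R) (V : nat -> grid R) :
  `|mux| * hx <= 1 -> `|muy| * hy <= 1 ->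
  (forall n, dx n = Num.sqrt k * zx n) -> (forall n, dy n = Num.sqrt k * zy n) ->
  milstein_scheme mux muy rhox rhoy hx hy k i0 j0 N zx zy V ->
  forall n, (n <= N)%N -> V n = fourier_solution n.
Proof.
move=> mx my ex ey [V0 VS]; elim=> [_|n IH nN]; first by rewrite V0 fourier_solution0.
have [l2 eV] := VS n nN.
apply: (implicit_op_inj hx0 hy0 k0 mx my (ell2_bounded l2) (fourier_solution_bounded n.+1)).
by rewrite eV IH ?(ltnW nN)// -(fourier_solutionS (ex n) (ey n)).
Qed.

End fourier_solution.

(** * The SPDE solution as an inverse Fourier transform over the plane *)

Section exact_solution.
Context {d : measure_display} {Omega : measurableType d} {R : realType}.
Variable P : probability Omega R.
Variables (F : R -> set (set Omega)) (M : R -> Omega -> R).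
Hypotheses (hF : filtration F) (bM : brownian_motion P F M).
Local Notation mu := (@lebesgue_measure R).
Local Notation mu2 := (mu \x mu)%E.

(** The grid phase minus the random phase is [X z.1 + Y z.2]. The addition formula splits its cosine
    into products of one-dimensional Gaussian integrals, of which the sine ones vanish. *)
Lemma has_rint_exact_mode (x0 y0 mux muy rhox rhoy hx hy T mx my : R) (i0 j0 i j : int) :
  0 < T -> rhox < 1 -> rhoy < 1 -> i0%:~R * hx = x0 -> j0%:~R * hy = y0 ->
  has_rint mu2 (fun z => grid_mode hx hy i0 j0 z
      (exact_re mux muy rhox rhoy z T mx my, exact_im mux muy rhox rhoy z T mx my) i j)
    (4 * pi ^+ 2 * spde_solution x0 y0 mux muy rhox rhoy T mx my (i%:~R * hx) (j%:~R * hy)).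
Proof.
move=> T0 rx ry i0x j0y.
set X := i%:~R * hx - x0 - mux * T - Num.sqrt rhox * mx.
set Y := j%:~R * hy - y0 - muy * T - Num.sqrt rhoy * my.
have rx0 : 0 < 1 - rhox by rewrite subr_gt0.
have ry0 : 0 < 1 - rhoy by rewrite subr_gt0.
have c1 : 0 < T * (1 - rhox) / 2 by rewrite divr_gt0// mulr_gt0.
have c2 : 0 < T * (1 - rhoy) / 2 by rewrite divr_gt0// mulr_gt0.
have H := has_rintB
  (has_rint_prod (has_rint_gauss_cos hF bM c1 X) (has_rint_gauss_cos hF bM c2 Y))
  (has_rint_prod (has_rint_gauss_sin c1 X) (has_rint_gauss_sin c2 Y)).
apply: eq_has_rint H => [z|].
  rewrite /grid_mode /exact_re /exact_im /=.
  set ph := phase _ _ _ _ _ _ _ _; set gp := grid_phase _ _ _ _ _ _ _.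
  have -> : cos gp * (cos ph * expR (- (T * decay rhox rhoy z))) -
      sin gp * (- sin ph * expR (- (T * decay rhox rhoy z))) =
      expR (- (T * decay rhox rhoy z)) * cos (gp - ph).
    by rewrite cosB; ring.
  have -> : gp - ph = X * z.1 + Y * z.2.
    by rewrite /gp /ph /phase /grid_phase /X /Y -i0x -j0y !rmorphB /=; ring.
  have -> : expR (- (T * decay rhox rhoy z)) =
      expR (- (T * (1 - rhox) / 2 * z.1 ^+ 2)) * expR (- (T * (1 - rhoy) / 2 * z.2 ^+ 2)).
    by rewrite -expRD; congr expR; rewrite /decay; field.
  by rewrite cosD; ring.
rewrite mulr0 subr0 /spde_solution -/X -/Y.
have := @pi_gt0 R; move: (pi : R) => q p0.
have qn : q != 0 by rewrite gt_eqF.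
have Tn : T != 0 by rewrite gt_eqF.
have rxn : 1 - rhox != 0 by rewrite gt_eqF.
have ryn : 1 - rhoy != 0 by rewrite gt_eqF.
have s0 : 0 < Num.sqrt ((1 - rhox) * (1 - rhoy)) by rewrite sqrtr_gt0 mulr_gt0.
have sq : Num.sqrt (q / (T * (1 - rhox) / 2)) * Num.sqrt (q / (T * (1 - rhoy) / 2)) =
    2 * q / T / Num.sqrt ((1 - rhox) * (1 - rhoy)).
  rewrite -(sqrtrM _ (divr_ge0 (ltW p0) (ltW c1))).
  rewrite (_ : q / (T * (1 - rhox) / 2) * (q / (T * (1 - rhoy) / 2)) = (2 * q / T) ^+ 2 / ((1 - rhox) * (1 - rhoy))); last first.
    by field; rewrite ?qn ?Tn ?rxn ?ryn.
  rewrite sqrtrM ?sqr_ge0// sqrtr_sqr sqrtrV ?mulr_ge0 ?(ltW rx0) ?(ltW ry0)//.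
  by rewrite ger0_norm// divr_ge0 ?(ltW T0)// mulr_ge0// ltW.
rewrite mulrACA sq -expRD.
have -> : - (X ^+ 2 / (4 * (T * (1 - rhox) / 2))) + - (Y ^+ 2 / (4 * (T * (1 - rhoy) / 2))) =
    - (X ^+ 2 / (2 * (1 - rhox) * T)) - Y ^+ 2 / (2 * (1 - rhoy) * T).
  by field; rewrite ?qn ?Tn ?rxn ?ryn.
have sn : Num.sqrt ((1 - rhox) * (1 - rhoy)) != 0 by rewrite gt_eqF.
by field; rewrite ?qn ?Tn ?sn.
Qed.

End exact_solution.

(** * A weighted Cauchy-Schwarz inequality *)

Section weighted_cauchy_schwarz.
Context {d1 d2 : measure_display} {Omega : measurableType d1} {T : measurableType d2} {R : realType}.
Variable P : {sigma_finite_measure set Omega -> \bar R}.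
Variable m : {sigma_finite_measure set T -> \bar R}.
Variables (f : Omega -> T -> R) (w : T -> R) (W : R).
Hypothesis mf : measurable_fun setT (fun p : Omega * T => f p.1 p.2).
Hypothesis fi : forall o, rintegrable m setT (f o).
Hypotheses (w0 : forall z, 0 < w z) (wW : has_rint m w W) (W0 : 0 < W).

Lemma measurable_rint : measurable_fun setT (fun o => \int[m]_z f o z).
Proof.
apply: measurableT_comp => //.
have -> : (fun o => \int[m]_z (f o z)%:E)%E =
    (fun o => \int[m]_z (EFin \o f o)^\+ z - \int[m]_z (EFin \o f o)^\- z)%E.
  by apply/funext => o; rewrite integralE.
have mE : measurable_fun setT (fun p : Omega * T => (f p.1 p.2)%:E) by exact/measurable_EFinP.
apply: emeasurable_funB.
- apply: (measurable_fun_fubini_tonelli_F (m2 := m) (fun p : Omega * T => (EFin \o f p.1)^\+ p.2)%E).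
    have -> : (fun p : Omega * T => (EFin \o f p.1)^\+ p.2)%E = ((fun p => (f p.1 p.2)%:E)^\+)%E.
      by apply/funext => p; rewrite !funeposE.
    exact: measurable_funepos.
  by move=> p; exact: funepos_ge0.
- apply: (measurable_fun_fubini_tonelli_F (m2 := m) (fun p : Omega * T => (EFin \o f p.1)^\- p.2)%E).
    have -> : (fun p : Omega * T => (EFin \o f p.1)^\- p.2)%E = ((fun p => (f p.1 p.2)%:E)^\-)%E.
      by apply/funext => p; rewrite !funenegE.
    exact: measurable_funeneg.
  by move=> p; exact: funeneg_ge0.
Qed.

Let msec o : measurable_fun setT (f o).
Proof. exact: rintegrable_measurable (fi o). Qed.

Let mw : measurable_fun setT w. Proof. exact: rintegrable_measurable wW.1. Qed.

Let mwV : measurable_fun setT (fun z => (w z)^-1).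
Proof.
have -> : (fun z => (w z)^-1) = (fun z => expR (- ln (w z))).
  by apply/funext => z; rewrite expRN lnK// posrE.
apply: measurableT_comp; first exact: measurable_expR.
by apply: measurableT_comp => //; apply: measurableT_comp mw; exact: measurable_ln.
Qed.

(** Integrate [2 c f - c^2 w <= f^2 / w], which restates [(f - c w)^2 >= 0], with the optimal
    [c = I / W]. The right-hand side may be infinite, a case settled first. *)
Let weighted o : (((\int[m]_z f o z) ^+ 2)%:E <= W%:E * \int[m]_z (f o z ^+ 2 / w z)%:E)%E.
Proof.
set I := \int[m]_z f o z.
have fw0 z : 0 <= f o z ^+ 2 / w z by rewrite divr_ge0 ?sqr_ge0// ltW.
have mfw : measurable_fun setT (fun z => f o z ^+ 2 / w z).
  by apply: measurable_funM => //; exact: measurable_funX.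
have J0 : (0 <= \int[m]_z (f o z ^+ 2 / w z)%:E)%E.
  by apply: integral_ge0 => z _; rewrite lee_fin.
case EJ : (\int[m]_z (f o z ^+ 2 / w z)%:E)%E J0 => [J| |] // J0; last first.
  by rewrite gt0_muley// ?lte_fin// leey.
have iJ : rintegrable m setT (fun z => f o z ^+ 2 / w z).
  by apply: (@ge0_rintegrable _ _ _ m setT _ J) => //; rewrite EJ.
pose c := I / W.
have hJ : \int[m]_z (f o z ^+ 2 / w z) = J by rewrite /Rintegral EJ.
have H := has_rintB (has_rintZ (2 * c) (has_rintP (fi o))) (has_rintZ (c ^+ 2) wW).
have : 2 * c * I - c ^+ 2 * W <= J.
  rewrite -hJ -H.2; apply: le_rint => //; first exact: H.1.
  move=> z _; rewrite ler_pdivlMr//.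
  by have := sqr_ge0 (f o z - c * w z); lra.
rewrite -EFinM lee_fin /c => h; rewrite mulrC -ler_pdivrMr//.
apply: le_trans h; rewrite le_eqVlt; apply/orP; left; apply/eqP; field.
by rewrite gt_eqF.
Qed.

(* Cauchy-Schwarz with weight [w], then Tonelli. *)
Lemma weighted_second_moment : (forall z, \int[P]_o (f o z ^+ 2)%:E <= (w z ^+ 2)%:E)%E ->
  (\int[P]_o ((\int[m]_z f o z) ^+ 2)%:E <= (W ^+ 2)%:E)%E.
Proof.
move=> Ef.
pose g (p : Omega * T) := (f p.1 p.2 ^+ 2 / w p.2)%:E.
have g0 p : (0 <= g p)%E by rewrite lee_fin divr_ge0 ?sqr_ge0// ltW.
have mg : measurable_fun setT g.
  apply/measurable_EFinP; apply: measurable_funM; first exact: measurable_funX.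
  exact: (measurableT_comp mwV measurable_snd).
have mG : measurable_fun setT (fun o => \int[m]_z g (o, z))%E.
  exact: measurable_fun_fubini_tonelli_F.
have G0 o : (0 <= \int[m]_z g (o, z))%E by apply: integral_ge0 => z _; exact: g0.
apply: (@le_trans _ _ (\int[P]_o (W%:E * \int[m]_z g (o, z)))%E).
  apply: ge0_le_integral => //.
  - by move=> o _; rewrite lee_fin sqr_ge0.
  - by apply/measurable_EFinP; apply: measurable_funX; exact: measurable_rint.
  - exact: measurable_funeM.
rewrite ge0_integralZl//; last by rewrite lee_fin ltW.
rewrite expr2 EFinM; apply: lee_wpmul2l; first by rewrite lee_fin ltW.
rewrite (fubini_tonelli g mg g0) -wW.2 EFin_rint//; last exact: wW.1.
apply: ge0_le_integral => //.
- by move=> z _; apply: integral_ge0 => o _; exact: g0.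
- exact: measurable_fun_fubini_tonelli_G.
- exact/measurable_EFinP.
move=> z _; rewrite /g /=.
under eq_integral => o _ do rewrite mulrC EFinM.
rewrite ge0_integralZl//.
- apply: (le_trans (lee_wpmul2l _ (Ef z))); first by rewrite lee_fin invr_ge0 ltW.
  by rewrite -EFinM lee_fin expr2 mulKf// gt_eqF.
- apply/measurable_EFinP; apply: measurable_funX.
  exact: (measurableT_comp mf (pair2_measurable z)).
- by move=> o _; rewrite lee_fin sqr_ge0.
- by rewrite lee_fin invr_ge0 ltW.
Qed.

End weighted_cauchy_schwarz.

Section plane_measure.
Context {R : realType}.
Local Notation mu := (@lebesgue_measure R).

(* An alias, because the sigma-finite instance of product measures of the library
   is not found by unification. *)
Definition plane_measure : set (measurableTypeR R * measurableTypeR R) -> \bar R := (mu \x mu)%E.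

HB.instance Definition _ := Measure.on plane_measure.

Let plane_measure_sigma_finite : sigma_finite setT plane_measure.
Proof.
pose I n : set (measurableTypeR R) := `[- n%:R, n%:R]%classic.
exists (fun n => I n `*` I n) => [|n].
  apply/seteqP; split => // -[x y] _.
  have [a b] : `|x| <= (Num.trunc `|x|).+1%:R /\ `|y| <= (Num.trunc `|y|).+1%:R.
    by split; apply: ltW; exact: truncnS_gt.
  exists (maxn (Num.trunc `|x|).+1 (Num.trunc `|y|).+1) => //; split; rewrite /I/= in_itv/= -ler_norml.
    by apply: le_trans a _; rewrite ler_nat leq_maxl.
  by apply: le_trans b _; rewrite ler_nat leq_maxr.
have mI : measurable (I n) by exact: measurable_itv.
have fI : (mu (I n) < +oo)%E.
  have -> : mu (I n) = lebesgue_measure (`[- n%:R, n%:R]%classic : set R) by [].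
  by rewrite lebesgue_measure_itv/=; case: ifP => // _; rewrite -EFinB ltry.
split; first exact: measurableX.
by rewrite /plane_measure product_measure1E// lte_mul_pinfty// ge0_fin_numE.
Qed.

HB.instance Definition _ := Measure_isSigmaFinite.Build _ _ _ plane_measure
  plane_measure_sigma_finite.

End plane_measure.

(** * The mean-square error *)

Section weight_constant.
Context {R : realType}.
Implicit Types (r c : R).

Lemma poly8_expR c : 0 < c ->
  exists2 K : R, 0 <= K & forall r, 0 <= r -> (1 + r) ^+ 8 * expR (- (c * r)) <= K.
Proof.
move=> c0; exists (8`!%:R * (c ^+ 8)^-1 * expR c) => [|r r0].
  by rewrite mulr_ge0 ?expR_ge0// mulr_ge0// invr_ge0 exprn_ge0// ltW.
have r1 : 0 <= 1 + r by rewrite addr_ge0.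
have := expn_le_expR 8 (mulr_ge0 (ltW c0) r1).
move: (8`!%:R : R) => e8; rewrite exprMn mulrDr mulr1 expRD => h.
have c8 : 0 < c ^+ 8 by rewrite exprn_gt0.
move: (c ^+ 8) ((1 + r) ^+ 8) c8 h => C X C0 h.
rewrite expRN ler_pdivrMr ?expR_gt0//.
rewrite [leRHS](_ : _ = e8 * (expR c * expR (c * r)) / C); last by ring.
by rewrite ler_pdivlMr// mulrC.
Qed.

Lemma mode_size_sqr (mux muy : R) (z : R * R) :
  mode_size mux muy z ^+ 2 <= 3 * (1 + `|mux| + `|muy|) ^+ 2 * (1 + (z.1 ^+ 2 + z.2 ^+ 2)).
Proof.
rewrite /mode_size exprMn [leRHS]mulrAC mulrC ler_wpM2r ?sqr_ge0//.
rewrite -(real_normK (num_real z.1)) -(real_normK (num_real z.2)).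
have := sqr_ge0 (1 - `|z.1|); have := sqr_ge0 (1 - `|z.2|); have := sqr_ge0 (`|z.1| - `|z.2|).
by lra.
Qed.

(** Half of the exponent [2 c r] absorbs the polynomial, since [mode_size ^+ 16] is at most a
    constant times [(1 + r) ^+ 8]. The two estimates serve inside and outside the box. [K0] is
    squared because [error_weight] bounds a root mean square; [K0 >= 1] gives [K0 <= K0 ^+ 2]. *)
Lemma weight_constant (mux muy K c : R) : 0 <= K -> 0 < c ->
  exists2 K0 : R, 1 <= K0 & forall z : R * R, let r := z.1 ^+ 2 + z.2 ^+ 2 in
    K * mode_size mux muy z ^+ 16 * expR (- (2 * c * r)) <= K0 ^+ 2 * expR (- (c * r)) /\
    r ^+ 2 * expR (- (2 * c * r)) <= K0 ^+ 2 * expR (- (c * r)).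
Proof.
move=> K_ge0 c0; have [B B0 hB] := poly8_expR c0.
pose m0 := 3 * (1 + `|mux| + `|muy|) ^+ 2.
have m00 : 0 <= m0 by rewrite mulr_ge0// sqr_ge0.
have m80 : 0 <= m0 ^+ 8 by rewrite exprn_ge0.
have KmB : 0 <= K * m0 ^+ 8 * B by apply: mulr_ge0 B0; exact: mulr_ge0.
exists (1 + K * m0 ^+ 8 * B + B) => [|z r]; first by rewrite -addrA lerDl addr_ge0.
set K0 := 1 + _ + _.
have K01 : K0 <= K0 ^+ 2 by rewrite expr2 ler_peMr// /K0 ?addr_ge0// -addrA lerDl addr_ge0.
have r0 : 0 <= r by rewrite addr_ge0 ?sqr_ge0.
have e2 : expR (- (2 * c * r)) = expR (- (c * r)) * expR (- (c * r)).
  by rewrite -expRD; congr expR; ring.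
have r1 : 0 <= 1 + r by rewrite addr_ge0.
have M16 : mode_size mux muy z ^+ 16 <= m0 ^+ 8 * (1 + r) ^+ 8.
  rewrite -exprMn -[16%N]/(2 * 8)%N exprM lerXn2r ?nnegrE ?sqr_ge0//; first exact: mulr_ge0.
  exact: mode_size_sqr.
have r18 : r ^+ 2 <= (1 + r) ^+ 8.
  apply: (@le_trans _ _ ((1 + r) ^+ 2)); first by rewrite lerXn2r ?nnegrE// lerDr.
  by rewrite ler_weXn2l// lerDl.
have := hB r r0; have := expR_ge0 (- (c * r)).
have K0le : K * m0 ^+ 8 * B <= K0 ^+ 2 by apply: le_trans K01; rewrite /K0; lra.
have B0le : B <= K0 ^+ 2 by apply: le_trans K01; rewrite /K0; lra.
rewrite e2; move: M16 r18 m80 K0le B0le.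
move: (mode_size mux muy z ^+ 16) (m0 ^+ 8) ((1 + r) ^+ 8) (r ^+ 2) (K0 ^+ 2) (expR (- (c * r))).
move=> M16 m8 r8 r2 K2 e M16le r2le m8ge K2le B2le e0 reB; split.
- rewrite [leLHS]mulrA ler_wpM2r//; apply: le_trans K2le.
  rewrite -[leLHS]mulrA -[leRHS]mulrA ler_wpM2l//.
  apply: (@le_trans _ _ (m8 * (r8 * e))); first by rewrite mulrA ler_wpM2r.
  exact: ler_wpM2l.
- rewrite [leLHS]mulrA ler_wpM2r//; apply: le_trans B2le; apply: le_trans reB.
  by rewrite ler_wpM2r.
Qed.

End weight_constant.

(** * Mean-square error at a grid point from the error at each frequency *)

Section fourier_error.
Context {d : measure_display} {Omega : measurableType d} {R : realType}.
Variable P : probability Omega R.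
Variable F : R -> set (set Omega).
Variables (Mx My : R -> Omega -> R) (mux muy rhox rhoy rhoxy : R).
Hypotheses (hF : filtration F) (bX : brownian_motion P F Mx) (bY : brownian_motion P F My).
Hypotheses (bXY : bracket_rate P F Mx My rhoxy) (rho1 : -1 <= rhoxy <= 1).
Hypotheses (rx : 0 <= rhox < 1) (ry : 0 <= rhoy < 1).
Variable nu : R.
Hypotheses (rxn : rhox <= nu) (ryn : rhoy <= nu) (nu1 : nu < 1).
Hypotheses
  (cx : 2 * rhox ^+ 2 * (1 + 2 * `|rhoxy|) <= nu)
  (cy : 2 * rhoy ^+ 2 * (1 + 2 * `|rhoxy|) <= nu)
  (cxy : 2 * rhox * rhoy * (3 * rhoxy ^+ 2 + 2 * `|rhoxy| + 1) <= nu).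
Variables (hx hy k T : R) (N : nat) (i0 j0 i j : int) (x0 y0 : R).
Hypotheses (hx0 : 0 < hx) (hy0 : 0 < hy) (k0 : 0 < k <= 1) (T0 : 0 < T) (N0 : (0 < N)%N).
Hypotheses (NkT : N%:R * k = T) (i0x : i0%:~R * hx = x0) (j0y : j0%:~R * hy = y0).
Local Notation mu := (@lebesgue_measure R).
Local Notation mu2 := (mu \x mu)%E.
Local Notation plane := (measurableTypeR R * measurableTypeR R)%type.

Let kp : 0 < k. Proof. by case/andP: k0. Qed.
Let rx0 : 0 <= rhox. Proof. by case/andP: rx. Qed.
Let ry0 : 0 <= rhoy. Proof. by case/andP: ry. Qed.
Let rx1 : rhox < 1. Proof. by case/andP: rx. Qed.
Let ry1 : rhoy < 1. Proof. by case/andP: ry. Qed.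

Let numeric w (z : R * R) := grid_integrand mux muy rhox rhoy hx hy k i0 j0
  (fun m => dB k Mx m w) (fun m => dB k My m w) N z i j.
Let exact w (z : R * R) := grid_mode hx hy i0 j0 z
  (exact_re mux muy rhox rhoy z T (Mx T w) (My T w), exact_im mux muy rhox rhoy z T (Mx T w) (My T w)) i j.

Definition fourier_error (w : Omega) (z : R * R) : R := numeric w z - exact w z.

Let f : Omega -> plane -> R := fourier_error.

Let mB M t : brownian_motion P F M -> 0 <= t -> measurable_fun setT (M t).
Proof.
move=> bM t0; have [sF Fm] := hF.1 t t0.
exact: (tame_measurable (conj sF Fm) (tame_brownian hF bM t0 (lexx t))).
Qed.

Let mdB M m : brownian_motion P F M -> measurable_fun setT (dB k M m).
Proof. by move=> bM; apply: measurable_funB; apply: mB => //; rewrite mulr_ge0// ltW. Qed.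

Let m1 (g : Omega -> R) : measurable_fun setT g -> measurable_fun setT (fun p : Omega * plane => g p.1).
Proof. by move=> mg; exact: (measurableT_comp mg measurable_fst). Qed.
Let mz1 : measurable_fun setT (fun p : Omega * plane => p.2.1).
Proof. exact: (measurableT_comp measurable_fst measurable_snd). Qed.
Let mz2 : measurable_fun setT (fun p : Omega * plane => p.2.2).
Proof. exact: (measurableT_comp measurable_snd measurable_snd). Qed.
Let mcos (g : Omega * plane -> R) : measurable_fun setT g -> measurable_fun setT (fun p => cos (g p)).
Proof. exact: (measurableT_comp (continuous_measurable_fun (@continuous_cos R))). Qed.
Let msin (g : Omega * plane -> R) : measurable_fun setT g -> measurable_fun setT (fun p => sin (g p)).
Proof. exact: (measurableT_comp (continuous_measurable_fun (@continuous_sin R))). Qed.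

Let mf : measurable_fun setT (fun p : Omega * plane => f p.1 p.2).
Proof.
have mphi : measurable_fun setT (fun p : Omega * plane => grid_phase hx hy i0 j0 p.2 i j).
  by apply: measurable_funD; apply: measurable_funM.
have [ma1 ma2] := @measurable_amp R _ (Omega * plane)%type mux muy rhox rhoy hx hy k
  hx0 hy0 (ltW kp) snd (fun m p => dB k Mx m p.1) (fun m p => dB k My m p.1) mz1 mz2
  (fun m => m1 (mdB m bX)) (fun m => m1 (mdB m bY)) N.
have mX := m1 (mB bX (ltW T0)); have mY := m1 (mB bY (ltW T0)).
have mpsi : measurable_fun setT (fun p : Omega * plane =>
    phase mux muy rhox rhoy p.2 T (Mx T p.1) (My T p.1)).
  apply: measurable_funD; apply: measurable_funM => //; apply: measurable_funD => //;
    exact: measurable_funM.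
have mdec : measurable_fun setT (fun p : Omega * plane => expR (- (T * decay rhox rhoy p.2))).
  apply: measurableT_comp; first exact: measurable_expR.
  apply: measurableT_comp => //; apply: measurable_funM => //; apply: measurable_funM => //.
  by apply: measurable_funD; apply: measurable_funM => //; exact: measurable_funX.
have mI (h : R) (g : Omega * plane -> R) : measurable_fun setT g ->
    measurable_fun setT (fun p => \1_(`[- (pi / h), pi / h]) (g p) : R).
  move=> mg; exact: (measurableT_comp (measurable_indic (measurable_itv _)) mg).
apply: measurable_funB.
  apply: measurable_funM; first by apply: measurable_funM; exact: mI.
  by apply: measurable_funB; apply: measurable_funM => //; [exact: mcos|exact: msin].
apply: measurable_funB; apply: measurable_funM.
- exact: mcos.
- by apply: measurable_funM => //; exact: mcos.
- exact: msin.
- by apply: measurable_funM => //; apply: measurableT_comp => //; exact: msin.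
Qed.

Let has_rint_exact w := has_rint_exact_mode hF bX mux muy (Mx T w) (My T w) i j T0 rx1 ry1 i0x j0y.

Lemma fourier_error_rint w : has_rint mu2 (f w)
  (4 * pi ^+ 2 * (fourier_solution mux muy rhox rhoy hx hy k i0 j0
      (fun m => dB k Mx m w) (fun m => dB k My m w) N i j -
    spde_solution x0 y0 mux muy rhox rhoy T (Mx T w) (My T w) (i%:~R * hx) (j%:~R * hy))).
Proof.
have ni := grid_integrand_rintegrable mux muy i0 j0 hx0 hy0 kp rx0 ry0
  (fun m => dB k Mx m w) (fun m => dB k My m w) N i j.
apply: eq_has_rint (has_rintB (has_rintP ni) (has_rint_exact w)) => //.
rewrite mulrBr; congr (_ - _); rewrite /fourier_solution mulVKf// gt_eqF//.
by rewrite mulr_gt0// exprn_gt0// pi_gt0.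
Qed.

Let uu := k + (hx ^+ 2 + hy ^+ 2).
Variables (K0 c : R).
Hypotheses (c0 : 0 < c) (K01 : 1 <= K0) (cT : mode_rate nu * T = 2 * c).
Hypothesis K0E : forall z : R * R, let r := z.1 ^+ 2 + z.2 ^+ 2 in
    mode_cst nu T * mode_size mux muy z ^+ 16 * expR (- (2 * c * r)) <= K0 ^+ 2 * expR (- (c * r)) /\
    r ^+ 2 * expR (- (2 * c * r)) <= K0 ^+ 2 * expR (- (c * r)).

Let uu0 : 0 < uu. Proof. by rewrite ltr_wpDr// addr_ge0 ?sqr_ge0. Qed.
Let K00 : 0 < K0. Proof. exact: lt_le_trans K01. Qed.

(** The Gaussian term keeps the weight positive on the whole plane, as division by it requires; the
    indicator carries the stiff frequencies, which show no decay. *)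
Definition error_weight (z : R * R) : R :=
  K0 * uu * (expR (- (c / 2 * z.1 ^+ 2)) * expR (- (c / 2 * z.2 ^+ 2))) +
  2 * mode_theta nu ^+ N * box_indic hx hy z.

Let w : plane -> R := error_weight.

Let th0 : 0 <= mode_theta nu ^+ N.
Proof.
have nu0 : 0 <= nu by apply: le_trans rxn.
by rewrite exprn_ge0// /mode_theta; lra.
Qed.

Let w_gt0 z : 0 < w z.
Proof.
have /andP[b0 _] := box_indic01 hx hy z.
rewrite ltr_wpDr//; first by rewrite mulr_ge0// mulr_ge0.
by rewrite mulr_gt0 ?mulr_gt0 ?expR_gt0.
Qed.

Definition error_mass : R :=
  K0 * uu * (pi / (c / 2)) + 2 * mode_theta nu ^+ N * (2 * (pi / hx) * (2 * (pi / hy))).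

Let c20 : 0 < c / 2. Proof. exact: divr_gt0. Qed.

Lemma has_rint_error_weight : has_rint mu2 w error_mass.
Proof.
have H := has_rintD (has_rintZ (K0 * uu) (has_rint_prod (has_rint_gauss c20) (has_rint_gauss c20)))
  (has_rintZ (2 * mode_theta nu ^+ N) (has_rint_box_indic hx0 hy0)).
apply: eq_has_rint H => //.
by rewrite -expr2 sqr_sqrtr// divr_ge0 ?(ltW c20)// pi_ge0.
Qed.

Lemma error_mass_gt0 : 0 < error_mass.
Proof.
have p0 := @pi_gt0 R.
have px : 0 < pi / hx by rewrite divr_gt0.
have py : 0 < pi / hy by rewrite divr_gt0.
apply: ltr_wpDr; last by apply: mulr_gt0; [exact: mulr_gt0|exact: divr_gt0].
apply: mulr_ge0; first exact: mulr_ge0.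
by apply: mulr_ge0; apply: mulr_ge0 => //; exact: ltW.
Qed.

Let M z w' := mode Mx My mux muy rhox rhoy hx hy k z N w'.
Let Q1 z := exact_mode_re Mx My mux muy rhox rhoy k z N.
Let Q2 z := exact_mode_im Mx My mux muy rhox rhoy k z N.

(** [f] is the real part of [exp (i gp)] times the difference of the truncated numerical mode and
    the exact one, so its square is at most the squared modulus of that difference. *)
Let f_sqr o z : f o z ^+ 2 <=
  (box_indic hx hy z * (M z o).1 - Q1 z o) ^+ 2 + (box_indic hx hy z * (M z o).2 - Q2 z o) ^+ 2.
Proof.
rewrite /Q1 /Q2 /exact_mode_re /exact_mode_im NkT.
rewrite /f /fourier_error /numeric /exact /grid_integrand /grid_mode -[amp _ _ _ _ _ _ _ _ _ _ _]/(M z o) /=.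
set b := box_indic _ _ _; set gp := grid_phase _ _ _ _ _ _ _.
set q1 := exact_re _ _ _ _ _ _ _ _; set q2 := exact_im _ _ _ _ _ _ _ _.
set p1 := (M z o).1; set p2 := (M z o).2.
have -> : (b * p1 - q1) ^+ 2 + (b * p2 - q2) ^+ 2 =
    (cos gp ^+ 2 + sin gp ^+ 2) * ((b * p1 - q1) ^+ 2 + (b * p2 - q2) ^+ 2).
  by rewrite cos2Dsin2 mul1r.
have := sqr_ge0 (sin gp * (b * p1 - q1) + cos gp * (b * p2 - q2)).
by move: (cos gp) (sin gp) => C S; nra.
Qed.

(** Outside the box some [h |z|] exceeds [pi], hence [1], and [uu] contains both squared mesh
    sizes. *)
Let box_cases z : (box_indic hx hy z = 1 /\ `|z.1| <= pi / hx /\ `|z.2| <= pi / hy) \/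
  (box_indic hx hy z = 0 /\ 1 <= uu * (z.1 ^+ 2 + z.2 ^+ 2)).
Proof.
have out (h x : R) : 0 < h -> ~ (`|x| <= pi / h) -> 1 <= h ^+ 2 * x ^+ 2.
  move=> h0 /negP; rewrite -ltNge ltr_pdivrMr// => xh.
  rewrite -exprMn -(real_normK (num_real (h * x))) normrM (gtr0_norm h0) mulrC.
  by rewrite -(expr1n _ 2) lerXn2r ?nnegrE ?mulr_ge0 ?(ltW h0)// ltW// (lt_trans _ xh)// (lt_le_trans _ (pi_ge2 R))// ltr1n.
have s1 := sqr_ge0 z.1; have s2 := sqr_ge0 z.2; have hx2 := sqr_ge0 hx; have hy2 := sqr_ge0 hy.
have bE : box_indic hx hy z = (`|z.1| <= pi / hx)%R%:R * (`|z.2| <= pi / hy)%R%:R.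
  by rewrite /box_indic !indicE !mem_setE !in_itv/= !ler_norml.
have m1' := mulr_ge0 (ltW kp) (addr_ge0 s1 s2); have m2' := mulr_ge0 hx2 s2.
have m3' := mulr_ge0 hy2 s1; have m4' := mulr_ge0 hx2 s1; have m5' := mulr_ge0 hy2 s2.
rewrite bE.
have [zx|/negP zx] := boolP (`|z.1| <= pi / hx); last first.
  by right; rewrite mul0r; split => //; have := out _ _ hx0 zx; rewrite /uu; lra.
have [zy|/negP zy] := boolP (`|z.2| <= pi / hy); last first.
  by right; rewrite mulr0; split => //; have := out _ _ hy0 zy; rewrite /uu; lra.
by left; rewrite mulr1.
Qed.

Let exp_split z : expR (- (c * (z.1 ^+ 2 + z.2 ^+ 2))) =
  (expR (- (c / 2 * z.1 ^+ 2)) * expR (- (c / 2 * z.2 ^+ 2))) ^+ 2.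
Proof.
by rewrite -expRD -expRM_natl; congr expR; field.
Qed.

(** Inside the box, [mode_error] gives a sum of two squares, which is below the square of the sum of
    the two nonnegative terms of the weight. Outside, the exact mode is alone, and the factor
    [(uu * r) ^+ 2 >= 1] turns its decay into a bound of second order. *)
Lemma fourier_error_second_moment z : (\int[P]_o (f o z ^+ 2)%:E <= (w z ^+ 2)%:E)%E.
Proof.
have mfz : measurable_fun setT (fun o => f o z) by exact: (measurableT_comp mf (pair2_measurable z)).
have e0 : 0 <= expR (- (c / 2 * z.1 ^+ 2)) * expR (- (c / 2 * z.2 ^+ 2)).
  by rewrite mulr_ge0 ?expR_ge0.
have [E1 E2] := K0E z; rewrite exp_split in E1 E2.
have kuu := ltW uu0; have kk0 := ltW K00.
have [[b1 [zx zy]]|[b0 zout]] := box_cases z.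
- have := mode_error mux muy hF bX bY bXY rho1 rx ry hx0 hy0 k0 rxn ryn nu1 cx cy cxy N0 zx zy.
  rewrite NkT -/uu cT -/(Q1 z) -/(Q2 z) => le1.
  have [t1 t2] := tame_mode mux muy rhox rhoy hF bX bY hx hy k0 z N.
  have [t3 t4] := tame_exact_mode mux muy rhox rhoy hF bX bY k0 z N.
  have sF : subsigma (F (N%:R * k)) by apply: hF.1; rewrite NkT ltW.
  have tU : tame P (F (N%:R * k)) (fun o => ((M z o).1 - Q1 z o) ^+ 2 + ((M z o).2 - Q2 z o) ^+ 2).
    by rewrite /M /Q1 /Q2; tame_tac.
  have iU := tame_integrable sF tU.
  apply: (@le_trans _ _ (\int[P]_o (((M z o).1 - Q1 z o) ^+ 2 + ((M z o).2 - Q2 z o) ^+ 2)%:E)%E).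
    apply: ge0_le_integral => //.
    + by move=> o _; rewrite lee_fin sqr_ge0.
    + by apply/measurable_EFinP; exact: measurable_funX.
    + exact: (measurable_int _ iU).
    + by move=> o _; rewrite lee_fin; apply: le_trans (f_sqr o z) _; rewrite b1 !mul1r.
  rewrite -EFin_rint// lee_fin; apply: le_trans le1 _.
  rewrite /w /error_weight b1 mulr1 -muln2 exprM.
  have h1 := ler_wpM2l (sqr_ge0 uu) E1.
  have h2 := mulr_ge0 (mulr_ge0 kk0 kuu) (mulr_ge0 e0 th0).
  move: h1 h2.
  move: (mode_size mux muy z ^+ 16) (mode_theta nu ^+ N) (expR (- (2 * c * (z.1 ^+ 2 + z.2 ^+ 2)))).
  move: (expR (- (c / 2 * z.1 ^+ 2)) * expR (- (c / 2 * z.2 ^+ 2))) uu K0 (mode_cst nu T).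
  by move=> e u K mc M16 t E h1 h2; lra.
- apply: (@le_trans _ _ (\int[P]_o (expR (- (2 * c * (z.1 ^+ 2 + z.2 ^+ 2))))%:E)%E).
    apply: ge0_le_integral => //.
    + by move=> o _; rewrite lee_fin sqr_ge0.
    + by apply/measurable_EFinP; exact: measurable_funX.
    + move=> o _; rewrite lee_fin; apply: le_trans (f_sqr o z) _; rewrite b0 !mul0r !sub0r !sqrrN.
      by rewrite -cT -NkT; exact: exact_mode_decay.
  have PT : (P : {measure set Omega -> \bar R}) setT = 1%E by exact: probability_setT.
  rewrite integral_cst// PT mule1 lee_fin /w /error_weight b0 mulr0 addr0.
  set r := _ + _ in zout E2 *.
  have r1 : 1 <= (uu * r) ^+ 2 by rewrite -(expr1n _ 2) lerXn2r ?nnegrE// (le_trans ler01).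
  apply: (@le_trans _ _ ((uu * r) ^+ 2 * expR (- (2 * c * r)))); first by rewrite ler_peMl ?expR_ge0.
  have := ler_wpM2l (sqr_ge0 uu) E2.
  by move: (expR (- (c / 2 * z.1 ^+ 2)) * expR (- (c / 2 * z.2 ^+ 2))) => e h; lra.
Qed.

Lemma fourier_solution_error :
  (\int[P]_o ((fourier_solution mux muy rhox rhoy hx hy k i0 j0
      (fun m => dB k Mx m o) (fun m => dB k My m o) N i j -
    spde_solution x0 y0 mux muy rhox rhoy T (Mx T o) (My T o) (i%:~R * hx) (j%:~R * hy)) ^+ 2)%:E
   <= ((error_mass / (4 * pi ^+ 2)) ^+ 2)%:E)%E.
Proof.
have p0 : 0 < 4 * pi ^+ 2 :> R by rewrite mulr_gt0// exprn_gt0// pi_gt0.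
have fi o : rintegrable mu2 setT (f o) := (fourier_error_rint o).1.
have := @weighted_second_moment _ _ Omega plane R P plane_measure f w error_mass mf fi w_gt0 has_rint_error_weight error_mass_gt0
  fourier_error_second_moment.
under eq_integral => o _ do rewrite (fourier_error_rint o).2 exprMn EFinM.
rewrite ge0_integralZl//; last 3 first.
- apply/measurable_EFinP; apply: measurable_funX.
  have -> : (fun o => fourier_solution mux muy rhox rhoy hx hy k i0 j0
      (fun m => dB k Mx m o) (fun m => dB k My m o) N i j -
    spde_solution x0 y0 mux muy rhox rhoy T (Mx T o) (My T o) (i%:~R * hx) (j%:~R * hy)) =
    (fun o => (4 * pi ^+ 2)^-1 * \int[mu2]_z f o z).
    by apply/funext => o; rewrite (fourier_error_rint o).2 mulKf// gt_eqF.
  apply: measurable_funM => //; exact: (@measurable_rint _ _ Omega plane R plane_measure f mf).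
- by move=> o _; rewrite lee_fin sqr_ge0.
- by rewrite lee_fin sqr_ge0.
have q0 : 0 < (4 * pi ^+ 2) ^+ 2 :> R by rewrite exprn_gt0.
move=> h; rewrite -(@lee_pmul2l _ ((4 * pi ^+ 2) ^+ 2)%:E)// ?lte_fin//.
by rewrite -EFinM -exprMn [_ * (error_mass / _)]mulrC divfK// gt_eqF.
Qed.

End fourier_error.

Theorem corollary2p1 (R : realType) (d : measure_display)
  (Omega : measurableType d) (P : probability Omega R)
  (F : R -> set (set Omega)) (Mx My : R -> Omega -> R)
  (T x0 y0 mux muy rhox rhoy rhoxy : R)
  (hF : filtration F)
  (hMx : brownian_motion P F Mx) (hMy : brownian_motion P F My)
  (hMxy : bracket_rate P F Mx My rhoxy)
  (hT : 0 < T)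
  (hrhox : 0 <= rhox < 1) (hrhoy : 0 <= rhoy < 1) (hrhoxy : -1 <= rhoxy <= 1)
  (hx_cond : 2 * rhox ^+ 2 * (1 + 2 * `|rhoxy|) < 1)
  (hy_cond : 2 * rhoy ^+ 2 * (1 + 2 * `|rhoxy|) < 1)
  (hxy_cond : 2 * rhox * rhoy * (3 * rhoxy ^+ 2 + 2 * `|rhoxy| + 1) < 1) :
  exists theta : R, 0 < theta < 1 /\
  forall beta C0 : R, 0 < beta -> 0 < C0 ->
  exists C delta : R, 0 < delta /\
  forall (hx hy k : R) (N : nat) (i0 j0 : int),
    0 < hx < delta -> 0 < hy < delta -> 0 < k < delta ->
    (0 < N)%N -> k = T / N%:R ->
    i0%:~R = x0 / hx -> j0%:~R = y0 / hy ->
    theta `^ (T / k) <= 2 `^ (- C0) * Num.min hx hy `^ (4 + beta) ->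
  forall V : nat -> Omega -> grid R,
    (forall w, milstein_scheme mux muy rhox rhoy hx hy k i0 j0 N
                 (normalised_increment k Mx w) (normalised_increment k My w)
                 (fun n => V n w)) ->
  forall i j : int,
    (sqrte ('E_P[fun w => (
       `|V N w i j - spde_solution x0 y0 mux muy rhox rhoy
           T (Mx T w) (My T w) (i%:~R * hx) (j%:~R * hy)| ^+ 2)%R])
     <= (C * (hx ^+ 2 + hy ^+ 2 + k))%:E)%E.
Proof.
have /andP[rx0 rx1] := hrhox; have /andP[ry0 ry1] := hrhoy.
(* A single margin [1 - nu] for all five strict inequalities; [theta] and the decay rate depend on
   it alone. *)
pose nu := Num.max rhox (Num.max rhoy (Num.max (2 * rhox ^+ 2 * (1 + 2 * `|rhoxy|))
  (Num.max (2 * rhoy ^+ 2 * (1 + 2 * `|rhoxy|))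
    (2 * rhox * rhoy * (3 * rhoxy ^+ 2 + 2 * `|rhoxy| + 1))))).
have nu1 : nu < 1 by rewrite /nu !gt_max rx1 ry1 hx_cond hy_cond hxy_cond.
have rxn : rhox <= nu by rewrite /nu le_max lexx.
have ryn : rhoy <= nu by rewrite /nu !le_max lexx !orbT.
have cx : 2 * rhox ^+ 2 * (1 + 2 * `|rhoxy|) <= nu by rewrite /nu !le_max lexx !orbT.
have cy : 2 * rhoy ^+ 2 * (1 + 2 * `|rhoxy|) <= nu by rewrite /nu !le_max lexx !orbT.
have cxy : 2 * rhox * rhoy * (3 * rhoxy ^+ 2 + 2 * `|rhoxy| + 1) <= nu.
  by rewrite /nu !le_max lexx !orbT.
have nu0 : 0 <= nu by apply: le_trans rxn.
move: nu nu0 nu1 rxn ryn cx cy cxy => nu nu0 nu1 rxn ryn cx cy cxy.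
have th0 : 0 < mode_theta nu by rewrite /mode_theta; lra.
have th1 : mode_theta nu < 1 by rewrite /mode_theta; lra.
exists (mode_theta nu); split; first by rewrite th0.
move=> beta C0 beta0 C00.
pose c := mode_rate nu * T / 2.
have c0 : 0 < c by rewrite /c /mode_rate !mulr_gt0 ?subr_gt0.
have cT : mode_rate nu * T = 2 * c by rewrite /c; field.
(* The absolute value provides nonnegativity at once; [K0E'] removes it below. *)
have [K0 K01 K0E] := weight_constant mux muy (normr_ge0 (mode_cst nu T)) c0.
(* The first term is the Gaussian mass [K0 * pi / (c / 2)] over [4 pi^2]; the [2] is the stiff
   contribution. The threshold ensures [k <= 1], [h <= 1] and the diagonal dominance conditions
   [|mu| h <= 1]. *)
exists (K0 / (2 * pi * c) + 2), (1 + `|mux| + `|muy|)^-1.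
have am := normr_ge0 mux; have bm := normr_ge0 muy.
have S1 : 1 <= 1 + `|mux| + `|muy| by lra.
have S0 : 0 < 1 + `|mux| + `|muy| by lra.
split; first by rewrite invr_gt0.
move=> hx hy k N i0 j0 /andP[hx0 hxd] /andP[hy0 hyd] /andP[kp kd] N0 kE i0E j0E hth V hV i j.
have small h : 0 < h -> h < (1 + `|mux| + `|muy|)^-1 ->
    [/\ h <= 1, `|mux| * h <= 1 & `|muy| * h <= 1].
  move=> h0; rewrite -div1r ltr_pdivlMr// mulrC => /ltW hS.
  have h0' := ltW h0.
  by split; apply: le_trans hS; [rewrite ler_peMl|rewrite ler_wpM2r//; lra..].
have [hx1 mux1 _] := small hx hx0 hxd; have [hy1 _ muy1] := small hy hy0 hyd.
have [k1 _ _] := small k kp kd.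
have k01 : 0 < k <= 1 by rewrite kp.
have Nn : N%:R != 0 :> R by rewrite pnatr_eq0 -lt0n.
have NkT : N%:R * k = T by rewrite kE mulrC divfK.
have i0x : i0%:~R * hx = x0 by rewrite i0E divfK// gt_eqF.
have j0y : j0%:~R * hy = y0 by rewrite j0E divfK// gt_eqF.
have VE w : V N w i j = fourier_solution mux muy rhox rhoy hx hy k i0 j0
    (fun m => dB k Mx m w) (fun m => dB k My m w) N i j.
  have sk0 : Num.sqrt k != 0 by rewrite gt_eqF// sqrtr_gt0.
  have incr M (m : nat) : dB k M m w = Num.sqrt k * normalised_increment k M w m.
    by rewrite /normalised_increment mulrCA mulfV// mulr1.
  by rewrite (milstein_scheme_fourier hx0 hy0 kp rx0 ry0 mux1 muy1 (incr Mx) (incr My) (hV w) (leqnn N)).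
have K0E' (z : R * R) : let r := z.1 ^+ 2 + z.2 ^+ 2 in
    mode_cst nu T * mode_size mux muy z ^+ 16 * expR (- (2 * c * r)) <= K0 ^+ 2 * expR (- (c * r)) /\
    r ^+ 2 * expR (- (2 * c * r)) <= K0 ^+ 2 * expR (- (c * r)).
  have [e1 e2] := K0E z; split => //; apply: le_trans e1.
  rewrite ler_wpM2r ?expR_ge0// ler_wpM2r ?ler_norm//.
  by rewrite -[16%N]/(2 * 8)%N exprM exprn_ge0// sqr_ge0.
have E2 := fourier_solution_error hF hMx hMy hMxy hrhoxy hrhox hrhoy rxn ryn nu1 cx cy cxy
  i j hx0 hy0 k01 hT N0 NkT i0x j0y c0 K01 cT K0E'.
set W := error_mass _ _ _ _ _ _ _ in E2.
have W0 : 0 < W := error_mass_gt0 hrhox rxn N hx0 hy0 k01 c0 K01.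
have p0 := @pi_gt0 R.
(* Since [h <= 1], the assumption gives [theta^N <= h^4]; two of the four powers cancel the area
   factor [1 / (hx hy)], the others leave [hx^2]. *)
have thN : mode_theta nu ^+ N <= hx ^+ 2 * (hx * hy).
  set h := Num.min hx hy in hth.
  have h0 : 0 < h by rewrite lt_min hx0.
  have hhx : h <= hx by rewrite ge_min lexx.
  have hhy : h <= hy by rewrite ge_min lexx orbT.
  have Tk : T / k = N%:R by rewrite -NkT mulfK// gt_eqF.
  rewrite Tk powR_mulrn ?(ltW th0)// in hth; apply: le_trans hth _.
  have e2 : 2 `^ (- C0) <= 1 :> R.
    by apply: (@le_trans _ _ (2 `^ 0)); [rewrite ler_powR ?ler1n// oppr_le0 ltW|rewrite powRr0].
  have e4 : h `^ (4 + beta) <= h ^+ 4.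
    rewrite -(powR_mulrn _ (ltW h0)) ger_powR ?h0 ?(le_trans hhx)//.
    by rewrite lerDl ltW.
  apply: (@le_trans _ _ (1 * h ^+ 4)); first by apply: ler_pM => //; exact: powR_ge0.
  rewrite mul1r -[4%N]/(2 + 2)%N exprD; apply: ler_pM; rewrite ?sqr_ge0//.
    by rewrite lerXn2r ?nnegrE ?(ltW h0) ?(ltW hx0).
  by rewrite expr2; apply: ler_pM => //; exact: ltW.
have bound : W / (4 * pi ^+ 2) <= (K0 / (2 * pi * c) + 2) * (hx ^+ 2 + hy ^+ 2 + k).
  have -> : W / (4 * pi ^+ 2) = K0 / (2 * pi * c) * (hx ^+ 2 + hy ^+ 2 + k) +
      2 * (mode_theta nu ^+ N / (hx * hy)).
    rewrite /W /error_mass; move: (pi : R) p0 (mode_theta nu ^+ N) => q q0 t.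
    have qn : q != 0 by rewrite gt_eqF.
    have cn : c != 0 by rewrite gt_eqF.
    have hxn : hx != 0 by rewrite gt_eqF.
    have hyn : hy != 0 by rewrite gt_eqF.
    by field; rewrite ?qn ?cn ?hxn ?hyn.
  rewrite [leRHS]mulrDl lerD2l ler_wpM2l//.
  apply: (@le_trans _ _ (hx ^+ 2)); first by rewrite ler_pdivrMr ?mulr_gt0.
  by rewrite -addrA lerDl addr_ge0 ?sqr_ge0// ltW.
have WB : 0 <= W / (4 * pi ^+ 2) by rewrite divr_ge0 ?(ltW W0)// mulr_ge0// sqr_ge0.
apply: (@le_trans _ _ (sqrte ((W / (4 * pi ^+ 2)) ^+ 2)%:E)); last first.
  by rewrite /= sqrtr_sqr ger0_norm// lee_fin.
rewrite lee_sqrt ?lee_fin ?sqr_ge0// unlock.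
apply: le_trans E2; rewrite le_eqVlt; apply/orP; left; apply/eqP.
by apply: eq_integral => w _; rewrite VE real_normK// num_real.
Qed.
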